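(* Suppose $(X^n)_{n\in\mathbb{N}}$ converges to $X$ weakly in $L^2(\Omega,\mathcal{F},P)$ and $X^n\in\mathbb{D}^{1,2}_n$ for every $n\in\mathbb{N}$. Then the following are equivalent: (i) $\sup_{n\in\mathbb{N}}\frac1n\sum_{i=1}^\infty\mathbb{E}[(D^n_iX^n)^2]<\infty$. (ii) $X\in\mathbb{D}^{1,2}$ and $(D^n_{\lceil n\cdot\rceil}X^n)_{n\in\mathbb{N}}$ converges to $DX$ weakly in $L^2(\Omega\times[0,\infty))$.
   Context: Setting: $(\Omega,\mathcal{F},P)$ is a probability space carrying a Brownian motion $B=(B_t)_{t\ge 0}$, where $\mathcal{F}$ is the $\sigma$-field generated by $B$, completed by null sets. $\xi$ is a square-integrable random variable with zero expectation and variance one. For each $n\in\mathbb{N}=\{1,2,\dots\}$, $(\xi^n_i)_{i\in\mathbb{N}}$ is a sequence of independent random variables on $(\Omega,\mathcal{F},P)$ with the same distribution as $\xi$, and $B^n_t=\frac{1}{\sqrt n}\sum_{i=1}^{\lfloor nt\rfloor}\xi^n_i$. Standing assumption: for every $t\ge 0$, $B^n_t\to B_t$ in probability as $n\to\infty$. $\mathcal{F}^n=\sigma(\xi^n_i, i\in\mathbb{N})$ and $\mathcal{F}^n_{-i}=\sigma(\xi^n_j, j\in\mathbb{N}\setminus\{i\})$. $\mathcal{E}$ is the set of step functions $g=\sum_{j=1}^m a_j\mathbf{1}_{(b_j,c_j]}$, $m\in\mathbb{N}$, $a_j,b_j,c_j\in\mathbb{R}$ (regarded as functions on $[0,\infty)$).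 $I(f)$ is the Wiener integral of $f\in L^2([0,\infty))$ with respect to $B$, $\exp^{\diamond}(I(f))=\exp\left(I(f)-\frac12\int_0^\infty f(s)^2ds\right)$, and $(SX)(f)=\mathbb{E}[X\exp^{\diamond}(I(f))]$. $L^2(\Omega\times[0,\infty))$ is taken with respect to $\mathcal{F}\otimes\mathcal{B}([0,\infty))$ and $P\otimes\lambda$, $\lambda$ Lebesgue measure. Malliavin derivative: $X\in L^2(\Omega,\mathcal{F},P)$ belongs to $\mathbb{D}^{1,2}$ if there is $Z\in L^2(\Omega\times[0,\infty))$ such that for every $g,h\in\mathcal{E}$, $\int_0^\infty(SZ_s)(g)h(s)ds=\mathbb{E}\left[X\exp^{\diamond}(I(g))\left(I(h)-\int_0^\infty g(s)h(s)ds\right)\right]$; then $Z$ is unique and $DX:=Z$. $L^2_n(\Omega\times\mathbb{N})$ is the space of $Z^n:\mathbb{N}\to L^2(\Omega,\mathcal{F}^n,P)$ with $\frac1n\sum_{i\ge1}\mathbb{E}[(Z^n_i)^2]<\infty$; convention $Z^n_0=0$. Discretized Malliavin derivative: for $X\in L^2(\Omega,\mathcal{F},P)$ and $j\in\mathbb{N}$, $D^n_jX=\sqrt n\,\mathbb{E}[\xi^n_jX|\mathcal{F}^n_{-j}]$; $X\in\mathbb{D}^{1,2}_n$ means $D^nX:=(D^n_iX)_{i\in\mathbb{N}}\in L^2_n(\Omega\times\mathbb{N})$. $D^n_{\lceil n\cdot\rceil}X^n$ denotes the process $t\mapsto D^n_{\lceil nt\rceil}X^n$. *)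

(* Defs.v *)
From HB Require Import structures.
From mathcomp Require Import all_boot all_order all_algebra.
From mathcomp Require Import all_classical all_reals all_analysis.
From mathcomp Require Import measurable_realfun.

Set Implicit Arguments.
Unset Strict Implicit.
Unset Printing Implicit Defensive.

Import Order.TTheory GRing.Theory Num.Theory.
Import numFieldNormedType.Exports.

Local Open Scope classical_set_scope.
Local Open Scope ring_scope.

(* Sequences indexed by {1, 2, ...} are functions on nat whose value at 0 is
   ignored: quantifiers, sums, suprema and generated sigma-algebras only see
   the indices in pos_nat. *)
Definition pos_nat : set nat := [set n | (0 < n)%N].

Section sub_sigma_algebras.
Context d (T : measurableType d) (R : realType).

Definition sigma_of (I : Type) (J : set I) (X : I -> T -> R) : set (set T) :=
  <<s \bigcup_(i in J) preimage_set_system setT (X i) measurable >>.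

Definition measurable_wrt (G : set (set T)) (X : T -> R) : Prop :=
  preimage_set_system setT X measurable `<=` G.

Definition cond_exp_of (P : probability T R) (G : set (set T))
    (X Y : T -> R) : Prop :=
  [/\ measurable_wrt G Y, P.-integrable setT (EFin \o Y) &
      forall A, G A -> \int[P]_(w in A) Y w = \int[P]_(w in A) X w].

(* A version of E[X | G].  The default is never reached for integrable X and
   G a sub-sigma-algebra, see cond_expP below. *)
Definition cond_exp (P : probability T R) (G : set (set T)) (X : T -> R) :
    T -> R :=
  xget (cst 0) [set Y | cond_exp_of P G X Y].

Definition mutually_independent (P : probability T R) (I : choiceType)
    (J : set I) (X : I -> T -> R) : Prop :=
  forall (s : seq I) (A : I -> set R), uniq s -> [set` s] `<=` J ->
    (forall i, measurable (A i)) ->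
    P (\bigcap_(i in [set` s]) (X i @^-1` A i)) =
    (\prod_(i <- s) P (X i @^-1` A i))%E.

Definition cvg_in_probability (P : probability T R) (X_ : nat -> T -> R)
    (X : T -> R) : Prop :=
  forall e : R, 0 < e ->
    (fun n => P [set w | e <= `|X_ n w - X w|]) @ \oo --> 0%E.

End sub_sigma_algebras.

Section cond_exp_existence.
Context d (T : measurableType d) (R : realType) (P : probability T R).
Context (H : set (set T)) (subH : <<s H >> `<=` d.-measurable).

Local Notation TH := (g_sigma_algebraType H).
Let idH : T -> TH := idfun.

Let midH : measurable_fun setT idH.
Proof. by move=> _ A mA; rewrite setTI; exact: subH. Qed.

Lemma cond_expP (X : T -> R) : P.-integrable setT (EFin \o X) ->
  cond_exp_of P <<s H >> X (cond_exp P <<s H >> X).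
Proof.
move=> iX.
suff exY : exists Y, cond_exp_of P <<s H >> X Y by exact: (xgetPex _ exY).
pose nu_ : {charge set TH -> \bar R} := pushforward (induced_charge iX) idH.
pose nu := nu_ midH.
pose idM : {mfun T >-> TH} :=
  HB.pack idH (@isMeasurableFun.Build _ _ _ _ idH midH).
pose PH : probability TH R := distribution P idM.
have domi : nu `<< PH.
  apply/null_content_dominatesP => A mA PA0.
  have mA' : d.-measurable A by exact: subH.
  apply: (null_set_integral mA' _ PA0).
  exact: measurable_funTS (measurable_int P iX).
pose f := Radon_Nikodym nu PH.
have ffin x : f x \is a fin_num by exact: Radon_Nikodym_fin_num.
have mf : measurable_fun setT f.
  exact: measurable_int (Radon_Nikodym_integrable domi).
have fP : P.-integrable setT (f \o idH).
  apply/integrableP; split; first exact: measurableT_comp.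
  have /integrableP[_] := Radon_Nikodym_integrable domi.
  rewrite -/f /PH ge0_integral_pushforward//.
  exact: measurableT_comp.
have fE : EFin \o (fine \o f \o idH) = f \o idH.
  by apply/funext => w /=; rewrite fineK.
exists (fine \o f \o idH); split.
- move=> _ [A mA <-].
  have : measurable_fun setT (fine \o f) by exact: measurableT_comp.
  by move=> /(_ measurableT _ mA).
- by rewrite fE.
- move=> A GA.
  rewrite /Rintegral; congr fine.
  have mA : measurable (A : set TH) by [].
  have -> : (\int[P]_(w in A) (X w)%:E)%E = nu A by [].
  rewrite (Radon_Nikodym_integral domi mA).
  rewrite (@integral_pushforward _ _ _ _ _ _ midH P A f mf) //.
    by apply: eq_integral => w _ /=; rewrite fineK.
  by apply: integrableS fP => //=; exact: subH.
Qed.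
End cond_exp_existence.

Section brownian_motion.
Context d (T : measurableType d) (R : realType).
Context (P : probability T R) (B : R -> {RV P >-> R}).

Local Notation mu := (@lebesgue_measure R).

(* B is indexed by R for convenience; only its values at t >= 0 matter. *)
Record brownian_motion : Prop := BrownianMotion {
  bm_start : {ae P, forall w, B 0 w = 0} ;
  bm_indep_increments : forall t : nat -> R, 0 <= t 0%N ->
    (forall i, t i <= t i.+1) ->
    mutually_independent P [set: nat] (fun i => B (t i.+1) - B (t i)) ;
  bm_gaussian : forall s t : R, 0 <= s -> s < t ->
    forall A : set R, measurable A ->
    distribution P (B t - B s) A = normal_prob 0 (Num.sqrt (t - s)) A ;
  bm_continuous :
    {ae P, forall w, {within `[0, +oo[, continuous (fun t => B t w)}} }.

(* The ambient sigma-algebra is the P-completion of sigma(B_t, t >= 0). *)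
Definition completed_brownian_field : Prop :=
  let FB := sigma_of [set t : R | 0 <= t] (fun t => B t) in
  forall A : set T, measurable A <->
    exists A1 A2 : set T, [/\ FB A1, FB A2, A1 `<=` A, A `<=` A2 &
                              P (A2 `\` A1) = 0%E].

(* A list of triples (a, b, c) codes the step function
   sum_j a_j 1_(b_j, c_j]. *)
Definition step := seq (R * R * R).

Definition step_fun (g : step) (s : R) : R :=
  \sum_(p <- g) p.1.1 * \1_(`]p.1.2, p.2]) s.

(* On [0, oo[ the interval (b, c] is (b v 0, b v c v 0], also when it is
   empty or meets the negative half-line. *)
Definition wiener_int (g : step) (w : T) : R :=
  \sum_(p <- g) p.1.1 *
    (B (Num.max 0 (Num.max p.1.2 p.2)) w - B (Num.max 0 p.1.2) w).

Definition wick_exp (g : step) (w : T) : R :=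
  expR (wiener_int g w -
        2^-1 * \int[mu]_(s in `[0, +oo[) (step_fun g s ^+ 2)).

Definition S_transform (X : T -> R) (g : step) : R :=
  \int[P]_w (X w * wick_exp g w).

Lemma measurable_setX_time : measurable ([set: T] `*` (`[0, +oo[ : set R)).
Proof. by apply: measurableX => //; exact: measurable_itv. Qed.

(* P \x Lebesgue on T * [0, oo[, as a measure on T * R. *)
Definition P_time : {measure set (T * measurableTypeR R) -> \bar R} :=
  mrestr (P \x mu)%E measurable_setX_time.

Definition malliavin_derivative_of (X : T -> R) (Z : T * R -> R) : Prop :=
  [/\ X \in Lfun P 2%:E, Z \in Lfun P_time 2%:E &
      forall g h : step,
        \int[mu]_(s in `[0, +oo[)
          (S_transform (fun w => Z (w, s)) g * step_fun h s) =
        \int[P]_w (X w * wick_exp g w *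
          (wiener_int h w -
           \int[mu]_(s in `[0, +oo[) (step_fun g s * step_fun h s)))].

End brownian_motion.

Section discretization.
Context d (T : measurableType d) (R : realType) (P : probability T R).
Context (xi : nat -> nat -> T -> R) (n : nat).

Definition random_walk (t : R) (w : T) : R :=
  (Num.sqrt n%:R)^-1 * \sum_(1 <= i < (Num.truncn (n%:R * t)).+1) xi n i w.

Definition Fn : set (set T) := sigma_of pos_nat (xi n).

Definition Fn_minus (j : nat) : set (set T) :=
  sigma_of (pos_nat `\ j) (xi n).

(* The value 0 at index 0 is the convention for elements of L^2_n. *)
Definition disc_malliavin (X : T -> R) (j : nat) : T -> R :=
  if j == 0%N then cst 0 else
  fun w => Num.sqrt n%:R *
    cond_exp P (Fn_minus j) (fun w' => xi n j w' * X w') w.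

Definition L2n_sqnorm (Z : nat -> T -> R) : \bar R :=
  ((n%:R^-1)%:E * \sum_(1 <= i <oo) 'E_P[fun w => (Z i w ^+ 2)%R])%E.

Definition in_L2n (Z : nat -> T -> R) : Prop :=
  (forall i, pos_nat i -> measurable_wrt Fn (Z i) /\ Z i \in Lfun P 2%:E) /\
  (L2n_sqnorm Z < +oo)%E.

Definition in_D12n (X : T -> R) : Prop :=
  X \in Lfun P 2%:E /\ in_L2n (disc_malliavin X).

(* (w, t) |-> D^n_{ceil(n t)} X w; the truncation at 0 only concerns t < 0,
   which P_time does not charge. *)
Definition disc_malliavin_process (X : T -> R) (p : T * R) : R :=
  disc_malliavin X (absz (Num.max 0 (Num.ceil (n%:R * p.2)))) p.1.

End discretization.

Definition weakly_converges_L2 d (T : measurableType d) (R : realType)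
    (m : {measure set T -> \bar R}) (f_ : nat -> T -> R) (f : T -> R) : Prop :=
  [/\ forall n, pos_nat n -> f_ n \in Lfun m 2%:E, f \in Lfun m 2%:E &
      forall g : T -> R, g \in Lfun m 2%:E ->
        (fun n => \int[m]_x (f_ n x * g x)) @ \oo --> \int[m]_x (f x * g x)].

(* Main.v *)
Require Import Defs.
From HB Require Import structures.
From mathcomp Require Import all_boot all_order all_algebra.
From mathcomp Require Import all_classical all_reals all_analysis.
From mathcomp Require Import measurable_realfun.
From mathcomp Require Import ring lra.

Import Order.TTheory GRing.Theory Num.Theory.
Import numFieldNormedType.Exports.

Local Open Scope classical_set_scope.
Local Open Scope ring_scope.

Set Implicit Arguments.
Unset Strict Implicit.
Unset Printing Implicit Defensive.

(** The process Z_n : (w, t) |-> D^n_(ceil(nt)) X^n is constant on time cells of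
    length 1/n, so its squared norm in L2(P x dt) is the quantity bounded in (i)
    ([integral_step_process_sqr]). Weakly convergent sequences are bounded
    ([L2_uniform_boundedness]), hence (ii) implies (i).

    For the converse, Z_n is tested against cos(L + a) 1_(0,t], where
    L = sum a_k B_(t_k). Let L^n be the same combination of the walk B^n, let
    x_i = xi^n_i / sqrt n and let c_i be the coefficient of x_i in L^n. The
    function cos(L^n - c_i x_i + a) does not involve xi^n_i, so that it can be
    pulled into the conditional expectation in D^n_i X^n. Expanding the cosine,
      (1/n) sum_(i <= nt) E[D^n_i X^n cos(L^n - c_i x_i + a)]
        = E[X^n (cos(L^n + a) C_n + sin(L^n + a) S_n)],
    with C_n = sum_(i <= nt) x_i cos(c_i x_i) and
    S_n = sum_(i <= nt) x_i sin(c_i x_i) ([disc_malliavin_duality]). Now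
    C_n -> B_t and S_n -> kappa = sum a_k min(t_k, t) in L2 ([cos_sum_cvg],
    [sin_sum_cvg]), and B^n_t -> B_t in L2 ([walk_cvg_L2]). As X^n converges
    weakly,
      <Z_n, cos(L + a) 1_(0,t]> -> E[X (cos(L + a) B_t + sin(L + a) kappa)]
    ([process_trig_cvg]). Trigonometric functions are used instead of
    exponentials because xi need not have exponential moments.

    When (Z_n) is bounded, the v for which <Z_n, v> converges form a closed
    subspace. The trigonometric processes are total, since the ambient
    sigma-algebra is generated by B up to null sets ([trigonometric_total]).
    So <Z_n, v> converges for all v, and the limit is <Z, v> for some Z by the
    Riesz representation ([bounded_weak_limit]).

    It remains to recognise Z as DX, whose definition involves exponentials.
    The identity <Z, F(L) 1_(0,t]> = E[X (F(L) B_t - kappa F'(L))] holds for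
    F = cos(. + a) and is stable under multiplication by sines, so it holds for
    F(x) = exp(m sin(x/m)); letting m tend to infinity, it holds for the
    exponential ([exponential_duality]). Linear combinations over t give the
    identity that defines DX ([malliavin_derivative_of_dual]). *)

(** * Square-integrable functions *)

Lemma measurable_fun_limR d (T : measurableType d) (R : realType)
    (f_ : nat -> T -> R) (f : T -> R) :
  (forall n, measurable_fun setT (f_ n)) ->
  (forall x, f_ n x @[n --> \oo] --> f x) -> measurable_fun setT f.
Proof.
move=> mf cf; apply/measurable_EFinP.
apply: (emeasurable_fun_cvg (fun n => EFin \o f_ n)).
  by move=> n; exact/measurable_EFinP.
by move=> x _; apply: cvg_EFin; [exact: nearW|exact: cf].
Qed.

Section L2.
Context d (T : measurableType d) (R : realType) (m : {measure set T -> \bar R}).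
Implicit Types (f g h : T -> R) (a : R).

Local Notation L2 := (Lfun m 2%:E).
Local Notation integrable := (m.-integrable setT).

Lemma Lfun2_measurable f : f \in L2 -> measurable_fun setT f.
Proof. by move=> /andP[+ _]; rewrite inE. Qed.

Lemma Lfun2P f : f \in L2 <->
  measurable_fun setT f /\ integrable (EFin \o (fun x => f x ^+ 2)).
Proof.
split=> [fL|[mf ifx]].
  by split; [exact: Lfun2_measurable|exact: Lfun2_integrable_sqr].
rewrite inE; apply/andP; split; rewrite inE//=.
rewrite /finite_norm unlock /=.
have /integrableP[_ +] := ifx => iffin.
apply: poweR_lty; apply: le_lt_trans iffin.
rewrite le_eqVlt; apply/orP; left; apply/eqP.
apply: eq_integral => x _ /=.
by rewrite powR_mulrn// normrX.
Qed.

Lemma Lfun2D f g : f \in L2 -> g \in L2 -> (fun x => f x + g x) \in L2.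
Proof. by move=> fL gL; apply: (Lfun_addr_closed m (lee1n 2)).2. Qed.

Lemma Lfun2Z a f : f \in L2 -> (fun x => a * f x) \in L2.
Proof.
move=> fL; have := (Lfun_submod_closed m (lee1n 2)).2 a _ _ fL
  (Lfun_submod_closed m (lee1n 2)).1.
by rewrite addr0.
Qed.

Lemma Lfun2_0 : (fun=> 0 : R) \in L2.
Proof. exact: (Lfun_submod_closed m (lee1n 2)).1. Qed.

Lemma Lfun2B f g : f \in L2 -> g \in L2 -> (fun x => f x - g x) \in L2.
Proof.
move=> fL gL; have := Lfun2D fL (Lfun2Z (-1) gL).
by under eq_fun do rewrite mulN1r.
Qed.

Lemma Lfun2_sum (I : Type) (s : seq I) (F : I -> T -> R) :
  (forall i, F i \in L2) -> (fun x => \sum_(i <- s) F i x) \in L2.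
Proof.
move=> FL; elim: s => [|i s IH].
  by under eq_fun do rewrite big_nil; exact: Lfun2_0.
by under eq_fun do rewrite big_cons; exact: Lfun2D.
Qed.

Lemma Lfun2_le f g : measurable_fun setT f -> g \in L2 ->
  (forall x, `|f x| <= `|g x|) -> f \in L2.
Proof.
move=> mf /Lfun2P[mg ig] fg; apply/Lfun2P; split => //.
apply: le_integrable ig => //.
  by apply/measurable_EFinP; exact: measurable_funX.
by move=> x _ /=; rewrite lee_fin !normrX lerXn2r ?nnegrE.
Qed.

Lemma Lfun2_integrableM f g : f \in L2 -> g \in L2 ->
  integrable (EFin \o (fun x => f x * g x)).
Proof. by move=> fL gL; apply/Lfun1_integrable; exact: Lfun2_mul_Lfun1. Qed.

Definition dotp f g : R := \int[m]_x (f x * g x).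
Definition L2norm f : R := Num.sqrt (dotp f f).

Lemma dotpC f g : dotp f g = dotp g f.
Proof. by apply: eq_Rintegral => x _; rewrite mulrC. Qed.

Lemma dotp_ge0 f : 0 <= dotp f f.
Proof. by apply: Rintegral_ge0 => x _; rewrite -expr2 sqr_ge0. Qed.

Lemma dotpDl f g h : f \in L2 -> g \in L2 -> h \in L2 ->
  dotp (fun x => f x + g x) h = dotp f h + dotp g h.
Proof.
move=> fL gL hL; rewrite /dotp -RintegralD//; try exact: Lfun2_integrableM.
by apply: eq_Rintegral => x _; rewrite mulrDl.
Qed.

Lemma dotpZl a f h : f \in L2 -> h \in L2 ->
  dotp (fun x => a * f x) h = a * dotp f h.
Proof.
move=> fL hL; rewrite /dotp -RintegralZl//; try exact: Lfun2_integrableM.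
by apply: eq_Rintegral => x _; rewrite mulrA.
Qed.

Lemma dotpBl f g h : f \in L2 -> g \in L2 -> h \in L2 ->
  dotp (fun x => f x - g x) h = dotp f h - dotp g h.
Proof.
move=> fL gL hL; rewrite /dotp -RintegralB//; try exact: Lfun2_integrableM.
by apply: eq_Rintegral => x _; rewrite mulrBl.
Qed.

Lemma dotpDr f g h : f \in L2 -> g \in L2 -> h \in L2 ->
  dotp h (fun x => f x + g x) = dotp h f + dotp h g.
Proof. by move=> ? ? ?; rewrite !(dotpC h) dotpDl. Qed.

Lemma dotpBr f g h : f \in L2 -> g \in L2 -> h \in L2 ->
  dotp h (fun x => f x - g x) = dotp h f - dotp h g.
Proof. by move=> ? ? ?; rewrite !(dotpC h) dotpBl. Qed.

Lemma dotpZr a f h : f \in L2 -> h \in L2 ->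
  dotp h (fun x => a * f x) = a * dotp h f.
Proof. by move=> ? ?; rewrite !(dotpC h) dotpZl. Qed.

Lemma dotp_sumr (I : Type) (s : seq I) (F : I -> T -> R) h :
  (forall i, F i \in L2) -> h \in L2 ->
  dotp h (fun x => \sum_(i <- s) F i x) = \sum_(i <- s) dotp h (F i).
Proof.
move=> FL hL; elim: s => [|i s IH].
  rewrite big_nil /dotp -[RHS](mul0r (\int[m]_x (h x * h x))).
  rewrite -RintegralZl//; last exact: Lfun2_integrableM.
  by apply: eq_Rintegral => x _; rewrite big_nil mulr0 mul0r.
rewrite big_cons -IH -dotpDr//; last exact: Lfun2_sum.
by apply: eq_Rintegral => x _; rewrite big_cons.
Qed.

Lemma L2norm_ge0 f : 0 <= L2norm f.
Proof. exact: sqrtr_ge0. Qed.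

Lemma L2norm_sqr f : L2norm f ^+ 2 = dotp f f.
Proof. by rewrite sqr_sqrtr// dotp_ge0. Qed.

Lemma L2normZ a f : f \in L2 -> L2norm (fun x => a * f x) = `|a| * L2norm f.
Proof.
move=> fL; rewrite /L2norm dotpZl ?Lfun2Z// dotpZr// mulrA -expr2.
by rewrite sqrtrM ?sqr_ge0// sqrtr_sqr.
Qed.

Lemma L2normBC f g : L2norm (fun x => f x - g x) = L2norm (fun x => g x - f x).
Proof.
by congr Num.sqrt; apply: eq_Rintegral => x _; rewrite -mulrNN !opprB.
Qed.

Lemma dotp_ge0_quadratic f g a : f \in L2 -> g \in L2 ->
  0 <= dotp f f + a * dotp f g *+ 2 + a ^+ 2 * dotp g g.
Proof.
move=> fL gL; have := dotp_ge0 (fun x => f x + a * g x).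
have agL := Lfun2Z a gL.
rewrite dotpDl ?Lfun2D// !dotpDr// !dotpZr// !dotpZl// (dotpC g f).
by congr (_ <= _); ring.
Qed.

Lemma L2_CauchySchwarz f g : f \in L2 -> g \in L2 ->
  `|dotp f g| <= L2norm f * L2norm g.
Proof.
move=> fL gL; rewrite -(@ler_pXn2r _ 2)// ?nnegrE ?mulr_ge0 ?L2norm_ge0//.
rewrite exprMn !L2norm_sqr real_normK ?num_real//.
have [g0|g0] := eqVneq (dotp g g) 0.
  rewrite g0 mulr0; have [->|fg0] := eqVneq (dotp f g) 0; first by rewrite expr0n.
  have := dotp_ge0_quadratic (- (dotp f f + 1) / (dotp f g *+ 2)) fL gL.
  rewrite g0 mulr0 addr0 -mulrnAr mulfVK ?mulrn_eq0//; lra.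
have := dotp_ge0_quadratic (- dotp f g / dotp g g) fL gL.
have gp : 0 < dotp g g by rewrite lt_def g0 dotp_ge0.
move/(mulr_ge0 (ltW gp)) => H.
rewrite -subr_ge0; apply: le_trans H _; rewrite le_eqVlt; apply/orP; left.
by apply/eqP; field.
Qed.

Lemma L2normD f g : f \in L2 -> g \in L2 ->
  L2norm (fun x => f x + g x) <= L2norm f + L2norm g.
Proof.
move=> fL gL; rewrite -(@ler_pXn2r _ 2)// ?nnegrE ?addr_ge0 ?L2norm_ge0//.
rewrite sqrrD !L2norm_sqr dotpDl ?Lfun2D// !dotpDr// (dotpC g f).
have := le_trans (ler_norm _) (L2_CauchySchwarz fL gL); lra.
Qed.

Lemma L2normB f g : f \in L2 -> g \in L2 ->
  L2norm (fun x => f x - g x) <= L2norm f + L2norm g.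
Proof.
move=> fL gL; have := L2normD fL (Lfun2Z (-1) gL).
rewrite (L2normZ _ gL) normrN1 mul1r; apply: le_trans.
by rewrite le_eqVlt; apply/orP; left; apply/eqP; congr L2norm;
  apply/funext => x; rewrite mulN1r.
Qed.

Lemma L2norm_distD f g h : f \in L2 -> g \in L2 -> h \in L2 ->
  L2norm (fun x => f x - h x) <=
  L2norm (fun x => f x - g x) + L2norm (fun x => g x - h x).
Proof.
move=> fL gL hL; have := L2normD (Lfun2B fL gL) (Lfun2B gL hL).
by under [X in L2norm X <= _]eq_fun do rewrite addrA subrK.
Qed.

Lemma L2norm_sum (I : Type) (s : seq I) (F : I -> T -> R) :
  (forall i, F i \in L2) ->
  L2norm (fun x => \sum_(i <- s) F i x) <= \sum_(i <- s) L2norm (F i).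
Proof.
move=> FL; elim: s => [|i s IH].
  rewrite big_nil /L2norm; under eq_fun do rewrite big_nil.
  by rewrite /dotp; under eq_Rintegral do rewrite mul0r;
    rewrite Rintegral_cst// mul0r sqrtr0.
rewrite big_cons; under eq_fun do rewrite big_cons.
by apply: le_trans (L2normD _ _) _ => //; [exact: Lfun2_sum|rewrite lerD2l].
Qed.

Lemma L2norm_le f g : measurable_fun setT f -> g \in L2 ->
  (forall x, `|f x| <= `|g x|) -> L2norm f <= L2norm g.
Proof.
move=> mf gL fg; have fL := Lfun2_le mf gL fg.
rewrite ler_sqrt ?dotp_ge0//; apply: le_Rintegral => //; try exact: Lfun2_integrableM.
by move=> x _; rewrite -!expr2 -(real_normK (num_real (f x)))
  -(real_normK (num_real (g x))) lerXn2r ?nnegrE.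
Qed.

Lemma L2norm_int f : f \in L2 ->
  ((L2norm f ^+ 2)%:E = \int[m]_x (f x ^+ 2)%:E)%E.
Proof.
move=> fL; rewrite L2norm_sqr /dotp /Rintegral fineK.
  by apply: eq_integral => x _; rewrite expr2.
by apply: integrable_fin_num => //; exact: Lfun2_integrableM.
Qed.

Lemma dotp_ae_eq f g h : f \in L2 -> g \in L2 -> h \in L2 ->
  {ae m, forall x, f x = g x} -> dotp f h = dotp g h.
Proof.
move=> fL gL hL fg; congr fine; apply: ae_eq_integral => //.
- by apply: measurable_int; exact: Lfun2_integrableM.
- by apply: measurable_int; exact: Lfun2_integrableM.
- by apply: filterS fg => x fgx _; rewrite /= fgx.
Qed.

(** Dominated convergence for (f_ n - f)^2, bounded by (2 g)^2. *)
Lemma L2_dominated_cvg (f_ : nat -> T -> R) f g :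
  (forall n, measurable_fun setT (f_ n)) -> g \in L2 ->
  (forall n x, `|f_ n x| <= g x) ->
  (forall x, f_ n x @[n --> \oo] --> f x) ->
  f \in L2 /\ L2norm (fun x => f_ n x - f x) @[n --> \oo] --> 0.
Proof.
move=> mf gL fg cf.
have mfl : measurable_fun setT f by exact: measurable_fun_limR mf cf.
have flg x : `|f x| <= g x.
  have cx : `|f_ n x| @[n --> \oo] --> `|f x| by apply: cvg_norm; exact: cf.
  rewrite -(cvg_lim _ cx)//; apply: limr_le; first by apply/cvg_ex; eexists; exact: cx.
  by near=> n; exact: fg.
have g0 x : 0 <= g x by apply: le_trans (flg x).
have fL : f \in L2 by apply: Lfun2_le gL _ => // x; rewrite (ger0_norm (g0 x)).
split => //.
have fnL n : f_ n \in L2 by apply: Lfun2_le gL _ => // x; rewrite (ger0_norm (g0 x)).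
have dL n : (fun x => f_ n x - f x) \in L2 by exact: Lfun2B.
suff : (\int[m]_x ((f_ n x - f x) ^+ 2)%:E @[n --> \oo] --> 0)%E.
  move=> H; rewrite -[X in _ --> X]sqrtr0; apply: continuous_cvg.
    exact: sqrt_continuous.
  move/fine_cvgP : H => [_]; apply: cvg_trans; apply: near_eq_cvg.
  by near=> n; rewrite /= -L2norm_int// L2norm_sqr.
have ig : m.-integrable setT (EFin \o (fun x => (2 * g x) ^+ 2)).
  by have /Lfun2P[] := Lfun2Z 2 gL.
have := @dominated_convergence _ _ _ m setT measurableT
  (fun n x => ((f_ n x - f x) ^+ 2)%:E) (fun=> 0%E)
  (EFin \o (fun x => (2 * g x) ^+ 2)).
case => //.
- by move=> n; apply/measurable_EFinP; apply: measurable_funX; exact: measurable_funB.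
- apply: aeW => x _; apply: cvg_EFin; first exact: nearW.
  have cx : f_ n x - f x @[n --> \oo] --> 0.
    by rewrite -(subrr (f x)); apply: cvgB; [exact: cf|exact: cvg_cst].
  rewrite [X in X @ _ --> _](_ : _ = (fun n => (f_ n x - f x) * (f_ n x - f x))).
    by rewrite -[X in _ --> X](mulr0 (0 : R)); exact: cvgM.
  by apply/funext => n; rewrite /= expr2.
- apply: aeW => x n _; rewrite /= lee_fin ger0_norm ?sqr_ge0//.
  rewrite -(real_normK (num_real (f_ n x - f x))) lerXn2r ?nnegrE//.
    by rewrite mulr_ge0.
  by rewrite (le_trans (ler_normB _ _))// mulrC mulr_natr mulr2n lerD// flg.
- by move=> _ _; rewrite integral0.
Unshelve. all: by end_near. Qed.

End L2.

(** * Completeness of L2, uniform boundedness and representation *)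

Lemma le_cvg (R : realType) (a l : R) (u : nat -> R) :
  (forall n, a <= u n) -> u n @[n --> \oo] --> l -> a <= l.
Proof.
move=> au ul; rewrite -(cvg_lim _ ul)//; apply: limr_ge.
  by apply/cvg_ex; exists l.
exact: nearW.
Qed.

Lemma cvg_le (R : realType) (a l : R) (u : nat -> R) :
  (forall n, u n <= a) -> u n @[n --> \oo] --> l -> l <= a.
Proof.
move=> au ul; rewrite -(cvg_lim _ ul)//; apply: limr_le.
  by apply/cvg_ex; exists l.
exact: nearW.
Qed.

Lemma norm_le_cvg0 (R : realType) (u v : nat -> R) :
  (forall n, `|u n| <= v n) -> v n @[n --> \oo] --> 0 -> u n @[n --> \oo] --> 0.
Proof.
move=> uv v0; apply/norm_cvg0P.
apply: (@squeeze_cvgr _ _ _ _ (fun=> 0) v) => //; last exact: cvg_cst.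
by apply: nearW => n; rewrite /= normr_ge0 uv.
Qed.

Lemma norm_sub_le_cvg (R : realType) (u v : nat -> R) (l : R) :
  (forall n, `|u n - l| <= v n) -> v n @[n --> \oo] --> 0 ->
  u n @[n --> \oo] --> l.
Proof.
move=> uv v0; rewrite (_ : u = fun n => (u n - l) + l); last first.
  by apply/funext => n; rewrite subrK.
rewrite -[X in _ --> X](add0r l); apply: cvgD; last exact: cvg_cst.
exact: norm_le_cvg0 uv v0.
Qed.

Section L2_complete.
Context d (T : measurableType d) (R : realType) (m : {measure set T -> \bar R}).
Implicit Types (f g h : T -> R) (a : R).

Local Notation L2 := (Lfun m 2%:E).
Local Notation nrm := (L2norm m).
Local Notation dot := (dotp m).

Lemma L2norm_ae_eq f g : f \in L2 -> g \in L2 ->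
  {ae m, forall x, f x = g x} -> nrm f = nrm g.
Proof.
move=> fL gL fg; congr Num.sqrt.
by rewrite (dotp_ae_eq fL gL fL fg) dotpC (dotp_ae_eq fL gL gL fg).
Qed.

Lemma L2norm_abs f : nrm (fun x => `|f x|) = nrm f.
Proof.
congr Num.sqrt; apply: eq_Rintegral => x _.
by rewrite -!expr2 real_normK// num_real.
Qed.

Lemma Lfun2_abs f : f \in L2 -> (fun x => `|f x|) \in L2.
Proof.
move=> fL; apply: (Lfun2_le _ fL) => [|x]; last by rewrite normr_id.
by apply: measurableT_comp => //; exact: Lfun2_measurable fL.
Qed.

(** By monotone convergence the squares increase to an integrable limit, which
    is finite off a null set; its square root is the majorant. *)
Lemma L2_monotone_bounded (G_ : nat -> T -> R) M :
  (forall n, G_ n \in L2) -> (forall n x, 0 <= G_ n x) ->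
  (forall n x, G_ n x <= G_ n.+1 x) -> (forall n, nrm (G_ n) <= M) ->
  exists E G, [/\ measurable E, m (~` E) = 0%E, G \in L2 &
    forall n x, E x -> G_ n x <= G x].
Proof.
move=> GL G0 Gnd GM.
have M0 : 0 <= M by apply: le_trans (GM 0%N); exact: L2norm_ge0.
pose g' n x := ((G_ n x ^+ 2)%:E)%E.
have mg' n : measurable_fun setT (g' n).
  by apply/measurable_EFinP; apply: measurable_funX; exact: Lfun2_measurable.
have g'0 n x : setT x -> (0 <= g' n x)%E by rewrite lee_fin sqr_ge0.
have nd x : setT x -> nondecreasing_seq (g' ^~ x).
  move=> _; apply/nondecreasing_seqP => n.
  by rewrite lee_fin lerXn2r ?nnegrE.
pose f x := limn (g' ^~ x).
have cf x : g' n x @[n --> \oo] --> f x by exact: ereal_nondecreasing_is_cvgn (nd x I).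
have mf : measurable_fun setT f.
  by apply: (emeasurable_fun_cvg g' f) => // x _; exact: cf.
have f0 x : (0 <= f x)%E.
  by apply: lime_ge; [exact: cf|apply: nearW => n; exact: g'0].
have fM : (\int[m]_x f x <= (M ^+ 2)%:E)%E.
  rewrite (monotone_convergence m measurableT mg' g'0 nd).
  apply: lime_le.
    apply: ereal_nondecreasing_is_cvgn; apply/nondecreasing_seqP => n.
    apply: ge0_le_integral => // x _; first exact: g'0.
    by apply: nd => //; exact: leqnSn.
  apply: nearW => n; rewrite -L2norm_int// lee_fin lerXn2r ?nnegrE ?L2norm_ge0//.
have fi : m.-integrable setT f.
  apply/integrableP; split => //.
  under eq_integral do rewrite gee0_abs//.
  by apply: le_lt_trans fM _; rewrite ltry.
have gf n x : (g' n x <= f x)%E.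
  apply: lime_ge; first exact: cf.
  by near=> k; apply: nd => //; near: k; exists n.
pose E := [set x | (f x < +oo)%E].
have mE : measurable E.
  by rewrite -[E]setTI; exact: emeasurable_fun_infty_o.
exists E, (fun x => Num.sqrt (fine (f x))); split => //.
- have [N [mN N0 EN]] := integrable_ae measurableT fi.
  apply: (subset_measure0 _ mN _ N0); first exact: measurableC.
  apply: subset_trans EN => x /= nE H; apply: nE.
  by rewrite /E/= -ge0_fin_numE// H.
- apply/Lfun2P; split.
    apply: measurableT_comp; last exact: measurableT_comp.
    exact: continuous_measurable_fun (@sqrt_continuous R).
  apply: le_integrable fi => //.
    apply/measurable_EFinP; apply: measurable_funX.
    apply: measurableT_comp; last exact: measurableT_comp.
    exact: continuous_measurable_fun (@sqrt_continuous R).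
  move=> x _ /=; rewrite sqr_sqrtr ?fine_ge0// ger0_norm ?fine_ge0//.
  have := f0 x; case: (f x) => //= r r0; by rewrite lee_fin ler_norm.
- move=> n x Ex; have := gf n x.
  have fx : f x \is a fin_num by rewrite ge0_fin_numE.
  rewrite -{1}(fineK fx) lee_fin => H.
  by rewrite -(ger0_norm (G0 n x)) -sqrtr_sqr ler_sqrt// fine_ge0.
Unshelve. all: by end_near. Qed.

(** Completeness, for increments that decay geometrically. The partial sums of
    the absolute increments have an L2 majorant, so the sequence converges
    almost everywhere and under a dominating function. Keeping track of the
    rate is what makes the two arguments below quantitative. *)
Lemma L2_geometric_limit (x_ : nat -> T -> R) (c r : R) :
  (forall k, x_ k \in L2) -> 0 <= c -> 0 < r -> r < 1 ->
  (forall k, nrm (fun t => x_ k.+1 t - x_ k t) <= c * r ^+ k) ->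
  exists2 x, x \in L2 &
    forall k, nrm (fun t => x t - x_ k t) <= c * r ^+ k / (1 - r).
Proof.
move=> xL c0 r0 r1 xc.
have r1' : 0 < 1 - r by rewrite subr_gt0.
have dL k l : (fun t => x_ k t - x_ l t) \in L2 by exact: Lfun2B.
have dist k j : nrm (fun t => x_ (k + j)%N t - x_ k t) <= c * r ^+ k / (1 - r).
  have : nrm (fun t => x_ (k + j)%N t - x_ k t) <=
      c * r ^+ k * (1 - r ^+ j) / (1 - r).
    elim: j => [|j IH].
      rewrite addn0 expr0 subrr mulr0 mul0r /L2norm /dotp.
      under eq_Rintegral do rewrite subrr mul0r.
      by rewrite Rintegral_cst// mul0r sqrtr0.
    apply: le_trans (L2norm_distD (xL _) (xL (k + j)%N) (xL _)) _.
    rewrite addnS; apply: le_trans (lerD (xc _) IH) _.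
    rewrite -subr_ge0 exprD exprS le_eqVlt; apply/orP; left; apply/eqP.
    by field; rewrite gt_eqF.
  move/le_trans; apply; rewrite ler_pM2r ?invr_gt0//.
  rewrite ler_piMr ?mulr_ge0 ?exprn_ge0 ?(ltW r0)//.
  by rewrite lerBlDr lerDl exprn_ge0// ltW.
pose G_ n x := \sum_(0 <= j < n) `|x_ j.+1 x - x_ j x|.
have GL n : G_ n \in L2 by apply: Lfun2_sum => j; exact: Lfun2_abs.
have GM n : nrm (G_ n) <= c / (1 - r).
  apply: le_trans (L2norm_sum _ _) _; first by move=> j; exact: Lfun2_abs.
  have -> : \sum_(0 <= j < n) nrm (fun t => `|x_ j.+1 t - x_ j t|) =
      \sum_(0 <= j < n) nrm (fun t => x_ j.+1 t - x_ j t).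
    by apply: eq_bigr => j _; rewrite L2norm_abs.
  apply: (@le_trans _ _ (\sum_(0 <= j < n) c * r ^+ j)).
    by apply: ler_sum => j _.
  have -> : \sum_(0 <= j < n) c * r ^+ j = c * (1 - r ^+ n) / (1 - r).
    elim: n => [|n IH]; first by rewrite big_nil expr0 subrr mulr0 mul0r.
    by rewrite big_nat_recr//= IH exprS; field; rewrite gt_eqF.
  rewrite ler_pM2r ?invr_gt0// ler_piMr// lerBlDr lerDl exprn_ge0// ltW//.
have G0 n x : 0 <= G_ n x by apply: sumr_ge0.
have [n x|E [G [mE E0 GinL GE]]] := L2_monotone_bounded GL G0 _ GM.
  by rewrite /G_ big_nat_recr//= lerDl.
have cx x : E x -> cvgn (x_ ^~ x).
  move=> Ex.
  have : cvgn (series (fun j => x_ j.+1 x - x_ j x)).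
    apply: normed_cvg; apply: nondecreasing_is_cvgn.
      by apply: nondecreasing_series => j _ _; rewrite normr_ge0.
    exists (G x) => _ [n _ <-]; exact: GE.
  have -> : x_ ^~ x = (fun n => series (fun j => x_ j.+1 x - x_ j x) n + x_ 0%N x).
    by apply/funext => n; rewrite /series/= telescope_sumr// subrK.
  by move=> H; apply: is_cvgD => //; exact: is_cvg_cst.
pose y_ n x := x_ n x * \1_E x.
have cy x : y_ n x @[n --> \oo] --> limn (y_ ^~ x).
  have [Ex|Ex] := pselect (E x).
    by apply: is_cvgMl; exact: cx.
  rewrite (_ : y_ ^~ x = cst 0); first exact: is_cvg_cst.
  by apply/funext => n; rewrite /y_ indicE memNset// mulr0.
have my n : measurable_fun setT (y_ n).
  by apply: measurable_funM; [exact: Lfun2_measurable (xL n)|exact: measurable_indic].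
pose x t := limn (y_ ^~ t).
have ybound n t : `|y_ n t| <= `|x_ 0%N t| + `|G t|.
  rewrite /y_ indicE; have [tE|tE] := boolP (t \in E); last first.
    by rewrite mulr0 normr0 addr_ge0.
  rewrite mulr1.
  have -> : x_ n t = x_ 0%N t + \sum_(0 <= j < n) (x_ j.+1 t - x_ j t).
    by rewrite telescope_sumr// addrC subrK.
  apply: le_trans (ler_normD _ _) _; rewrite lerD2l.
  apply: le_trans (ler_norm_sum _ _ _) _.
  by apply: le_trans (GE n t _) (ler_norm _); exact: set_mem.
have gL : (fun t => `|x_ 0%N t| + `|G t|) \in L2.
  by apply: Lfun2D; exact: Lfun2_abs.
have [xinL cvx] := L2_dominated_cvg my gL ybound cy.
exists x => // k.
have yL n : y_ n \in L2.
  apply: Lfun2_le (my n) (xL n) _ => t.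
  rewrite /y_ normrM ler_piMr// indicE; case: (_ \in _); by rewrite ?normr1 ?normr0.
have yx n : nrm (fun t => y_ n t - x t) = nrm (fun t => x_ n t - x t).
  apply: L2norm_ae_eq; [exact: Lfun2B|exact: Lfun2B|].
  exists (~` E); split => //; first exact: measurableC.
  move=> t /= H Et; by apply: H; rewrite /y_ indicE (mem_set Et) mulr1.
rewrite leNgt; apply/negP => H.
pose e := nrm (fun t => x t - x_ k t) - c * r ^+ k / (1 - r).
have e0 : 0 < e by rewrite subr_gt0.
move/cvgrPdist_lt : cvx => /(_ _ e0)[N _ /(_ (maxn N k))].
rewrite /= leq_maxl => /(_ isT).
rewrite sub0r normrN ger0_norm ?L2norm_ge0// yx; apply/negP; rewrite -leNgt.
rewrite lerBlDl -lerBlDr -/(x _) L2normBC.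
have := L2norm_distD (xL k) (xL (maxn N k)) xinL.
rewrite (L2normBC _ (x_ k) (x_ _)).
have := dist k (maxn N k - k)%N; rewrite subnKC ?leq_maxr// => H1 H2.
by rewrite lerBlDr; apply: le_trans H2 _; rewrite lerD2r.
Qed.

(** A gliding hump. If the norms are unbounded, choose phi k among the f_ n
    with norm above k 3^k and walk by steps of length 3^-k in the directions
    phi k, signed so as not to cancel the pairing already present. The limit x
    is within 3^-k / 2 of the (k+1)-st point, so the pairing of phi k with x
    is still larger than k / 2. *)
Lemma L2_uniform_boundedness (f_ : nat -> T -> R) :
  (forall n, f_ n \in L2) ->
  (forall g, g \in L2 -> exists M : R, forall n, `|dot (f_ n) g| <= M) ->
  exists M : R, forall n, nrm (f_ n) <= M.
Proof.
move=> fL bd; apply: contrapT => /forallNP unb.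
have big (M : R) : {n | M < nrm (f_ n)}.
  by apply: cid; have /existsNP[n /negP] := unb M; rewrite -ltNge; exists n.
pose n_ k := sval (big (k%:R * 3 ^+ k)).
have n_P k : k%:R * 3 ^+ k < nrm (f_ (n_ k)) by rewrite /n_; case: (big _).
pose phi k := f_ (n_ k).
have phi0 k : 0 < nrm (phi k).
  by apply: le_lt_trans (n_P k); rewrite mulr_ge0// exprn_ge0.
pose sg (a : R) : R := if 0 <= a then 1 else -1.
pose step k (x : T -> R) : T -> R :=
  fun t => x t + sg (dot (phi k) x) * 3^-1 ^+ k / nrm (phi k) * phi k t.
pose x_ := fix x_ k := if k is k'.+1 then step k' (x_ k') else fun=> 0.
have xL k : x_ k \in L2.
  elim: k => [|k IH]; first exact: Lfun2_0.
  by apply: Lfun2D => //; apply: Lfun2Z; exact: fL.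
have nsg a : `|sg a| = 1 by rewrite /sg; case: ifP; rewrite ?normrN normr1.
have e3 k : 0 < 3^-1 ^+ k :> R by rewrite exprn_gt0.
have sL k : nrm (fun t => x_ k.+1 t - x_ k t) <= 1 * 3^-1 ^+ k.
  rewrite /= /step; under eq_fun do rewrite addrAC subrr add0r.
  rewrite L2normZ; last exact: fL.
  rewrite !normrM nsg !mul1r normfV (gtr0_norm (phi0 k)) (gtr0_norm (e3 k)).
  by rewrite divfK// gt_eqF.
have dL k : 3^-1 ^+ k * nrm (phi k) <= `|dot (phi k) (x_ k.+1)|.
  rewrite /= /step dotpDr//; [|exact: Lfun2Z (fL _)|exact: fL].
  rewrite dotpZr; [|exact: fL|exact: fL].
  rewrite -L2norm_sqr expr2 mulrA divfK ?gt_eqF//.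
  have p : 0 < 3^-1 ^+ k * nrm (phi k) by rewrite mulr_gt0.
  rewrite /sg; case: ifPn => [d0|]; last rewrite -ltNge => d0.
    by rewrite mul1r ger0_norm ?addr_ge0// ?(ltW p)// lerDr.
  by rewrite mulN1r mulNr ler0_norm; lra.
have [|||x xinL xd] := L2_geometric_limit xL _ _ _ sL; [lra|lra|lra|].
have [M MP] := bd x xinL.
have key k : k%:R <= 2 * M.
  have := MP (n_ k); rewrite -/(phi k) => dM.
  have := L2_CauchySchwarz (fL (n_ k)) (Lfun2B xinL (xL k.+1)).
  rewrite dotpBr//.
  have := xd k.+1; have := dL k; have := n_P k; rewrite -/(phi k).
  move: dM; move: (dot _ x) (dot _ (x_ _)) => u v uM.
  move=> H1 H2 H3 H4.
  have H5 : nrm (phi k) * nrm (fun t => x t - x_ k.+1 t) <=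
      3^-1 ^+ k * nrm (phi k) / 2.
    rewrite mulrC -mulrA mulrCA; rewrite mulrC ler_pM2l//.
    rewrite mulrC; apply: le_trans H3 _; rewrite exprS mul1r.
    by rewrite le_eqVlt; apply/orP; left; apply/eqP; field.
  have H6 : k%:R <= 3^-1 ^+ k * nrm (phi k).
    rewrite -ler_pdivrMl// exprVn invrK mulrC ltW//.
  have H7 : `|v| <= `|u| + `|u - v|.
    by rewrite -[v in leLHS](subKr u) (le_trans (ler_normB _ _)).
  lra.
have := key (Num.truncn (2 * M)).+1.
by apply/negP; rewrite -ltNge; exact: truncnS_gt.
Qed.

(** The representing function minimises J v = |v|^2 - 2 l v: by the
    parallelogram identity (mid below) 4^-k-minimisers are geometrically
    Cauchy, and J being stationary at their limit Z says that l is the pairing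
    with Z. *)
Lemma L2_Riesz (l : (T -> R) -> R) C :
  (forall a f g, f \in L2 -> g \in L2 ->
    l (fun x => a * f x + g x) = a * l f + l g) ->
  (forall f, f \in L2 -> `|l f| <= C * nrm f) ->
  exists2 Z, Z \in L2 & forall f, f \in L2 -> l f = dot Z f.
Proof.
move=> lin lC.
pose J v := dot v v - 2 * l v.
have Jge v : v \in L2 -> - C ^+ 2 <= J v.
  move=> vL; rewrite /J -L2norm_sqr.
  have := sqr_ge0 (nrm v - C); have := lC v vL => /(le_trans (ler_norm _)).
  rewrite sqrrB; lra.
pose S := [set J v | v in [set v | v \in L2]].
have S0 : S !=set0 by exists (J (fun=> 0)), (fun=> 0) => //=; exact: Lfun2_0.
have Slb : has_lbound S by exists (- C ^+ 2) => _ [v /= vL <-]; exact: Jge.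
have infJ v : v \in L2 -> inf S <= J v.
  by move=> vL; apply: ge_inf => //; exists v.
have approx k : {v | v \in L2 /\ J v < inf S + 4^-1 ^+ k}.
  apply: cid.
  have [|_ [v /= vL <-] Jv] := @inf_adherent _ S (4^-1 ^+ k) _ (conj S0 Slb).
    by rewrite exprn_gt0.
  by exists v.
pose v_ k := sval (approx k).
have vL k : v_ k \in L2 by rewrite /v_; case: (approx _) => ? [].
have vJ k : J (v_ k) < inf S + 4^-1 ^+ k by rewrite /v_; case: (approx _) => ? [].
have mid v w : v \in L2 -> w \in L2 ->
    dot (fun t => w t - v t) (fun t => w t - v t) =
    2 * (J v + J w - 2 * J (fun t => 2^-1 * v t + (2^-1 * w t))).
  move=> vinL winL; rewrite /J.
  rewrite lin ?Lfun2Z//.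
  have -> : l (fun x => 2^-1 * w x) = 2^-1 * l w.
    have := lin 2^-1 w (fun=> 0) winL (Lfun2_0 m).
    have -> : l (fun=> 0) = 0.
      have := lin 1 (fun=> 0) (fun=> 0) (Lfun2_0 m) (Lfun2_0 m).
      under eq_fun do rewrite mulr0 addr0.
      lra.
    by under eq_fun do rewrite addr0; rewrite addr0.
  rewrite dotpBl ?Lfun2B// !dotpBr// dotpDl ?dotpDr ?Lfun2D ?Lfun2Z//.
  rewrite !dotpZl ?Lfun2Z// !dotpZr// (dotpC m w v).
  by field.
have e2 k : 0 < 2^-1 ^+ k :> R by rewrite exprn_gt0.
have e4 k : 4^-1 ^+ k = (2^-1 ^+ k) ^+ 2 :> R.
  by rewrite -exprM mulnC exprM; congr (_ ^+ k); field.
have vd k : nrm (fun t => v_ k.+1 t - v_ k t) <= 2 * 2^-1 ^+ k.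
  rewrite -(@ler_pXn2r _ 2)// ?nnegrE ?L2norm_ge0 ?mulr_ge0 ?(ltW (e2 k))//.
  rewrite L2norm_sqr mid// exprMn -e4.
  have := infJ (fun t => 2^-1 * v_ k t + 2^-1 * v_ k.+1 t)
    (Lfun2D (Lfun2Z _ (vL k)) (Lfun2Z _ (vL k.+1))).
  have := vJ k; have := vJ k.+1; rewrite exprS; have : 0 < 4^-1 ^+ k :> R by rewrite exprn_gt0.
  lra.
have [|||Z ZL Zd] := L2_geometric_limit vL _ _ _ vd; [lra|lra|lra|].
exists Z => // f fL.
have near_min k (t : R) :
    - 4^-1 ^+ k <= 2 * t * (dot (v_ k) f - l f) + t ^+ 2 * dot f f.
  have := infJ (fun x => t * f x + v_ k x) (Lfun2D (Lfun2Z t fL) (vL k)).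
  have := vJ k; rewrite /J lin// dotpDl ?Lfun2D ?Lfun2Z//.
  rewrite !dotpDr ?Lfun2Z// !dotpZl ?Lfun2Z// !dotpZr// (dotpC m f).
  lra.
have vkf k : `|dot (v_ k) f - l f| <= 2^-1 ^+ k * (1 + dot f f).
  have := near_min k (2^-1 ^+ k); have := near_min k (- 2^-1 ^+ k).
  rewrite e4 sqrrN; set u := dot _ f - _; set e := 2^-1 ^+ k => H1 H2.
  have e0 : 0 < e by exact: e2.
  have D0 := dotp_ge0 m f.
  have H1' : e * (2 * u) <= e * (e * (1 + dot f f)) by lra.
  have H2' : e * (- (2 * u)) <= e * (e * (1 + dot f f)) by lra.
  move: H1' H2'; rewrite !ler_pM2l// => H1' H2'.
  rewrite ler_norml; apply/andP; split; nra.
have Zf k : `|dot Z f - l f| <= 2^-1 ^+ k * (1 + dot f f + 4 * nrm f).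
  have := vkf k.
  have := L2_CauchySchwarz (Lfun2B ZL (vL k)) fL.
  rewrite dotpBl// => /le_trans /(_ (ler_wpM2r (L2norm_ge0 m f) (Zd k))).
  have := ler_distD (dot (v_ k) f) (dot Z f) (l f).
  have -> : 2 * 2^-1 ^+ k / (1 - 2^-1) = 4 * 2^-1 ^+ k :> R by field.
  lra.
apply/eqP; rewrite eq_sym -subr_eq0 -normr_le0.
have c0 : 2^-1 ^+ k * (1 + dot f f + 4 * nrm f) @[k --> \oo] --> 0.
  rewrite -[X in _ --> X](mul0r (1 + dot f f + 4 * nrm f)).
  by apply: cvgM; [apply: cvg_expr; rewrite ger0_norm; lra|exact: cvg_cst].
exact: (le_cvg Zf c0).
Qed.

Lemma L2norm_dist f g : f \in L2 -> g \in L2 ->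
  `|nrm f - nrm g| <= nrm (fun x => f x - g x).
Proof.
move=> fL gL; have H1 := L2normD (Lfun2B fL gL) gL.
have H2 := L2normD (Lfun2B gL fL) fL.
have E1 : (fun x => f x - g x + g x) = f by apply/funext => x; rewrite subrK.
have E2 : (fun x => g x - f x + f x) = g by apply/funext => x; rewrite subrK.
rewrite E1 in H1; rewrite E2 L2normBC in H2.
rewrite ler_norml; apply/andP; split; lra.
Qed.

Lemma L2norm_cvg (f_ : nat -> T -> R) f :
  (forall n, f_ n \in L2) -> f \in L2 ->
  nrm (fun x => f_ n x - f x) @[n --> \oo] --> 0 ->
  nrm (f_ n) @[n --> \oo] --> nrm f.
Proof.
by move=> fnL fL; apply: norm_sub_le_cvg => n; exact: L2norm_dist.
Qed.

Lemma dotp_cvg_weak_strong (f_ g_ : nat -> T -> R) f g M :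
  (forall n, f_ n \in L2) -> (forall n, g_ n \in L2) -> g \in L2 ->
  (forall n, nrm (f_ n) <= M) ->
  dot (f_ n) g @[n --> \oo] --> dot f g ->
  nrm (fun x => g_ n x - g x) @[n --> \oo] --> 0 ->
  dot (f_ n) (g_ n) @[n --> \oo] --> dot f g.
Proof.
move=> fL gnL gL fM fg gg.
have -> : (fun n => dot (f_ n) (g_ n)) =
    (fun n => dot (f_ n) (fun x => g_ n x - g x) + dot (f_ n) g).
  by apply/funext => n; rewrite dotpBr// subrK.
rewrite -[X in _ --> X]add0r; apply: cvgD => //.
apply: (@norm_le_cvg0 _ _ (fun n => M * nrm (fun x => g_ n x - g x))).
  move=> n; apply: le_trans (L2_CauchySchwarz (fL n) (Lfun2B (gnL n) gL)) _.
  by rewrite ler_wpM2r ?L2norm_ge0.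
by rewrite -[X in _ --> X](mulr0 M); apply: cvgM => //; exact: cvg_cst.
Qed.

Lemma Lfun2_mul_bounded (V D : T -> R) (c : R) : V \in L2 ->
  measurable_fun setT D -> (forall w, `|D w| <= c) ->
  (fun w => D w * V w) \in L2.
Proof.
move=> VL mD Dc; apply: (Lfun2_le _ (Lfun2Z c VL)) => [|w].
  by apply: measurable_funM => //; exact: Lfun2_measurable VL.
by rewrite !normrM ler_wpM2r// (le_trans (Dc w))// ler_norm.
Qed.

Lemma L2norm_mul_bounded (V D : T -> R) (c : R) : V \in L2 ->
  measurable_fun setT D -> 0 <= c -> (forall w, `|D w| <= c) ->
  nrm (fun w => D w * V w) <= c * nrm V.
Proof.
move=> VL mD c0 Dc; rewrite -(ger0_norm c0) -L2normZ//.
apply: L2norm_le (Lfun2Z c VL) _ => [|w].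
  by apply: measurable_funM => //; exact: Lfun2_measurable VL.
by rewrite !normrM ler_wpM2r// (le_trans (Dc w))// ler_norm.
Qed.

Lemma Lfun2_ae_eq (f g : T -> R) : measurable_fun setT f -> g \in L2 ->
  {ae m, forall w, f w = g w} -> f \in L2.
Proof.
move=> mf /Lfun2P[mg /integrableP[_ ig]] fg; apply/Lfun2P; split => //.
apply/integrableP; split; first by apply/measurable_EFinP; exact: measurable_funX.
have ms (h : T -> R) : measurable_fun setT h ->
    measurable_fun setT (fun w => `|(h w ^+ 2)%:E|%E).
  move=> mh; apply: measurableT_comp => //; apply/measurable_EFinP.
  exact: measurable_funX.
have E : ae_eq m setT (fun w => `|(f w ^+ 2)%:E|%E) (fun w => `|(g w ^+ 2)%:E|%E).
  by apply: filterS fg => w /= -> _.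
by rewrite (_ : integral _ _ _ = (\int[m]_w `|(g w ^+ 2)%:E|)%E)//;
  apply: ae_eq_integral E => //; exact: ms.
Qed.

End L2_complete.

(** * Bounded functions, restricted measures and conditional expectation *)

Section bounded_class.
Context (T : Type) (R : realType).

(** A bounded f is within 1/(k+1) of a combination of indicators of the sets
    where f lies in an interval of length 1/(k+1); so a linear class
    stable under uniform limits contains f once it contains these indicators. *)
Lemma bounded_measurable_class (G : set (set T)) (K : (T -> R) -> Prop) :
  (forall A, G A -> K (\1_A)) ->
  (forall a f g, K f -> K g -> K (fun x => a * f x + g x)) ->
  K (fun=> 0) ->
  (forall (f_ : nat -> T -> R) f, (forall k, K (f_ k)) ->
    (forall k x, `|f_ k x - f x| <= k.+1%:R^-1) -> K f) ->
  forall (f : T -> R) (M : R), (forall x, `|f x| <= M) ->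
    (forall a b, G (f @^-1` `[a, b[)) -> K f.
Proof.
move=> Kind Klin K0 Klim f M fM Gf.
pose c k j : R := j%:R / k.+1%:R - M.
pose N k := (Num.truncn (2 * M * k.+1%:R)).+1.
pose f_ k x : R := \sum_(j < N k) c k j * \1_(f @^-1` `[c k j, c k j.+1[) x.
apply: (Klim f_).
  move=> k; rewrite /f_.
  elim: (N k) => [|n IH]; first by under eq_fun do rewrite big_ord0.
  under eq_fun do rewrite big_ord_recr/= addrC.
  by apply: Klin => //; exact/Kind/Gf.
move=> k x.
have k0 : 0 < k.+1%:R :> R by [].
have M0 : 0 <= M by apply: le_trans (fM x).
have /andP[fM1 fM2] : - M <= f x <= M by rewrite -ler_norml.
pose i := Num.truncn ((f x + M) * k.+1%:R).
have fx0 : 0 <= (f x + M) * k.+1%:R by rewrite mulr_ge0//; lra.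
have /andP[i1 i2] := truncn_itv fx0.
have iN : (i < N k)%N.
  rewrite ltnS /i; apply: le_truncn.
  by rewrite ler_pM2r//; lra.
have ci : f x \in `[c k i, c k i.+1[.
  rewrite in_itv/= /c lerBlDr ltrBrDr ler_pdivrMr// ltr_pdivlMr//.
  by rewrite i1 i2.
rewrite /f_ (bigD1 (Ordinal iN))//= big1 ?addr0.
  rewrite indicE mem_set// mulr1.
  move: ci; rewrite in_itv/= {2}/c -(natr1 i) mulrDl mul1r => /andP[c1].
  rewrite addrAC -/(c k i) => c2.
  move: c1 c2; move: (c k i) (k.+1%:R^-1) => u v c1 c2.
  by rewrite distrC ger0_norm; lra.
move=> j /negP jNi; rewrite indicE memNset ?mulr0// => /= fj.
apply: jNi; apply/eqP/val_inj => /=; apply/eqP; rewrite eq_sym.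
rewrite /i truncn_eq//; move: fj; rewrite in_itv/= /c lerBlDr ltrBrDr.
by rewrite ler_pdivrMr// ltr_pdivlMr.
Qed.
End bounded_class.

Section integrals.
Context d (T : measurableType d) (R : realType) (m : {measure set T -> \bar R}).

Lemma integrable_mul_bounded (W h : T -> R) (M : R) :
  m.-integrable setT (EFin \o W) -> measurable_fun setT h ->
  (forall x, `|h x| <= M) ->
  m.-integrable setT (EFin \o (fun x => W x * h x)).
Proof.
move=> iW mh hM; have /integrableP[mW _] := iW.
apply: le_integrable (integrableZl measurableT M iW) => //.
  by apply/measurable_EFinP; apply: measurable_funM => //; exact/measurable_EFinP.
move=> x _ /=; rewrite lee_fin !normrM mulrC ler_wpM2r//.
by apply: le_trans (hM x) (ler_norm _).
Qed.

Lemma integrableZ_EFin (a : R) (f : T -> R) :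
  m.-integrable setT (EFin \o f) ->
  m.-integrable setT (EFin \o (fun x => a * f x)).
Proof.
move=> fi; rewrite (_ : _ \o _ = (fun x => a%:E * (EFin \o f) x)%E)//.
exact: integrableZl.
Qed.

Lemma integrableD_EFin (f g : T -> R) :
  m.-integrable setT (EFin \o f) -> m.-integrable setT (EFin \o g) ->
  m.-integrable setT (EFin \o (fun x => f x + g x)).
Proof.
move=> fi gi; rewrite (_ : _ \o _ = ((EFin \o f) \+ (EFin \o g))%E)//.
exact: integrableD.
Qed.

Lemma integrableB_EFin (f g : T -> R) :
  m.-integrable setT (EFin \o f) -> m.-integrable setT (EFin \o g) ->
  m.-integrable setT (EFin \o (fun x => f x - g x)).
Proof.
move=> fi gi; rewrite (_ : _ \o _ = ((EFin \o f) \- (EFin \o g))%E)//.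
exact: integrableB.
Qed.

Lemma Rintegral_indicr (W : T -> R) (A : set T) :
  \int[m]_x (W x * \1_A x) = \int[m]_(x in A) W x.
Proof.
rewrite [RHS]Rintegral_mkcond; apply: eq_Rintegral => x _.
by rewrite patchE indicE; case: (x \in A); rewrite ?mulr1 ?mulr0.
Qed.

Lemma integral_mrestr (D : set T) (mD : measurable D) (f : T -> \bar R) :
  measurable_fun setT f -> (forall x, 0 <= f x)%E ->
  (\int[mrestr m mD]_x f x = \int[m]_(x in D) f x)%E.
Proof.
move=> mf f0; rewrite (@ge0_negligible_integral _ _ _ _ setT (~` D))//.
- rewrite setTD setCK; apply: eq_measure_integral => A mA AD.
  by rewrite /= /mrestr setIidl.
- exact: measurableC.
- by rewrite /= /mrestr setICl measure0.
Qed.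

Lemma integrable_mrestr (D : set T) (mD : measurable D) (f : T -> \bar R) :
  measurable_fun setT f ->
  (mrestr m mD).-integrable setT f <-> m.-integrable D f.
Proof.
move=> mf; split => /integrableP[_ H]; apply/integrableP; split.
- exact: measurable_funTS.
- by rewrite -integral_mrestr//; exact: measurableT_comp.
- by [].
- by rewrite integral_mrestr//; exact: measurableT_comp.
Qed.

Lemma Rintegral_mrestr (D : set T) (mD : measurable D) (f : T -> R) :
  (mrestr m mD).-integrable setT (EFin \o f) ->
  \int[mrestr m mD]_x f x = \int[m]_(x in D) f x.
Proof.
move=> /[dup] /integrableP[mf _] fi; congr fine.
rewrite (@negligible_integral _ _ _ _ setT (~` D))//.
- rewrite setTD setCK; apply: eq_measure_integral => A mA AD.
  by rewrite /= /mrestr setIidl.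
- exact: measurableC.
- by rewrite /= /mrestr setICl measure0.
Qed.

End integrals.

Section cond_exp_pull_out.
Context d (T : measurableType d) (R : realType) (P : probability T R).
Context (H : set (set T)) (subH : <<s H >> `<=` measurable).

(** The pull-out property under the integral: for indicators Y it defines the
    conditional expectation, and both sides are stable under uniform limits. *)
Lemma cond_exp_mul_bounded (X Y : T -> R) (M : R) :
  P.-integrable setT (EFin \o X) -> measurable_wrt <<s H >> Y ->
  (forall w, `|Y w| <= M) ->
  \int[P]_w (cond_exp P <<s H >> X w * Y w) = \int[P]_w (X w * Y w).
Proof.
move=> iX mY YM.
have [mC iC intC] := cond_expP subH iX.
set C := cond_exp _ _ _ in mC iC intC *.
pose K (Y : T -> R) := [/\ measurable_fun setT Y,
  (exists M : R, forall w, `|Y w| <= M) &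
  \int[P]_w (C w * Y w) = \int[P]_w (X w * Y w)].
have int_bd (W Z : T -> R) : P.-integrable setT (EFin \o W) ->
    measurable_fun setT Z -> (exists M : R, forall w : T, `|Z w| <= M) ->
    P.-integrable setT (EFin \o (fun w => W w * Z w)).
  by move=> iW mZ [N ZN]; exact: integrable_mul_bounded iW mZ ZN.
suff [] : K Y by [].
apply: (@bounded_measurable_class _ _ <<s H >> K _ _ _ _ Y M) => //.
- move=> A GA; split.
  + by apply: measurable_indic; exact: subH.
  + by exists 1 => w; rewrite indicE; case: (_ \in _); rewrite ?normr1 ?normr0.
  + by rewrite !Rintegral_indicr intC.
- move=> a f g [mf bf ef] [mg bg eg]; split.
  + by apply: measurable_funD => //; exact: measurable_funM.
  + move: bf bg => [M1 f1] [M2 g1]; exists (`|a| * M1 + M2) => w.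
    apply: le_trans (ler_normD _ _) _; rewrite lerD// normrM.
    by rewrite ler_wpM2l.
  + have lin W : P.-integrable setT (EFin \o W) ->
        \int[P]_w (W w * (a * f w + g w)) =
        a * (\int[P]_w (W w * f w)) + \int[P]_w (W w * g w).
      move=> iW; rewrite -RintegralZl//; last exact: int_bd.
      rewrite -RintegralD//; [|by apply: integrableZ_EFin; exact: int_bd|exact: int_bd].
      by apply: eq_Rintegral => w _; ring.
    by rewrite !lin// ef eg.
- split => //; first by exists 0 => w; rewrite normr0.
  by under eq_Rintegral do rewrite mulr0;
    under [RHS]eq_Rintegral do rewrite mulr0.
- move=> f_ f Kf ff.
  have fB : exists M : R, forall w, `|f w| <= M.
    have [_ [N fN] _] := Kf 0%N; exists (N + 1) => w.
    have := ff 0%N w; rewrite invr1 => H0.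
    rewrite -[f w](subKr (f_ 0%N w)).
    by apply: le_trans (ler_normB _ _) _; rewrite lerD.
  have cf w : f_ k w @[k --> \oo] --> f w.
    by apply: (norm_sub_le_cvg _ (@cvg_harmonic R)) => k; exact: ff.
  have mf : measurable_fun setT f.
    by apply: (measurable_fun_limR _ cf) => k; case: (Kf k).
  split => //.
  pose D w := C w - X w.
  have iD : P.-integrable setT (EFin \o D) by exact: integrableB_EFin.
  have D0 k : \int[P]_w (D w * f_ k w) = 0.
    have [mk bk ek] := Kf k.
    under eq_Rintegral do rewrite mulrBl.
    by rewrite RintegralB//; [rewrite ek subrr|exact: int_bd|exact: int_bd].
  apply/eqP; rewrite -subr_eq0 -RintegralB//; [|exact: int_bd|exact: int_bd].
  rewrite -normr_le0.
  under eq_Rintegral do rewrite -mulrBl.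
  have H0 k : `|\int[P]_w (D w * f w)| <= k.+1%:R^-1 * \int[P]_w `|D w|.
    have [mk bk ek] := Kf k.
    have -> : \int[P]_w (D w * f w) = \int[P]_w (D w * (f w - f_ k w)).
      rewrite -[LHS]subr0 -(D0 k) -RintegralB//; [|exact: int_bd|exact: int_bd].
      by apply: eq_Rintegral => w _; rewrite mulrBr.
    have ib : P.-integrable setT (EFin \o (fun w => D w * (f w - f_ k w))).
      apply: (@integrable_mul_bounded _ _ _ _ _ _ k.+1%:R^-1) => //.
        exact: measurable_funB.
      by move=> w; rewrite distrC.
    have inD : P.-integrable setT (EFin \o (fun w => `|D w|)).
      exact: integrable_norm iD.
    apply: le_trans (le_normr_Rintegral measurableT ib) _.
    rewrite -RintegralZl//; apply: le_Rintegral => //.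
    + exact: integrable_norm ib.
    + exact: integrableZ_EFin.
    + by move=> w _; rewrite normrM mulrC ler_wpM2r// distrC.
  apply: (le_cvg H0).
  rewrite -[X in _ --> X](mul0r (\int[P]_w `|D w|)).
  by apply: cvgM; [exact: cvg_harmonic|exact: cvg_cst].
- move=> a b; apply: mY; exists `[a, b[%classic => //.
  by rewrite setTI.
Qed.

End cond_exp_pull_out.

(** * Elementary processes on the product with the half-line *)

Section time_product.
Context d (T : measurableType d) (R : realType) (P : probability T R).

Local Notation mu := (@lebesgue_measure R).
Local Notation TR := (T * measurableTypeR R)%type.

Local Notation time := [set` Interval (BLeft (0:R)) +oo%O].

Lemma patch_time (V : Type) (z : V) (F : TR -> V) (w : T) (s : R) :
  patch (fun=> z) ([set: T] `*` time) F (w, s) =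
  patch (fun=> z) time (fun s => F (w, s)) s.
Proof. by rewrite /patch in_setX in_setT. Qed.

Lemma P_time_ge0_integral (F : TR -> \bar R) :
  measurable_fun setT F -> (forall x, 0 <= F x)%E ->
  (\int[P_time P]_x F x =
   \int[mu]_(s in time) \int[P]_w F (w, s))%E.
Proof.
move=> mF F0; rewrite /P_time integral_mrestr// integral_mkcond.
rewrite fubini_tonelli2; last 2 first.
- apply/(measurable_restrictT _ (@measurable_setX_time _ T R)).
  exact: measurable_funTS.
- by move=> x; rewrite patchE; case: ifPn.
rewrite [RHS]integral_mkcond; apply: eq_integral => s _.
rewrite /fubini_G [RHS]patchE; case: ifPn => hs.
  by apply: eq_integral => w _; rewrite patch_time patchE hs.
under eq_integral do rewrite patch_time patchE (negbTE hs).
by rewrite integral0.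
Qed.

(** P_time is a restriction of the product measure, so Fubini is applied to f
    cut off outside the half-line. *)
Lemma P_time_Fubini (f : TR -> R) :
  (P_time P).-integrable setT (EFin \o f) ->
  {ae mu, forall s, s \in time -> P.-integrable setT (fun w => (f (w, s))%:E)} /\
  \int[P_time P]_x f x = \int[mu]_(s in time) \int[P]_w f (w, s).
Proof.
move=> /[dup] fi /integrableP[mf _].
have mD := @measurable_setX_time _ T R.
have fi' : (P \x mu)%E.-integrable setT ((EFin \o f) \_ ([set: T] `*` time)).
  apply: (iffLR (@integrable_mkcond _ _ _ (P \x mu)%E _ (EFin \o f) mD)).
  exact: (iffLR (@integrable_mrestr _ _ _ (P \x mu)%E _ mD _ mf)).
have aei := ae_integrable2 fi'.
split.
  apply: filterS aei => s /= + hs.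
  by under eq_fun do rewrite patch_time patchE hs.
set F' := (EFin \o f) \_ _ in fi' aei.
rewrite /P_time Rintegral_mrestr// /Rintegral integral_mkcond -/F'.
rewrite -integral21_prod_meas1// [in RHS]integral_mkcond; congr fine.
rewrite [in RHS](_ : _ \_ _ = fun s => (fine (fubini_G P F' s))%:E); last first.
  apply/funext => s; rewrite /fubini_G patchE; case: ifPn => hs.
    congr (fine _)%:E; apply: eq_integral => w _.
    by rewrite /F' patch_time patchE hs.
  under eq_integral do rewrite /F' patch_time patchE (negbTE hs).
  by rewrite integral0.
apply: ae_eq_integral => //.
- exact: (measurable_fubini_G fi').
- apply/measurable_EFinP; apply: measurableT_comp => //.
  exact: (measurable_fubini_G fi').
- apply: filterS aei => s /= si _.
  by rewrite fineK//; exact: integrable_fin_num.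
Qed.


Definition tensor (u : T -> R) (a b : R) (p : T * R) : R :=
  u p.1 * \1_(`]a, b]) p.2.

Lemma measurable_tensor (u : T -> R) (a b : R) : measurable_fun setT u ->
  measurable_fun [set: TR] (tensor u a b).
Proof.
move=> mu_; apply: measurable_funM; first exact: measurableT_comp.
by apply: measurableT_comp => //; exact: measurable_indic.
Qed.

Lemma integral_time_indic (a b : R) : 0 <= a -> a <= b ->
  (\int[mu]_(s in time) (\1_(`]a, b]) s)%:E = (b - a)%:E)%E.
Proof.
move=> a0 ab; rewrite integral_indic; [|exact: measurable_itv..].
rewrite setIidl; last first.
  by move=> s /=; rewrite !in_itv/= andbT => /andP[/ltW + _]; exact: le_trans.
apply: etrans (lebesgue_measure_itv `]a, b]) _; rewrite /= lte_fin.
by case: ltgtP ab => //= -> _; rewrite subrr.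
Qed.

Lemma ge0_integral_tensor (u : T -> R) (a b : R) :
  measurable_fun setT u -> (forall w, 0 <= u w) -> 0 <= a -> a <= b ->
  (\int[P_time P]_p (tensor u a b p)%:E = (b - a)%:E * \int[P]_w (u w)%:E)%E.
Proof.
move=> mu_ u0 a0 ab.
rewrite P_time_ge0_integral; last 2 first.
- by apply/measurable_EFinP; exact: measurable_tensor.
- by move=> p; rewrite lee_fin mulr_ge0// indicE.
have step s : (\int[P]_w (tensor u a b (w, s))%:E =
    (\int[P]_w (u w)%:E) * (\1_(`]a, b]) s)%:E)%E.
  rewrite -ge0_integralZr//.
  - exact/measurable_EFinP.
  - by move=> w _; rewrite lee_fin.
under eq_integral do rewrite step.
rewrite ge0_integralZl//.
- by rewrite integral_time_indic// muleC.
- by apply/measurable_EFinP; apply: measurable_funTS; exact: measurable_indic.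
- by apply: integral_ge0 => w _; rewrite lee_fin.
Qed.

Lemma tensor_integrable (u : T -> R) (a b : R) :
  P.-integrable setT (EFin \o u) -> 0 <= a -> a <= b ->
  (P_time P).-integrable setT (EFin \o tensor u a b).
Proof.
move=> /integrableP[mu_ ui] a0 ab; apply/integrableP; split.
  by apply/measurable_EFinP; apply: measurable_tensor; exact/measurable_EFinP.
have E p : `|(EFin \o tensor u a b) p|%E = (tensor (fun w => `|u w|) a b p)%:E.
  by rewrite /= /tensor normrM indicE; case: (_ \in _); rewrite ?normr1 ?normr0.
under eq_integral do rewrite E.
rewrite ge0_integral_tensor//.
  by rewrite lte_mul_pinfty// lee_fin subr_ge0.
by apply: measurableT_comp => //; exact/measurable_EFinP.
Qed.

Lemma Rintegral_tensor (u : T -> R) (a b : R) :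
  P.-integrable setT (EFin \o u) -> 0 <= a -> a <= b ->
  \int[P_time P]_p tensor u a b p = (b - a) * \int[P]_w u w.
Proof.
move=> ui a0 ab; have [_ ->] := P_time_Fubini (tensor_integrable ui a0 ab).
have step s : \int[P]_w tensor u a b (w, s) = (\int[P]_w u w) * \1_(`]a, b]) s.
  by rewrite -RintegralZr.
under eq_Rintegral do rewrite step.
have iI : mu.-integrable time (EFin \o \1_(`]a, b])).
  apply/integrableP; split.
    apply/measurable_EFinP; apply: measurable_funTS; exact: measurable_indic.
  under eq_integral do rewrite /= ger0_norm//.
  by rewrite integral_time_indic// ltry.
rewrite RintegralZl// mulrC; congr (_ * _).
by rewrite /Rintegral integral_time_indic.
Qed.

Lemma tensorM (u v : T -> R) (a b : R) p :
  tensor u a b p * tensor v a b p = tensor (fun w => u w * v w) a b p.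
Proof.
rewrite /tensor mulrACA; congr (_ * _); rewrite indicE.
by case: (_ \in _); rewrite ?mulr1 ?mulr0.
Qed.

Lemma Lfun2_tensor (u : T -> R) (a b : R) : u \in Lfun P 2%:E -> 0 <= a -> a <= b ->
  tensor u a b \in Lfun (P_time P) 2%:E.
Proof.
move=> uL a0 ab; apply/Lfun2P; split.
  by apply: measurable_tensor; exact: Lfun2_measurable uL.
rewrite (_ : (fun p => _) = tensor (fun w => u w * u w) a b).
  by apply: tensor_integrable => //; exact: Lfun2_integrableM.
by apply/funext => p; rewrite expr2 tensorM.
Qed.

Lemma dotp_tensor (u v : T -> R) (a b : R) :
  u \in Lfun P 2%:E -> v \in Lfun P 2%:E -> 0 <= a -> a <= b ->
  dotp (P_time P) (tensor u a b) (tensor v a b) = (b - a) * dotp P u v.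
Proof.
move=> uL vL a0 ab; rewrite /dotp -Rintegral_tensor//; last exact: Lfun2_integrableM.
by apply: eq_Rintegral => p _; rewrite tensorM.
Qed.

End time_product.

Section step_process.
Context d (T : measurableType d) (R : realType) (P : probability T R).
Context (D : nat -> T -> R) (n : nat) (n0 : (0 < n)%N) (D0 : D 0 = cst 0).
Context (DL : forall i, D i \in Lfun P 2%:E).

Local Notation mu := (@lebesgue_measure R).

(** For s > 0, the index i of the interval ](i-1)/n, i/n] containing s. *)
Definition cell (s : R) : nat := absz (Num.max 0 (Num.ceil (n%:R * s))).
Definition step_process (p : T * R) : R := D (cell p.2) p.1.
Definition step_cell i := tensor (D i) (i.-1%:R / n%:R) (i%:R / n%:R).

Let n0' : 0 < n%:R :> R. Proof. by rewrite ltr0n. Qed.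

Lemma cell_itv s i : (0 < i)%N ->
  (s \in `]i.-1%:R / n%:R, i%:R / n%:R]) = (cell s == i).
Proof.
move=> i0; rewrite in_itv/= ltr_pdivrMr// ler_pdivlMr// ![s * _]mulrC /cell.
have e : (i.-1%:R < n%:R * s) && (n%:R * s <= i%:R) = (Num.ceil (n%:R * s) == i%:Z).
  by rewrite ceil_eq intrB pmulrn -(natrB _ i0) subn1 .
rewrite e; case: (Num.ceil (n%:R * s)) => [k|k] /=.
  by rewrite max_r.
by apply/esym/negbTE; rewrite eq_sym -lt0n.
Qed.

Lemma step_cellE i p : step_cell i p = if cell p.2 == i then D i p.1 else 0.
Proof.
rewrite /step_cell /tensor; have [->|i0] := posnP i.
  by rewrite D0 mul0r if_same.
rewrite indicE -cell_itv//; case: ifPn => h.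
  by rewrite mem_set// mulr1.
by rewrite memNset ?mulr0//= => h'; rewrite h' in h.
Qed.

Lemma step_process_sum (N : nat) p :
  \sum_(0 <= i < N) step_cell i p = if (cell p.2 < N)%N then step_process p else 0.
Proof.
under eq_bigr do rewrite step_cellE.
elim: N => [|N IH]; first by rewrite big_nil.
rewrite big_nat_recr//= IH [in RHS]ltnS [in RHS]leq_eqVlt.
case: eqP => [cN|_] /=; last by rewrite addr0.
by rewrite cN ltnn add0r /step_process cN.
Qed.

Lemma step_process_cvg p :
  \sum_(0 <= i < N) step_cell i p @[N --> \oo] --> step_process p.
Proof.
apply: cvg_near_cst; exists (cell p.2).+1 => // N /= cN.
by rewrite step_process_sum cN.
Qed.

Let itv0 i : 0 <= i.-1%:R / n%:R :> R. Proof. by rewrite divr_ge0. Qed.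
Let itvle i : i.-1%:R / n%:R <= i%:R / n%:R :> R.
Proof. by rewrite ler_pM2r ?invr_gt0// ler_nat leq_pred. Qed.

Lemma Lfun2_step_cell i : step_cell i \in Lfun (P_time P) 2%:E.
Proof. exact: Lfun2_tensor. Qed.

Lemma measurable_step_process :
  measurable_fun [set: (T * measurableTypeR R)%type] step_process.
Proof.
apply: (@measurable_fun_limR _ (T * measurableTypeR R)%type R _ _ _ step_process_cvg).
by move=> N; apply: measurable_sum => i; apply: (Lfun2_measurable (Lfun2_step_cell i)).
Qed.

(** At each point at most one cell process is non-zero, so squaring commutes
    with the sum over cells, and each cell contributes 1/n times a second
    moment. *)
Lemma integral_step_process_sqr :
  (\int[P_time P]_p (step_process p ^+ 2)%:E = L2n_sqnorm P n D)%E.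
Proof.
have sE p : ((step_process p ^+ 2)%:E = \sum_(i <oo) (step_cell i p ^+ 2)%:E)%E.
  apply/esym/cvg_lim => //.
  apply: cvg_near_cst; exists (cell p.2).+1 => // N /= cN.
  rewrite sumEFin; congr EFin.
  rewrite (bigD1_seq (cell p.2))/= ?mem_index_iota ?iota_uniq//.
  rewrite step_cellE eqxx big1 ?addr0// => i; rewrite eq_sym => /negbTE h.
  by rewrite step_cellE h expr0n.
under eq_integral do rewrite sE.
rewrite integral_nneseries//; last 2 first.
- move=> i; apply/measurable_EFinP; apply: measurable_funX.
  by apply: Lfun2_measurable; exact: Lfun2_step_cell.
- by move=> i p _; rewrite lee_fin sqr_ge0.
have iE i : (\int[P_time P]_p (step_cell i p ^+ 2)%:E =
    (n%:R^-1)%:E * 'E_P[fun w => (D i w ^+ 2)%R])%E.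
  under eq_integral do rewrite expr2 tensorM.
  rewrite ge0_integral_tensor//; last 2 first.
  - by apply: measurable_funM; exact: Lfun2_measurable.
  - by move=> w; rewrite -expr2 sqr_ge0.
  rewrite unlock; have [i0|i0] := posnP i.
    rewrite i0 D0; under eq_integral do rewrite /= mulr0.
    by rewrite !integral0 !mule0.
  rewrite -mulrBl -natrB ?leq_pred// -subn1 subKn// mul1r.
  by under eq_integral do rewrite -expr2.
under eq_eseriesr do rewrite iE.
rewrite nneseriesZl; last first.
  by move=> i _; rewrite unlock; apply: integral_ge0 => w _; rewrite lee_fin sqr_ge0.
congr (_ * _)%E; rewrite nneseries_recl//; last first.
  by move=> i _; rewrite unlock; apply: integral_ge0 => w _; rewrite lee_fin sqr_ge0.
rewrite D0 [X in (X + _)%E](_ : _ = 0%E) ?add0e//.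
by rewrite unlock; under eq_integral do rewrite /= expr0n; rewrite integral0.
Qed.

Lemma Lfun2_step_process : (L2n_sqnorm P n D < +oo)%E ->
  step_process \in Lfun (P_time P) 2%:E.
Proof.
move=> Dfin; apply/Lfun2P; split; first exact: measurable_step_process.
apply/integrableP; split.
  by apply/measurable_EFinP; apply: measurable_funX; exact: measurable_step_process.
under eq_integral do rewrite /= ger0_norm ?sqr_ge0//.
by rewrite integral_step_process_sqr.
Qed.

End step_process.

(** * Gaussian moments and pairwise independence *)

Section normal_moments.
Context (R : realType).
Local Notation mu := (@lebesgue_measure R).

(** The normal law is given by its density, which is therefore almost
    everywhere the Radon-Nikodym derivative. *)
Lemma ge0_integral_normal (m s : R) (f : R -> \bar R) :
  measurable_fun setT f -> (forall x, 0 <= f x)%E ->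
  (\int[normal_prob m s]_x f x = \int[mu]_x (f x * (normal_pdf m s x)%:E))%E.
Proof.
move=> mf f0.
have dom : normal_prob m s `<< mu by exact: normal_prob_dominates.
rewrite -(Radon_Nikodym_SigmaFinite.change_of_variables dom f0 measurableT mf).
have mp : measurable_fun setT (fun x => (normal_pdf m s x)%:E).
  by apply/measurable_EFinP; exact: measurable_normal_pdf.
have fi := Radon_Nikodym_SigmaFinite.f_integrable dom.
apply: ae_eq_integral => //.
- by apply: emeasurable_funM => //; exact: measurable_int fi.
- exact: emeasurable_funM.
have : ae_eq mu setT (Radon_Nikodym_SigmaFinite.f (normal_prob m s) mu)
    (fun x => (normal_pdf m s x)%:E).
  apply: integral_ae_eq => // E _ mE.
  by rewrite -Radon_Nikodym_SigmaFinite.f_integral.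
by apply: filterS => x /= + _ => -> .
Qed.

(** Completing the square: the exponential moves the mean of the density from
    0 to c s^2. *)
Lemma normal_mgf (s c : R) : s != 0 ->
  (\int[normal_prob 0 s]_x (expR (c * x))%:E = (expR (c ^+ 2 * s ^+ 2 / 2))%:E)%E.
Proof.
move=> s0; rewrite ge0_integral_normal; last 2 first.
- by apply/measurable_EFinP; apply: measurableT_comp => //.
- by move=> x; rewrite lee_fin expR_ge0.
have E x : ((expR (c * x))%:E * (normal_pdf 0 s x)%:E =
    (expR (c ^+ 2 * s ^+ 2 / 2))%:E * (normal_pdf (c * s ^+ 2) s x)%:E)%E.
  have pE m : normal_pdf m s x = normal_peak s * normal_fun m s x.
    by rewrite normal_pdfE.
  rewrite -!EFinM; congr EFin; rewrite !pE mulrCA [RHS]mulrCA; congr (_ * _).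
  by rewrite /normal_fun -!expRD; congr expR; field.
under eq_integral do rewrite E.
rewrite ge0_integralZl//.
- by rewrite integral_normal_pdf mule1.
- by apply/measurable_EFinP; exact: measurable_normal_pdf.
- by move=> x _; rewrite lee_fin normal_pdf_ge0.
Qed.

End normal_moments.

Section cosh_quotient.
Context (R : realType).

Lemma expR_sub_le (a b : R) : expR a - expR b <= (a - b) * expR a.
Proof.
have := expR_ge1Dx (b - a); rewrite expRD => H.
have ea := expR_gt0 a.
have : (1 + (b - a)) * expR a <= expR b * expR (- a) * expR a.
  by rewrite ler_pM2r.
rewrite expRN divfK ?gt_eqF//; lra.
Qed.

(** This is 2 sinh(c x / 2) / c. Its square is the second difference quotient
    (e^(cx) + e^(-cx) - 2) / c^2 and it tends to x as c tends to 0, so that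
    the second moment of a Gaussian is read off its moment generating function
    without differentiating under the integral. *)
Definition sinhq (c x : R) := (expR (c * x / 2) - expR (- (c * x / 2))) / c.

Lemma sinhq_sqr c x : c != 0 ->
  sinhq c x ^+ 2 = (expR (c * x) + expR (- c * x) - 2) / c ^+ 2.
Proof.
move=> c0; rewrite /sinhq expr_div_n sqrrB; congr (_ / _).
rewrite -!expRM_natl -expRD subrr expR0.
have -> : 2 * (c * x / 2) = c * x by field.
have -> : 2 * - (c * x / 2) = - c * x by field.
by ring.
Qed.

Lemma sinhqN c x : sinhq c (- x) = - sinhq c x.
Proof.
rewrite /sinhq -[RHS]mulNr opprB; congr ((expR _ - expR _) / _); by field.
Qed.

Lemma sinhq_ge c x : 0 < c -> 0 <= x -> x * expR (- (c * x / 2)) <= sinhq c x.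
Proof.
move=> c0 x0; rewrite /sinhq ler_pdivlMr//.
have := expR_sub_le (- (c * x / 2)) (c * x / 2).
have -> : - (c * x / 2) - c * x / 2 = - (c * x) by field.
lra.
Qed.

Lemma sinhq_le c x : 0 < c -> 0 <= x -> sinhq c x <= x * expR (c * x / 2).
Proof.
move=> c0 x0; rewrite /sinhq ler_pdivrMr//.
have := expR_sub_le (c * x / 2) (- (c * x / 2)).
have -> : c * x / 2 - - (c * x / 2) = c * x by field.
lra.
Qed.

Lemma sinhq_ge0 c x : 0 < c -> 0 <= x -> 0 <= sinhq c x.
Proof.
move=> c0 x0; apply: le_trans (sinhq_ge c0 x0).
by rewrite mulr_ge0// expR_ge0.
Qed.

Lemma sinhq_bound c x : 0 < c -> c <= 1 -> `|sinhq c x| <= expR (2 * `|x|).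
Proof.
move=> c0 c1; wlog x0 : x / 0 <= x.
  move=> H; have [|x0] := leP 0 x; first exact: H.
  by have := H (- x); rewrite sinhqN !normrN; apply; lra.
rewrite !ger0_norm ?sinhq_ge0//; apply: le_trans (sinhq_le c0 x0) _.
have -> : 2 * x = x + x by ring.
rewrite expRD ler_pM ?expR_ge0//.
  by apply: le_trans (expR_ge1Dx x); lra.
rewrite ler_expR; nra.
Qed.

Let cvg_exp0 (a : R) : expR (a * k.+1%:R^-1) @[k --> \oo] --> (1 : R).
Proof.
rewrite -[X in _ --> X]expR0; apply: continuous_cvg; first exact: continuous_expR.
rewrite -[X in _ --> X](mulr0 a); apply: cvgM; first exact: cvg_cst.
exact: cvg_harmonic.
Qed.

Lemma sinhq_cvg x : sinhq k.+1%:R^-1 x @[k --> \oo] --> x.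
Proof.
wlog x0 : x / 0 <= x.
  move=> H; have [|x0] := leP 0 x; first exact: H.
  rewrite -[X in _ --> X]opprK (_ : (fun k => _) = (fun k : nat => - sinhq k.+1%:R^-1 (- x))).
    by apply: cvgN; apply: H; lra.
  by apply/funext => k; rewrite sinhqN opprK.
apply: (@squeeze_cvgr _ _ _ _ (fun k => x * expR (- (x / 2) * k.+1%:R^-1))
  (fun k => x * expR (x / 2 * k.+1%:R^-1))).
- apply: nearW => k; have : 0 < k.+1%:R^-1 :> R by [].
  move: (k.+1%:R^-1) => c k0; apply/andP; split.
    by apply: le_trans (sinhq_ge k0 x0); rewrite ler_wpM2l// ler_expR; lra.
  by apply: le_trans (sinhq_le k0 x0) _; rewrite ler_wpM2l// ler_expR; lra.
- rewrite -[X in _ --> X]mulr1; apply: cvgM; [exact: cvg_cst|exact: cvg_exp0].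
- rewrite -[X in _ --> X]mulr1; apply: cvgM; [exact: cvg_cst|exact: cvg_exp0].
Qed.

(** The left-hand side is the second moment of sinhq c Y for a centred
    Gaussian Y of variance t, at c = 1/(k+1). *)
Lemma mgf_quotient_cvg (t : R) : 0 <= t ->
  (2 * expR (k.+1%:R^-1 ^+ 2 * t / 2) - 2) / k.+1%:R^-1 ^+ 2 @[k --> \oo] --> t.
Proof.
move=> t0.
apply: (@squeeze_cvgr _ _ _ _ (fun=> t) (fun k => t * expR (t / 2 * k.+1%:R^-1))).
- apply: nearW => k; have k0 : 0 < k.+1%:R^-1 :> R by [].
  have k1 : k.+1%:R^-1 <= 1 :> R by rewrite invf_le1// ler1n.
  move: k0 k1; move: (k.+1%:R^-1) => c c0 c1.
  have c20 : 0 < c ^+ 2 by rewrite exprn_gt0.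
  rewrite ler_pdivlMr// ler_pdivrMr//; apply/andP; split.
    have := expR_ge1Dx (c ^+ 2 * t / 2); lra.
  have := expR_sub_le (c ^+ 2 * t / 2) 0; rewrite expR0 subr0 => H.
  have H2 : expR (c ^+ 2 * t / 2) <= expR (t / 2 * c).
    rewrite ler_expR -subr_ge0.
    have -> : t / 2 * c - c ^+ 2 * t / 2 = t / 2 * (c * (1 - c)) by field.
    by rewrite !mulr_ge0; lra.
  have : c ^+ 2 * t / 2 * expR (c ^+ 2 * t / 2) <= c ^+ 2 * t / 2 * expR (t / 2 * c).
    rewrite ler_wpM2l//; apply: divr_ge0 => //; apply: mulr_ge0 => //; exact: ltW.
  lra.
- exact: cvg_cst.
- rewrite -[X in _ --> X]mulr1; apply: cvgM; [exact: cvg_cst|exact: cvg_exp0].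
Qed.

End cosh_quotient.

Section gaussian_rv.
Context d (T : measurableType d) (R : realType) (P : probability T R).

Lemma expR_norm_le (x : R) : expR `|x| <= expR x + expR (- x).
Proof. by case: ger0P => _; rewrite ?lerDl ?lerDr ?expR_ge0. Qed.

Lemma gaussian_mgf (Y : {RV P >-> R}) (s : R) : s != 0 ->
  (forall A, measurable A -> distribution P Y A = normal_prob 0 s A) ->
  forall a, (\int[P]_w (expR (a * Y w))%:E = (expR (a ^+ 2 * s ^+ 2 / 2))%:E)%E.
Proof.
move=> s0 Ylaw a.
(* normal_prob lives on the copy of R whose Borel sets are generated by
   intervals *)
have mY : measurable_fun setT (Y : T -> measurableTypeR R).
  have h : measurable_fun setT Y by [].
  exact: h.
pose Y' : {mfun T >-> measurableTypeR R} :=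
  HB.pack (Y : T -> measurableTypeR R) (@isMeasurableFun.Build _ _ _ _ _ mY).
rewrite -(normal_mgf a s0).
transitivity (\int[distribution P Y']_x (expR (a * x))%:E)%E.
  rewrite ge0_integral_distribution//.
  have me : measurable_fun setT (fun x : R => (expR (a * x))%:E).
    by apply/measurable_EFinP; apply: measurableT_comp => //; exact: measurable_funM.
  exact: me.
by apply: eq_measure_integral => A mA _; exact: Ylaw.
Qed.

Lemma gaussian_exp_Lfun2 (Y : {RV P >-> R}) (s : R) : s != 0 ->
  (forall A, measurable A -> distribution P Y A = normal_prob 0 s A) ->
  forall c : R, (fun w => expR (c * `|Y w|)) \in Lfun P 2%:E.
Proof.
move=> s0 Ylaw c; wlog c0 : c / 0 <= c.
  move=> H; have [|c0] := leP 0 c; first exact: H.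
  apply: (@Lfun2_le _ _ _ _ _ (fun w => expR (- c * `|Y w|))).
  - apply: measurableT_comp => //; apply: measurable_funM => //.
    exact: measurableT_comp.
  - by apply: H; lra.
  - move=> w; rewrite [leLHS]ger0_norm ?expR_ge0// [leRHS]ger0_norm ?expR_ge0//.
    rewrite ler_expR ler_wpM2r//; lra.
have mY : measurable_fun setT Y by [].
have mgf a : P.-integrable setT (EFin \o (fun w => expR (a * Y w))).
  apply/integrableP; split.
    by apply/measurable_EFinP; apply: measurableT_comp => //; exact: measurable_funM.
  under eq_integral do rewrite /= ger0_norm ?expR_ge0//.
  by rewrite (gaussian_mgf s0 Ylaw) ltry.
apply/Lfun2P; split.
  apply: measurableT_comp => //; apply: measurable_funM => //.
  exact: measurableT_comp.
have := integrableD_EFin (mgf (2 * c)) (mgf (- (2 * c))).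
apply: le_integrable => //.
  apply/measurable_EFinP; apply: measurable_funX.
  apply: measurableT_comp => //; apply: measurable_funM => //.
  exact: measurableT_comp.
move=> w _ /=; rewrite lee_fin ger0_norm ?sqr_ge0// [leRHS]ger0_norm ?addr_ge0 ?expR_ge0//.
rewrite -expRM_natl mulrA -[leLHS]/(expR (2 * c * `|Y w|)).
rewrite -[in leLHS](@ger0_norm _ (2 * c)) ?mulr_ge0// -normrM mulNr.
exact: expR_norm_le.
Qed.

Lemma gaussian_second_moment (Y : {RV P >-> R}) (s : R) : s != 0 ->
  (forall A, measurable A -> distribution P Y A = normal_prob 0 s A) ->
  (Y : T -> R) \in Lfun P 2%:E /\ dotp P Y Y = s ^+ 2.
Proof.
move=> s0 Ylaw; have eL := gaussian_exp_Lfun2 s0 Ylaw.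
have mY : measurable_fun setT Y by [].
have mq c : measurable_fun setT (fun w => sinhq c (Y w)).
  rewrite /sinhq; apply: measurable_funM => //; apply: measurable_funB.
    by apply: measurableT_comp => //; do 2 apply: measurable_funM => //.
  apply: measurableT_comp => //; apply: measurableT_comp => //.
  by do 2 apply: measurable_funM => //.
have qb k w : `|sinhq k.+1%:R^-1 (Y w)| <= expR (2 * `|Y w|).
  by apply: sinhq_bound; rewrite ?invf_le1 ?ler1n.
have cq w : sinhq k.+1%:R^-1 (Y w) @[k --> \oo] --> Y w by exact: sinhq_cvg.
have [YL qY] := L2_dominated_cvg (fun k => mq k.+1%:R^-1) (eL 2) qb cq.
split=> //.
have qL k : (fun w => sinhq k.+1%:R^-1 (Y w)) \in Lfun P 2%:E.
  apply: (Lfun2_le (mq _) (eL 2)) => w; rewrite [leRHS]ger0_norm ?expR_ge0//.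
have mgf := gaussian_mgf s0 Ylaw.
have iE a : P.-integrable setT (EFin \o (fun w => expR (a * Y w))).
  apply/integrableP; split.
    by apply/measurable_EFinP; apply: measurableT_comp => //; exact: measurable_funM.
  under eq_integral do rewrite /= ger0_norm ?expR_ge0//.
  by rewrite mgf ltry.
have nq k : L2norm P (fun w => sinhq k.+1%:R^-1 (Y w)) ^+ 2 =
    (2 * expR (k.+1%:R^-1 ^+ 2 * s ^+ 2 / 2) - 2) / k.+1%:R^-1 ^+ 2.
  set c := k.+1%:R^-1; have c0 : c != 0 by rewrite gt_eqF// /c invr_gt0.
  rewrite L2norm_sqr /dotp; under eq_Rintegral do rewrite -expr2 sinhq_sqr//.
  rewrite RintegralZr//; last first.
    apply: integrableB_EFin; first exact: integrableD_EFin.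
    exact: finite_measure_integrable_cst.
  rewrite RintegralB//; [|exact: integrableD_EFin|exact: finite_measure_integrable_cst].
  rewrite RintegralD// Rintegral_cst// /Rintegral !mgf/= probability_setT/=.
  by rewrite sqrrN mulr1; congr (_ / _); ring.
have c1 : L2norm P (fun w => sinhq k.+1%:R^-1 (Y w)) @[k --> \oo] --> L2norm P Y.
  exact: L2norm_cvg.
have c2 : L2norm P (fun w => sinhq k.+1%:R^-1 (Y w)) ^+ 2 @[k --> \oo] --> dotp P Y Y.
  by rewrite -L2norm_sqr expr2; under eq_fun do rewrite expr2; exact: cvgM.
have := mgf_quotient_cvg (sqr_ge0 s).
under eq_fun do rewrite -nq.
by move=> c3; rewrite -(cvg_lim _ c2)// -(cvg_lim _ c3).
Qed.

End gaussian_rv.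

Section pairwise_independence.
Context d (T : measurableType d) (R : realType) (P : probability T R).

(** The joint law is the product of the marginal laws, so Fubini applies. *)
Lemma independent_integralM (X Y : {RV P >-> R}) (u v : R -> R) :
  (forall A B : set R, measurable A -> measurable B ->
    P (X @^-1` A `&` Y @^-1` B) = (P (X @^-1` A) * P (Y @^-1` B))%E) ->
  measurable_fun setT u -> measurable_fun setT v ->
  (fun w => u (X w)) \in Lfun P 2%:E -> (fun w => v (Y w)) \in Lfun P 2%:E ->
  dotp P (fun w => u (X w)) (fun w => v (Y w)) =
  (\int[P]_w u (X w)) * (\int[P]_w v (Y w)).
Proof.
move=> XY mu_ mv uL vL.
have iu : P.-integrable setT (EFin \o (fun w => u (X w))).
  by apply/Lfun1_integrable; apply: Lfun_subset12 uL; exact: fin_num_measure.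
have iv : P.-integrable setT (EFin \o (fun w => v (Y w))).
  by apply/Lfun1_integrable; apply: Lfun_subset12 vL; exact: fin_num_measure.
have iuv := Lfun2_integrableM uL vL.
have mXY : measurable_fun setT (fun w => (X w, Y w)).
  by apply: measurable_fun_pair.
pose Z : {mfun T >-> (R * R)%type} :=
  HB.pack (fun w => (X w, Y w)) (@isMeasurableFun.Build _ _ _ _ _ mXY).
pose PX : probability R R := distribution P X.
pose PY : probability R R := distribution P Y.
have muv : measurable_fun setT (fun p : R * R => (u p.1 * v p.2)%:E).
  by apply/measurable_EFinP; apply: measurable_funM; exact: measurableT_comp.
have E A : measurable A -> (PX \x PY)%E A = distribution P Z A.
  by move=> mA; apply: product_measure_unique.
have ixy : (PX \x PY)%E.-integrable setT (fun p => (u p.1 * v p.2)%:E).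
  apply/integrableP; split => //.
  rewrite (eq_measure_integral (distribution P Z)); last by move=> A mA _; exact: E.
  rewrite ge0_integral_distribution//; last exact: measurableT_comp.
  by have /integrableP[] := iuv.
rewrite /dotp /Rintegral.
transitivity (fine (\int[(PX \x PY)%E]_p (u p.1 * v p.2)%:E)%E).
  congr fine; rewrite (eq_measure_integral (distribution P Z)); last first.
    by move=> A mA _; exact: E.
  by rewrite (@integral_distribution _ _ _ _ _ P Z (fun p => (u p.1 * v p.2)%:E)).
rewrite -integral12_prod_meas1//= /fubini_F.
have iuX : PX.-integrable setT (EFin \o u).
  apply: integrable_pushforward => //; exact/measurable_EFinP.
have ivY : PY.-integrable setT (EFin \o v).
  apply: integrable_pushforward => //; exact/measurable_EFinP.
have EY : (\int[PY]_y (v y)%:E = (\int[P]_w v (Y w))%:E)%E.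
  rewrite (@integral_distribution _ _ _ _ _ P Y (EFin \o v))//; last first.
    exact/measurable_EFinP.
  by rewrite fineK//; exact: integrable_fin_num.
have EX : (\int[PX]_x (u x)%:E = (\int[P]_w u (X w))%:E)%E.
  rewrite (@integral_distribution _ _ _ _ _ P X (EFin \o u))//; last first.
    exact/measurable_EFinP.
  by rewrite fineK//; exact: integrable_fin_num.
have Ex x : (\int[PY]_y (u x * v y)%:E = (u x)%:E * (\int[P]_w v (Y w))%:E)%E.
  by under eq_integral do rewrite EFinM; rewrite (integralZl measurableT ivY) EY.
under eq_integral do rewrite Ex.
by rewrite integralZr// EX -EFinM.
Qed.

Lemma dotp_sum_le (F : nat -> T -> R) (N : nat) (b c : R) :
  (forall i, F i \in Lfun P 2%:E) -> 0 <= b ->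
  (forall i, dotp P (F i) (F i) <= b) ->
  (forall i j, i != j -> dotp P (F i) (F j) <= c) ->
  0 <= c ->
  dotp P (fun w => \sum_(i < N) F i w) (fun w => \sum_(i < N) F i w) <=
  N%:R * b + N%:R ^+ 2 * c.
Proof.
move=> FL b0 Fb Fc c0.
rewrite dotp_sumr//; last exact: Lfun2_sum.
apply: (@le_trans _ _ (\sum_(i < N) (b + N%:R * c))); last first.
  by rewrite sumr_const card_ord -[leLHS]mulr_natl mulrDr mulrA -expr2.
apply: ler_sum => i _; rewrite dotpC dotp_sumr//.
rewrite (bigD1 i)//= lerD//.
apply: (@le_trans _ _ (\sum_(j < N) c)).
  rewrite [leRHS](bigD1 i)//= -[leLHS]add0r lerD//.
  by apply: ler_sum => j ji; apply: Fc; rewrite eq_sym.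
by rewrite sumr_const card_ord mulr_natl.
Qed.

End pairwise_independence.

(** * Trigonometric bounds and convergence in probability *)

Section trigonometric_bounds.
Context (R : realType).

Lemma cos_lipschitz (x y : R) : `|cos x - cos y| <= `|x - y|.
Proof.
wlog xy : x y / y <= x.
  move=> H; have [/H//|/ltW /H] := leP y x.
  by rewrite distrC => /le_trans; apply; rewrite distrC.
have [x1|z zI ->] := @MVT_segment _ cos (- sin) _ _ xy.
  exact/continuous_subspaceT/continuous_cos.
rewrite normrM ler_piMl// normrN; exact: sin_max.
Qed.

Lemma sin_MVT (x : R) : exists2 z, `|z| <= `|x| & sin x = cos z * x.
Proof.
wlog x0 : x / 0 <= x.
  move=> H; have [/H//|x0] := leP 0 x.
  have [|z zx e] := H (- x); first by lra.
  exists z; first by rewrite -(normrN x).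
  by apply: oppr_inj; rewrite -sinN e mulrN.
have [x1|z zI] := @MVT_segment _ sin cos _ _ x0.
  exact/continuous_subspaceT/continuous_sin.
rewrite sin0 !subr0 => ->; exists z => //.
move: zI; rewrite in_itv/= => /andP[z0 zx].
by rewrite !ger0_norm.
Qed.

(** Bounds both |cos x - 1| and |sin x|. It is bounded and vanishes at 0, hence
    xi * trunc2 (xi / r) tends to 0 in L2 as r grows with no moment of xi
    beyond the second. *)
Definition trunc2 (x : R) : R := Num.min 2 `|x|.

Lemma trunc2_ge0 x : 0 <= trunc2 x.
Proof. by rewrite /trunc2 le_min normr_ge0 andbT. Qed.

Lemma trunc2_le2 x : trunc2 x <= 2.
Proof. by rewrite /trunc2 ge_min lexx. Qed.

Lemma trunc2_mono x y : `|x| <= `|y| -> trunc2 x <= trunc2 y.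
Proof.
move=> xy; rewrite /trunc2 le_min; apply/andP; split.
  by rewrite ge_min lexx.
by rewrite ge_min xy orbT.
Qed.

Lemma cosB1_trunc2 (x : R) : `|cos x - 1| <= trunc2 x.
Proof.
rewrite /trunc2 le_min; apply/andP; split.
  apply: le_trans (ler_normB _ _) _; rewrite normr1.
  have := cos_max x; lra.
by have := cos_lipschitz x 0; rewrite cos0 subr0.
Qed.

Lemma sin_trunc2 (x : R) : `|sin x| <= trunc2 x.
Proof.
rewrite /trunc2 le_min; apply/andP; split.
  by have := sin_max x; lra.
have [z _ ->] := sin_MVT x; rewrite normrM ler_piMl//; exact: cos_max.
Qed.

Lemma sinBid_trunc2 (x : R) : `|sin x - x| <= `|x| * trunc2 x.
Proof.
have [z zx ->] := sin_MVT x.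
rewrite -[X in _ - X]mul1r -mulrBl normrM mulrC ler_wpM2l//.
by apply: le_trans (cosB1_trunc2 z) _; exact: trunc2_mono.
Qed.

Lemma cosB1_sqr_trunc2 (x : R) : `|cos x - 1| <= `|x| * trunc2 x.
Proof.
have -> : cos x - 1 = - (sin (x / 2) ^+ 2 *+ 2).
  have -> : cos x = cos ((x / 2) *+ 2) by congr cos; rewrite -mulr_natr divfK.
  rewrite cos_mulr2n cos2sin2 -[_ *+ 2]mulr_natr -[in RHS]mulr_natr; ring.
rewrite normrN -mulr_natr normrM normrX expr2 (ger0_norm (_ : 0 <= 2%:R))//.
have H1 : `|sin (x / 2)| <= `|x| / 2.
  have [z _ ->] := sin_MVT (x / 2).
  rewrite normrM normrM (ger0_norm (_ : 0 <= 2^-1)) ?invr_ge0//.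
  rewrite ler_piMl ?divr_ge0//; exact: cos_max.
have H2 : `|sin (x / 2)| <= trunc2 x.
  apply: le_trans (sin_trunc2 _) _; apply: trunc2_mono.
  rewrite normrM (ger0_norm (_ : 0 <= 2^-1)) ?invr_ge0//.
  have := normr_ge0 x; lra.
have := ler_pM (normr_ge0 _) (normr_ge0 _) H1 H2; lra.
Qed.

Lemma measurable_trunc2 : measurable_fun setT trunc2.
Proof. by apply: measurable_minr => //; exact: measurable_normr. Qed.

End trigonometric_bounds.

Section cvg_lemmas.
Context (R : realType).

Lemma cvg0_two_step (u : nat -> R) (a : nat -> nat -> R) (b : nat -> R) :
  (forall n, 0 <= u n) -> (forall k n, u n <= a k n + b k) ->
  (forall k, a k n @[n --> \oo] --> 0) -> b k @[k --> \oo] --> 0 ->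
  u n @[n --> \oo] --> 0.
Proof.
move=> u0 uab a0 b0; apply/cvgrPdist_lt => e e0.
have e2 : 0 < e / 2 by lra.
have /cvgrPdist_lt /(_ _ e2)[K _ /(_ K)] := b0.
rewrite /= leqnn sub0r normrN => /(_ isT) bK.
have /cvgrPdist_lt /(_ _ e2)[N _ aN] := a0 K.
exists N => // n /= Nn; rewrite sub0r normrN ger0_norm//.
have := aN n Nn; rewrite /= sub0r normrN => aK.
have := ler_norm (a K n); have := ler_norm (b K); have := uab K n; lra.
Qed.

End cvg_lemmas.

Section convergence_in_probability.
Context d (T : measurableType d) (R : realType) (P : probability T R).
Local Notation L2 := (Lfun P 2%:E).
Local Notation nrm := (L2norm P).
Local Notation dot := (dotp P).

Definition tail (V : T -> R) (k : nat) (w : T) : R :=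
  V w * \1_[set w | k%:R < `|V w|] w.

Let measurable_tailset (V : T -> R) (k : nat) : measurable_fun setT V ->
  measurable [set w | k%:R < `|V w|].
Proof.
move=> mV; rewrite -[X in measurable X]setTI.
have mn : measurable_fun setT (fun w => `|V w|) by exact: measurableT_comp.
rewrite (_ : [set w | _] = (fun w => `|V w|) @^-1` `]k%:R, +oo[).
  exact: mn.
by apply/seteqP; split => w /=; rewrite in_itv/= andbT.
Qed.

Lemma measurable_tail V k : measurable_fun setT V ->
  measurable_fun setT (tail V k).
Proof.
move=> mV; apply: measurable_funM => //.
by apply: measurable_indic; exact: measurable_tailset.
Qed.

Lemma tail_cvg V : V \in L2 -> nrm (tail V k) @[k --> \oo] --> 0.
Proof.
move=> VL; have mV := Lfun2_measurable VL.
have tb k w : `|tail V k w| <= `|V w|.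
  rewrite /tail normrM ler_piMr// indicE.
  by case: (_ \in _); rewrite ?normr1 ?normr0.
have tc w : tail V k w @[k --> \oo] --> 0.
  apply: cvg_near_cst; exists (Num.truncn `|V w|).+1 => // k /= hk.
  rewrite /tail indicE memNset ?mulr0//=.
  apply/negP; rewrite -leNgt; apply: ltW.
  by apply: lt_le_trans (truncnS_gt _) _; rewrite ler_nat.
have [_] := L2_dominated_cvg (fun k => measurable_tail k mV) (Lfun2_abs VL) tb tc.
rewrite (_ : (fun k => nrm (fun x => tail V k x - 0)) = fun k => nrm (tail V k))//.
by apply/funext => k; congr nrm; apply/funext => w; rewrite subr0.
Qed.

Lemma Lfun2_tail V k : V \in L2 -> tail V k \in L2.
Proof.
move=> VL; apply: (Lfun2_le (measurable_tail _ (Lfun2_measurable VL)) VL) => w.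
rewrite /tail normrM ler_piMr// indicE.
by case: (_ \in _); rewrite ?normr1 ?normr0.
Qed.

(** V is cut at a level k: its bounded part is harmless against D n, its tail
    is small against the bound on D n. First n, then k tends to infinity. *)
Lemma bounded_mul_cvg0 (D : nat -> T -> R) (V : T -> R) (c : R) :
  (forall n, D n \in L2) -> V \in L2 -> (forall n w, `|D n w| <= c) ->
  nrm (D n) @[n --> \oo] --> 0 ->
  nrm (fun w => D n w * V w) @[n --> \oo] --> 0.
Proof.
move=> DL VL Dc D0.
have mV := Lfun2_measurable VL; have mD n := Lfun2_measurable (DL n).
have cc : `|c| * nrm (tail V k) @[k --> \oo] --> 0.
  by rewrite -[X in _ --> X](mulr0 `|c|); apply: cvgM; [exact: cvg_cst|exact: tail_cvg].
apply: (cvg0_two_step _ _ _ cc) => [n|k n|k].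
- exact: L2norm_ge0.
- have -> : (fun w => D n w * V w) =
      (fun w => (V w - tail V k w) * D n w + D n w * tail V k w).
    by apply/funext => w; rewrite mulrBl [tail _ _ _ * _]mulrC [V w * _]mulrC subrK.
  have mW : measurable_fun setT (fun w => V w - tail V k w).
    by apply: measurable_funB => //; exact: measurable_tail.
  have Wk w : `|V w - tail V k w| <= k%:R.
    rewrite /tail indicE; have [h|/negP h] := boolP (k%:R < `|V w|).
      by rewrite mem_set// mulr1 subrr normr0.
    by rewrite memNset// mulr0 subr0 leNgt; apply/negP.
  apply: le_trans (L2normD _ _) _.
  + exact: (Lfun2_mul_bounded (DL n) mW Wk).
  + exact: (Lfun2_mul_bounded (Lfun2_tail k VL) (mD n) (Dc n)).
  rewrite lerD//.
    exact: (L2norm_mul_bounded (DL n) mW (ler0n _ _) Wk).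
  apply: (L2norm_mul_bounded (Lfun2_tail k VL) (mD n)) => // w.
  by apply: le_trans (Dc n w) (ler_norm c).
- by rewrite -[X in _ --> X](mulr0 k%:R); apply: cvgM => //; exact: cvg_cst.
Qed.

(** Here V is cut at a level k, and against the part bounded by k the integral
    of D n is split according to whether |D n| exceeds (k+1)^-2: the small
    values contribute at most 1/(k+1), the large ones vanish with their
    probability by Cauchy-Schwarz. *)
Lemma dotp_cvg0_in_probability (D : nat -> T -> R) (V : T -> R) (M : R) :
  (forall n, D n \in L2) -> V \in L2 -> (forall n, nrm (D n) <= M) ->
  cvg_in_probability P D (fun=> 0) ->
  dot (D n) V @[n --> \oo] --> 0.
Proof.
move=> DL VL DM Dp.
have mV := Lfun2_measurable VL; have mD n := Lfun2_measurable (DL n).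
have M0 : 0 <= M by apply: le_trans (L2norm_ge0 P (D 0%N)) (DM _).
pose A k n := [set w | k.+1%:R^-1 ^+ 2 <= `|D n w - 0|].
have mA k n : measurable (A k n).
  rewrite -[X in measurable X]setTI.
  rewrite (_ : A k n = (fun w => `|D n w - 0|) @^-1` `[k.+1%:R^-1 ^+ 2, +oo[).
    have mn : measurable_fun setT (fun w => `|D n w - 0|).
      by apply: measurableT_comp => //; exact: measurable_funB.
    exact: mn.
  by apply/seteqP; split => w /=; rewrite in_itv/= andbT.
have indA k n : nrm (\1_(A k n)) = Num.sqrt (fine (P (A k n))).
  rewrite /L2norm /dotp; congr Num.sqrt;
  rewrite Rintegral_indicr /Rintegral integral_indic//.
  by rewrite setIid.
have indL k n : (\1_(A k n) : T -> R) \in L2.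
  apply: (@Lfun2_le _ _ _ _ _ (fun=> 1)) => [||w]; first exact: measurable_indic.
    exact: Lfun_cst.
  by rewrite indicE; case: (_ \in _); rewrite ?normr1 ?normr0.
have b0 : k.+1%:R^-1 + M * nrm (tail V k) @[k --> \oo] --> 0.
  rewrite -[X in _ --> X]addr0; apply: cvgD; first exact: cvg_harmonic.
  by rewrite -[X in _ --> X](mulr0 M); apply: cvgM; [exact: cvg_cst|exact: tail_cvg].
apply/norm_cvg0P; apply: (cvg0_two_step (a := fun k n => k%:R * (M * nrm (\1_(A k n)))) _ _ _ b0).
- by move=> n; exact: normr_ge0.
- move=> k n.
  have WL : (fun w => V w - tail V k w) \in L2 by apply: Lfun2B => //; exact: Lfun2_tail.
  have Wk w : `|V w - tail V k w| <= k%:R.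
    rewrite /tail indicE; have [h|/negP h] := boolP (k%:R < `|V w|).
      by rewrite mem_set// mulr1 subrr normr0.
    by rewrite memNset// mulr0 subr0 leNgt; apply/negP.
  have -> : dot (D n) V = dot (D n) (fun w => V w - tail V k w) + dot (D n) (tail V k).
    rewrite -dotpDr//; last exact: Lfun2_tail.
    by apply: eq_Rintegral => w _; rewrite subrK.
  apply: le_trans (ler_normD _ _) _; rewrite addrA lerD//; last first.
    apply: le_trans (L2_CauchySchwarz (DL n) (Lfun2_tail k VL)) _.
    by rewrite ler_wpM2r// L2norm_ge0.
  have iA : P.-integrable setT (EFin \o (fun w => `|D n w| * \1_(A k n) w)).
    by apply: Lfun2_integrableM => //; exact: Lfun2_abs.
  apply: le_trans (le_normr_Rintegral measurableT (Lfun2_integrableM (DL n) WL)) _.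
  apply: (@le_trans _ _ (\int[P]_w (k%:R * (`|D n w| * \1_(A k n) w) + k.+1%:R^-1))).
    apply: le_Rintegral => //.
    + exact: integrable_norm (Lfun2_integrableM (DL n) WL).
    + apply: integrableD_EFin; first exact: integrableZ_EFin.
      exact: finite_measure_integrable_cst.
    move=> w _; rewrite normrM.
    apply: (@le_trans _ _ (k%:R * `|D n w|)); first by rewrite mulrC ler_wpM2r.
    rewrite indicE; have [h|/negP h] := boolP (k.+1%:R^-1 ^+ 2 <= `|D n w|).
      by rewrite mem_set ?mulr1 ?lerDl// /A/= subr0.
    rewrite memNset ?mulr0 ?add0r; last by rewrite /A/= subr0.
    apply: (@le_trans _ _ (k.+1%:R * k.+1%:R^-1 ^+ 2)).
      rewrite ler_pM// ?ler_nat// ltW// ltNge; exact/negP.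
    by rewrite expr2 mulrA divff// mul1r.
  rewrite RintegralD//; [|exact: integrableZ_EFin|exact: finite_measure_integrable_cst].
  rewrite RintegralZl// Rintegral_cst// /= probability_setT/= mulr1 lerD//.
  rewrite ler_wpM2l//.
  have := L2_CauchySchwarz (Lfun2_abs (DL n)) (indL k n).
  move=> /(le_trans (ler_norm _)) /le_trans; apply.
  by rewrite L2norm_abs ler_wpM2r// L2norm_ge0.
- move=> k; rewrite -[X in _ --> X](mulr0 k%:R); apply: cvgM; first exact: cvg_cst.
  rewrite -[X in _ --> X](mulr0 M); apply: cvgM; first exact: cvg_cst.
  have k0 : 0 < k.+1%:R^-1 ^+ 2 :> R by rewrite exprn_gt0.
  have := Dp _ k0 => /fine_cvgP[_ H].
  rewrite -[X in _ --> X](@sqrtr0 R); under eq_fun do rewrite indA.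
  by apply: continuous_cvg => //; exact: sqrt_continuous.
Qed.

(** A theorem of Riesz: once the norms converge, the squared distance tends to
    0 as soon as the pairing of X_ n - X with X does. *)
Lemma L2_cvg_in_probability (X_ : nat -> T -> R) (X : T -> R) :
  (forall n, X_ n \in L2) -> X \in L2 -> cvg_in_probability P X_ X ->
  dot (X_ n) (X_ n) @[n --> \oo] --> dot X X ->
  nrm (fun w => X_ n w - X w) @[n --> \oo] --> 0.
Proof.
move=> XnL XL Xp Xn.
have DL n : (fun w => X_ n w - X w) \in L2 by exact: Lfun2B.
have [M XM] : exists M, forall n, nrm (X_ n) <= M.
  have : cvgn (fun n => dot (X_ n) (X_ n)) by apply/cvg_ex; exists (dot X X).
  move=> /cvg_seq_bounded [M [_ MP]].
  exists (Num.sqrt (M + 1)) => n; rewrite ler_sqrt.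
    by apply: le_trans (ler_norm _) (MP _ _ _ _) => //; lra.
  by apply: le_trans (normr_ge0 _) (MP (M + 1) _ 0%N _) => //; lra.
have D0 : dot (fun w => X_ n w - X w) X @[n --> \oo] --> 0.
  apply: (dotp_cvg0_in_probability DL XL (M := M + nrm X)) => [n|e e0].
    by apply: le_trans (L2normB _ _) _ => //; rewrite lerD2r.
  by have := Xp _ e0; under eq_fun do under eq_set do rewrite -[_ - _]subr0.
have E n : dot (fun w => X_ n w - X w) (fun w => X_ n w - X w) =
    dot (X_ n) (X_ n) - dot X X - 2 * dot (fun w => X_ n w - X w) X.
  rewrite !dotpBr ?dotpBl//; try exact: Lfun2B.
  by rewrite (dotpC P X (X_ n)); ring.
rewrite -[X in _ --> X](@sqrtr0 R).
apply: continuous_cvg; first exact: sqrt_continuous.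
rewrite (_ : (fun n => _) = (fun n => dot (X_ n) (X_ n) - dot X X -
    2 * dot (fun w => X_ n w - X w) X)); last by apply/funext => n; exact: E.
rewrite -[X in _ --> X](subr0 0); apply: cvgB.
  by rewrite -[X in _ --> X](subrr (dot X X)); apply: cvgB => //; exact: cvg_cst.
by rewrite -[X in _ --> X](mulr0 2); apply: cvgM => //; exact: cvg_cst.
Qed.

End convergence_in_probability.

(** * Sums over one row of the array *)

Section same_law.
Context d (T : measurableType d) d' (T' : measurableType d') (R : realType).
Context (P : probability T R) (P' : probability T' R).
Context (X : {RV P >-> R}) (X' : {RV P' >-> R}).
Context (law : forall A : set R, measurable A ->
  distribution P X A = distribution P' X' A).

Lemma same_law_ge0_integral (f : R -> \bar R) :
  measurable_fun setT f -> (forall x, 0 <= f x)%E ->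
  (\int[P]_w f (X w) = \int[P']_w f (X' w))%E.
Proof.
move=> mf f0.
transitivity (\int[distribution P X]_x f x)%E.
  by rewrite ge0_integral_distribution.
rewrite (eq_measure_integral (distribution P' X')).
  by rewrite ge0_integral_distribution.
by move=> A mA _; exact: law.
Qed.

Lemma same_law_Lfun2 (f : R -> R) : measurable_fun setT f ->
  (fun w => f (X' w)) \in Lfun P' 2%:E ->
  [/\ (fun w => f (X w)) \in Lfun P 2%:E,
      L2norm P (fun w => f (X w)) = L2norm P' (fun w => f (X' w)) &
      \int[P]_w f (X w) = \int[P']_w f (X' w)].
Proof.
move=> mf fL.
have mf2 : measurable_fun setT (fun x => (f x ^+ 2)%:E).
  by apply/measurable_EFinP; exact: measurable_funX.
have E2 := same_law_ge0_integral mf2 (fun x => sqr_ge0 (f x)).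
have fXL : (fun w => f (X w)) \in Lfun P 2%:E.
  apply/Lfun2P; split; first exact: measurableT_comp.
  apply/integrableP; split.
    by apply/measurable_EFinP; apply: measurable_funX; exact: measurableT_comp.
  under eq_integral do rewrite /= ger0_norm ?sqr_ge0//.
  rewrite E2; have /Lfun2P[_ /integrableP[_]] := fL.
  by under eq_integral do rewrite /= ger0_norm ?sqr_ge0//.
split => //.
  apply/eqP; rewrite -(@eqrXn2 _ 2) ?L2norm_ge0//; apply/eqP/EFin_inj.
  by rewrite !L2norm_int.
have iX' : P'.-integrable setT (EFin \o (fun w => f (X' w))).
  by apply/Lfun1_integrable; apply: Lfun_subset12 fL; exact: fin_num_measure.
have iX : P.-integrable setT (EFin \o (fun w => f (X w))).
  by apply/Lfun1_integrable; apply: Lfun_subset12 fXL; exact: fin_num_measure.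
congr fine.
transitivity (\int[distribution P X]_x (f x)%:E)%E.
  by rewrite (integral_distribution (f := EFin \o f))//; exact/measurable_EFinP.
rewrite (eq_measure_integral (distribution P' X')); last by move=> A mA _; exact: law.
by rewrite (integral_distribution (f := EFin \o f))//; exact/measurable_EFinP.
Qed.
End same_law.

Section rows.
Context (R : realType) d (T : measurableType d) (P : probability T R).
Context d' (T' : measurableType d') (P' : probability T' R).
Context (xi : {RV P' >-> R}) (xin : nat -> nat -> {RV P >-> R}).
Context (xiL : (xi : T' -> R) \in Lfun P' 2%:E).
Context (xi0 : ('E_P'[xi] = 0)%E) (xi1 : ('V_P'[xi] = 1)%E).
Context (indep : forall n, pos_nat n -> mutually_independent P pos_nat (xin n)).
Context (law : forall n i, pos_nat n -> pos_nat i ->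
  forall A : set R, measurable A -> distribution P (xin n i) A = distribution P' xi A).

Local Notation L2 := (Lfun P 2%:E).
Local Notation nrm := (L2norm P).
Local Notation dot := (dotp P).

Lemma xi_mean : \int[P']_w xi w = 0.
Proof. by rewrite /Rintegral -expectation_def xi0. Qed.

Lemma xi_second_moment : dotp P' xi xi = 1.
Proof.
have := varianceE xiL; rewrite xi1 xi0 expe2 mule0 sube0 unlock => H.
by rewrite /dotp /Rintegral (_ : integral _ _ _ = 1%E).
Qed.

Lemma xi_norm : L2norm P' xi = 1.
Proof. by rewrite /L2norm xi_second_moment sqrtr1. Qed.

Lemma pairwise_independent n i j : (0 < n)%N -> i != j ->
  forall A B : set R, measurable A -> measurable B ->
  P (xin n i.+1 @^-1` A `&` xin n j.+1 @^-1` B) =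
  (P (xin n i.+1 @^-1` A) * P (xin n j.+1 @^-1` B))%E.
Proof.
move=> n0 ij A B mA mB.
pose F k : set R := if k == i.+1 then A else B.
have Fj : F j.+1 = B by rewrite /F eqSS eq_sym (negbTE ij).
have Fi : F i.+1 = A by rewrite /F eqxx.
have := @indep n n0 [:: i.+1; j.+1] F.
rewrite !big_cons big_nil mule1 Fi Fj => <-.
- congr (P _); apply/seteqP; split => [w [wA wB] k|w h] /=.
    by rewrite !inE => /orP[]/eqP->; rewrite ?Fi ?Fj.
  by split; [rewrite -Fi|rewrite -Fj]; apply: h; rewrite /= !inE eqxx ?orbT.
- by rewrite /= inE eqSS ij.
- by move=> k /=; rewrite !inE => /orP[]/eqP->.
- by move=> k; rewrite /F; case: ifP.
Qed.

(** The common size of the first-order errors made on xi / r by cosine and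
    sine; it tends to 0 for r = sqrt n by dominated convergence. *)
Definition eta (gamma r : R) : R :=
  L2norm P' (fun w => xi w * trunc2 (gamma * (xi w / r))).

Lemma eta_ge0 gamma r : 0 <= eta gamma r. Proof. exact: L2norm_ge0. Qed.

Let measurable_xit gamma r :
  measurable_fun setT (fun w => xi w * trunc2 (gamma * (xi w / r))).
Proof.
apply: measurable_funM => //.
apply: measurableT_comp; first exact: measurable_trunc2.
by apply: measurable_funM => //; apply: measurable_funM.
Qed.

Let xit_bound gamma r w :
  `|xi w * trunc2 (gamma * (xi w / r))| <= 2 * `|xi w|.
Proof.
rewrite normrM mulrC ler_wpM2r// ger0_norm ?trunc2_ge0//; exact: trunc2_le2.
Qed.

Lemma Lfun2_xit gamma r :
  (fun w => xi w * trunc2 (gamma * (xi w / r))) \in Lfun P' 2%:E.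
Proof.
apply: (Lfun2_le (measurable_xit _ _) (Lfun2Z 2 xiL)) => w.
by rewrite [leRHS]normrM (ger0_norm (_ : 0 <= 2)).
Qed.

Lemma invsqrt_cvg : (Num.sqrt k.+1%:R)^-1 @[k --> \oo] --> (0 : R).
Proof.
have -> : (fun k => (Num.sqrt k.+1%:R)^-1) = (fun k => Num.sqrt (k.+1%:R^-1 : R)).
  by apply/funext => k; rewrite sqrtrV.
rewrite -[X in _ --> X](@sqrtr0 R); apply: continuous_cvg; first exact: sqrt_continuous.
exact: cvg_harmonic.
Qed.

Lemma eta_cvg gamma : eta gamma (Num.sqrt k.+1%:R) @[k --> \oo] --> 0.
Proof.
have xc w : xi w * trunc2 (gamma * (xi w / Num.sqrt k.+1%:R)) @[k --> \oo] --> 0.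
  apply: (@norm_le_cvg0 _ _ (fun k => `|xi w| * `|gamma * xi w| * (Num.sqrt k.+1%:R)^-1)).
    move=> k; rewrite normrM -mulrA ler_wpM2l// ger0_norm ?trunc2_ge0//.
    rewrite /trunc2 mulrA normrM ge_min; apply/orP; right.
    by rewrite (ger0_norm (_ : 0 <= (Num.sqrt _)^-1))// invr_ge0 sqrtr_ge0.
  rewrite -[X in _ --> X](mulr0 (`|xi w| * `|gamma * xi w|)).
  by apply: cvgM; [exact: cvg_cst|exact: invsqrt_cvg].
have [_] := L2_dominated_cvg (fun k => measurable_xit gamma (Num.sqrt k.+1%:R))
  (Lfun2Z 2 (Lfun2_abs xiL)) (fun k => xit_bound gamma (Num.sqrt k.+1%:R)) xc.
rewrite (_ : (fun k => L2norm _ _) = fun k => eta gamma (Num.sqrt k.+1%:R))//.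
by apply/funext => k; congr L2norm; apply/funext => w; rewrite subr0.
Qed.

Section row.
Context (r : R) (r0 : 0 < r) (g : nat -> R) (gamma : R).
Context (gg : forall i, `|g i| <= gamma).

(** The error made in (y / r) cos (g_i y / r) by replacing the cosine by 1. *)
Definition cos_term i (y : R) := y / r * (cos (g i * (y / r)) - 1).
(** Subtracting g_i / r^2 centres (y / r) sin (g_i y / r) up to first order,
    the second moment of xi being 1. *)
Definition sin_term i (y : R) := y / r * sin (g i * (y / r)) - g i / r ^+ 2.

Let gamma0 : 0 <= gamma. Proof. exact: le_trans (gg 0%N). Qed.

Let mono i y : trunc2 (g i * (y / r)) <= trunc2 (gamma * (y / r)).
Proof.
apply: trunc2_mono; rewrite !normrM ler_wpM2r//.
by rewrite (le_trans (gg i))// ler_norm.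
Qed.

Let measurable_scaled i : measurable_fun setT (fun y : R => g i * (y / r)).
Proof. by apply: measurable_funM => //; apply: measurable_funM. Qed.

Lemma measurable_cos_term i : measurable_fun setT (cos_term i).
Proof.
apply: measurable_funM; first by apply: measurable_funM.
apply: measurable_funB => //; apply: measurableT_comp => //.
exact: continuous_measurable_fun (@continuous_cos R).
Qed.

Lemma measurable_sin_term i : measurable_fun setT (sin_term i).
Proof.
apply: measurable_funB => //.
apply: measurable_funM; first by apply: measurable_funM.
apply: measurableT_comp => //; exact: continuous_measurable_fun (@continuous_sin R).
Qed.

Let cos_term_bound i y :
  `|cos_term i y| <= `|r^-1 * (y * trunc2 (gamma * (y / r)))|.
Proof.
rewrite /cos_term normrM [in leRHS]mulrCA [in leRHS]mulrA [leRHS]normrM.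
rewrite ler_wpM2l//.
rewrite [leRHS]ger0_norm ?trunc2_ge0//.
by apply: le_trans (cosB1_trunc2 _) _.
Qed.

Let first_order i y (z : R) : `|z| <= `|g i * (y / r)| * trunc2 (g i * (y / r)) ->
  `|y / r * z| <= gamma / r ^+ 2 * (`|y| * `|y * trunc2 (gamma * (y / r))|).
Proof.
move=> zb; rewrite normrM.
apply: (@le_trans _ _ (`|y / r| * (gamma * `|y / r| * trunc2 (gamma * (y / r))))).
  rewrite ler_wpM2l//; apply: le_trans zb _; rewrite ler_pM ?trunc2_ge0//.
  by rewrite normrM ler_wpM2r.
rewrite le_eqVlt; apply/orP; left; apply/eqP.
rewrite [`|_ * trunc2 _|]normrM (ger0_norm (trunc2_ge0 _)) !normrM.
rewrite (ger0_norm (_ : 0 <= r^-1)) ?invr_ge0 ?(ltW r0)//.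
by field; rewrite gt_eqF.
Qed.

Let first_order_integral (f : R -> R) : measurable_fun setT f ->
  (forall y, `|f y| <= gamma / r ^+ 2 * (`|y| * `|y * trunc2 (gamma * (y / r))|)) ->
  `|\int[P']_w f (xi w)| <= gamma / r ^+ 2 * eta gamma r.
Proof.
move=> mf fb.
have axL := Lfun2_abs xiL; have atL := Lfun2_abs (Lfun2_xit gamma r).
have i2 := Lfun2_integrableM axL atL.
have i1 : P'.-integrable setT (EFin \o (fun w => f (xi w))).
  apply: le_integrable (integrableZ_EFin (gamma / r ^+ 2) i2) => //.
    by apply/measurable_EFinP; exact: measurableT_comp.
  move=> w _; rewrite /= lee_fin; apply: le_trans (fb _) (ler_norm _).
apply: le_trans (le_normr_Rintegral measurableT i1) _.
apply: (@le_trans _ _ (gamma / r ^+ 2 * \int[P']_w (`|xi w| *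
    `|xi w * trunc2 (gamma * (xi w / r))|))).
  rewrite -RintegralZl//; apply: le_Rintegral => //.
  - exact: integrable_norm i1.
  - exact: integrableZ_EFin.
rewrite ler_wpM2l ?divr_ge0 ?exprn_ge0 ?(ltW r0)//.
apply: le_trans (ler_norm _) _; apply: le_trans (L2_CauchySchwarz axL atL) _.
by rewrite !L2norm_abs xi_norm mul1r.
Qed.

(** With eta = o(1), each term has norm o(1/r) and mean o(1/r^2). A row has of
    the order of r^2 terms, so row_sum_bound makes their sum o(1) in L2. *)
Lemma cos_term_xi i : [/\ (fun w => cos_term i (xi w)) \in Lfun P' 2%:E,
  L2norm P' (fun w => cos_term i (xi w)) <= eta gamma r / r &
  `|\int[P']_w cos_term i (xi w)| <= gamma / r ^+ 2 * eta gamma r].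
Proof.
have m1 : measurable_fun setT (fun w => cos_term i (xi w)).
  by apply: measurableT_comp => //; exact: measurable_cos_term.
have zL := Lfun2Z r^-1 (Lfun2_xit gamma r).
have cL : (fun w => cos_term i (xi w)) \in Lfun P' 2%:E.
  by apply: (Lfun2_le m1 zL) => w; exact: cos_term_bound.
split => //.
- apply: le_trans (L2norm_le m1 zL (fun w => cos_term_bound _ _)) _.
  rewrite L2normZ ?Lfun2_xit// (ger0_norm (_ : 0 <= r^-1)) ?invr_ge0 ?(ltW r0)//.
  by rewrite mulrC.
- apply: first_order_integral => //; first exact: measurable_cos_term.
  by move=> y; apply: first_order; exact: cosB1_sqr_trunc2.
Qed.

Lemma sin_term_xi i : [/\ (fun w => sin_term i (xi w)) \in Lfun P' 2%:E,
  L2norm P' (fun w => sin_term i (xi w)) <= eta gamma r / r + gamma / r ^+ 2 &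
  `|\int[P']_w sin_term i (xi w)| <= gamma / r ^+ 2 * eta gamma r].
Proof.
pose s1 (y : R) := y / r * sin (g i * (y / r)).
have ms1 : measurable_fun setT s1.
  apply: measurable_funM; first by apply: measurable_funM.
  apply: measurableT_comp => //; exact: continuous_measurable_fun (@continuous_sin R).
have m1 : measurable_fun setT (fun w => s1 (xi w)) by exact: measurableT_comp.
have zL := Lfun2Z r^-1 (Lfun2_xit gamma r).
have s1b y : `|s1 y| <= `|r^-1 * (y * trunc2 (gamma * (y / r)))|.
  rewrite /s1 normrM [in leRHS]mulrCA [in leRHS]mulrA [leRHS]normrM.
  rewrite ler_wpM2l//.
  rewrite [leRHS]ger0_norm ?trunc2_ge0//.
  by apply: le_trans (sin_trunc2 _) _.
have s1L : (fun w => s1 (xi w)) \in Lfun P' 2%:E.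
  by apply: (Lfun2_le m1 zL) => w; exact: s1b.
have cstL c : (fun=> c : R) \in Lfun P' 2%:E by exact: Lfun_cst.
have sL : (fun w => sin_term i (xi w)) \in Lfun P' 2%:E by exact: Lfun2B.
split => //.
- apply: le_trans (L2normB s1L (cstL _)) _; rewrite lerD//.
    apply: le_trans (L2norm_le m1 zL (fun w => s1b _)) _.
    rewrite L2normZ ?Lfun2_xit// (ger0_norm (_ : 0 <= r^-1)) ?invr_ge0 ?(ltW r0)//.
    by rewrite mulrC.
  rewrite /L2norm /dotp Rintegral_cst//= probability_setT mulr1 -expr2 sqrtr_sqr.
  by rewrite normrM normfV (ger0_norm (sqr_ge0 r)) ler_wpM2r ?invr_ge0 ?sqr_ge0.
- pose s2 (y : R) := y / r * (sin (g i * (y / r)) - g i * (y / r)).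
  have ms2 : measurable_fun setT s2.
    apply: measurable_funM; first by apply: measurable_funM.
    apply: measurable_funB => //.
    apply: measurableT_comp => //; exact: continuous_measurable_fun (@continuous_sin R).
  have s2E y : s2 y = s1 y - g i / r ^+ 2 * (y * y).
    by rewrite /s2 /s1 mulrBr; congr (_ - _); field; rewrite gt_eqF.
  have -> : \int[P']_w sin_term i (xi w) = \int[P']_w s2 (xi w).
    have is1 : P'.-integrable setT (EFin \o (fun w => s1 (xi w))).
      by apply/Lfun1_integrable; apply: Lfun_subset12 s1L; exact: fin_num_measure.
    have ixx := Lfun2_integrableM xiL xiL.
    under [RHS]eq_Rintegral do rewrite s2E.
    rewrite RintegralB//; last exact: finite_measure_integrable_cst.
    rewrite RintegralB//; last exact: integrableZ_EFin.
    rewrite [in RHS]RintegralZl// -/(dotp P' xi xi) xi_second_moment mulr1.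
    by rewrite Rintegral_cst//= probability_setT mulr1.
  apply: first_order_integral => // y; apply: first_order.
  exact: sinBid_trunc2.
Qed.

End row.
(** Pairwise independence turns the off-diagonal terms into products of means. *)
Lemma row_sum_bound n N (f : nat -> R -> R) (b c : R) : (0 < n)%N ->
  (forall i, measurable_fun setT (f i)) ->
  (forall i, (fun w => f i (xi w)) \in Lfun P' 2%:E) ->
  (forall i, L2norm P' (fun w => f i (xi w)) <= b) ->
  (forall i, `|\int[P']_w f i (xi w)| <= c) ->
  (fun w => \sum_(i < N) f i (xin n i.+1 w)) \in L2 /\
  nrm (fun w => \sum_(i < N) f i (xin n i.+1 w)) <=
    Num.sqrt (N%:R * b ^+ 2 + N%:R ^+ 2 * c ^+ 2).
Proof.
move=> n0 mf fL fb fc.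
have tr i := same_law_Lfun2 (fun A mA => law n0 (ltn0Sn i) mA) (mf i) (fL i).
have FL i : (fun w => f i (xin n i.+1 w)) \in L2 by have [] := tr i.
split; first exact: Lfun2_sum.
have b0 : 0 <= b by apply: le_trans (L2norm_ge0 _ _) (fb 0%N).
have c0 : 0 <= c by apply: le_trans (normr_ge0 _) (fc 0%N).
rewrite ler_sqrt; last by rewrite addr_ge0// mulr_ge0// sqr_ge0.
apply: (@dotp_sum_le _ _ _ P (fun i w => f i (xin n i.+1 w))) => //.
- by rewrite sqr_ge0.
- move=> i; rewrite -L2norm_sqr; have [_ -> _] := tr i.
  by rewrite lerXn2r ?nnegrE ?L2norm_ge0.
- move=> i j ij; rewrite (independent_integralM (pairwise_independent n0 ij))//.
  have [_ _ ->] := tr i; have [_ _ ->] := tr j.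
  apply: le_trans (ler_norm _) _; rewrite normrM expr2.
  by rewrite ler_pM.
- by rewrite sqr_ge0.
Qed.

End rows.

Section time_grid.
Context (R : realType).

(** The times in the codes of step functions are arbitrary reals; the
    processes are read at their positive parts. *)
Definition tpos (t : R) : R := Num.max 0 t.

Lemma tpos_ge0 t : 0 <= tpos t. Proof. by rewrite le_max lexx. Qed.

Lemma tpos_id t : 0 <= t -> tpos t = t. Proof. by move=> t0; rewrite /tpos max_r. Qed.

Definition grid (n : nat) (t : R) : nat := Num.truncn (n%:R * tpos t).

Lemma truncn_div_cvg (s : R) : 0 <= s ->
  (Num.truncn (k.+1%:R * s))%:R / k.+1%:R @[k --> \oo] --> s.
Proof.
move=> s0; apply: (norm_sub_le_cvg _ (@cvg_harmonic R)) => k.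
have k0 : 0 < k.+1%:R :> R by [].
have /andP[] := truncn_itv (mulr_ge0 (ltW k0) s0).
move: (Num.truncn _) => N; rewrite -natr1 => H1 H2.
rewrite ler_norml /harmonic /= lerBrDr lerBlDr ler_pdivlMr// ler_pdivrMr//.
rewrite mulrDl !mulrDl ?mulNr mulVf ?gt_eqF// ![s * _]mulrC.
by apply/andP; split; lra.
Qed.

Lemma truncn_min (a b : R) : 0 <= a -> 0 <= b ->
  minn (Num.truncn a) (Num.truncn b) = Num.truncn (Num.min a b).
Proof.
move=> a0 b0; case: (leP a b) => ab.
  by rewrite (minn_idPl _)//; exact: le_truncn.
by rewrite (minn_idPr _)//; apply: le_truncn; exact: ltW.
Qed.

Lemma grid_min n s t :
  minn (grid n s) (grid n t) = Num.truncn (n%:R * Num.min (tpos s) (tpos t)).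
Proof. by rewrite /grid truncn_min ?mulr_ge0 ?tpos_ge0// minr_pMr. Qed.

Lemma sum_lt_minn N M : \sum_(i < N) (i < M)%:R = (minn N M)%:R :> R.
Proof.
elim: N => [|N IH]; first by rewrite big_ord0 min0n.
rewrite big_ord_recr/= IH; have [h|h] := ltnP N M.
  by rewrite (minn_idPl _) ?(minn_idPl _)// ?natr1// ltnW.
by rewrite addr0 !(minn_idPr _)// leqW.
Qed.

(** A list of pairs (a, t) codes the combination sum a B_t. In its discrete
    counterpart sum a B^n_t the (i+1)-st step of the walk has this coefficient. *)
Definition coef (n : nat) (g : seq (R * R)) (i : nat) : R :=
  \sum_(p <- g) p.1 * (i < grid n p.2)%:R.
Definition mass (g : seq (R * R)) : R := \sum_(p <- g) `|p.1|.
(** The covariance of sum a B_s with B_t. *)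
Definition overlap (g : seq (R * R)) (t : R) : R :=
  \sum_(p <- g) p.1 * Num.min (tpos t) (tpos p.2).

Lemma coef_le n g i : `|coef n g i| <= mass g.
Proof.
apply: le_trans (ler_norm_sum _ _ _) _; apply: ler_sum => p _.
rewrite normrM ler_piMr//; by case: (_ < _)%N; rewrite ?normr1 ?normr0.
Qed.

Lemma mass_ge0 g : 0 <= mass g. Proof. by apply: sumr_ge0. Qed.

Lemma coef_mean_cvg g t :
  (\sum_(i < grid k.+1 t) coef k.+1 g i) / k.+1%:R @[k --> \oo] --> overlap g t.
Proof.
have E k : (\sum_(i < grid k.+1 t) coef k.+1 g i) / k.+1%:R =
    \sum_(p <- g) p.1 * ((minn (grid k.+1 t) (grid k.+1 p.2))%:R / k.+1%:R).
  rewrite /coef exchange_big/= mulr_suml; apply: eq_bigr => p _.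
  by rewrite -mulr_sumr sum_lt_minn mulrA.
rewrite (_ : (fun k => _) = (fun k : nat =>
    \sum_(p <- g) p.1 * ((minn (grid k.+1 t) (grid k.+1 p.2))%:R / k.+1%:R))).
  rewrite /overlap; elim: g {E} => [|p g IH].
    rewrite big_nil; under eq_fun do rewrite big_nil; exact: cvg_cst.
  rewrite big_cons; under eq_fun do rewrite big_cons.
  apply: cvgD => //; apply: cvgM; first exact: cvg_cst.
  under eq_fun do rewrite grid_min.
  by apply: truncn_div_cvg; rewrite le_min !tpos_ge0.
by apply/funext => k; exact: E.
Qed.

End time_grid.

(** * Scaling limit of the random walk *)

Section brownian_marginals.
Context (R : realType) d (T : measurableType d) (P : probability T R).
Context (B : R -> {RV P >-> R}) (bm : brownian_motion B).

Local Notation L2 := (Lfun P 2%:E).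

Definition bpos (t : R) (w : T) : R := B (tpos t) w.

Lemma bposE t w : bpos t w = B (tpos t) w. Proof. by []. Qed.

Lemma measurable_bpos t : measurable_fun setT (bpos t).
Proof. by []. Qed.

Let B00 : {ae P, forall w, B 0 w = 0}. Proof. by case: bm. Qed.

Let increment (t : R) (t0 : 0 < t) : {ae P, forall w, bpos t w = (B t - B 0) w}.
Proof.
apply: filterS B00 => w B0; rewrite /bpos tpos_id ?ltW//.
by rewrite (_ : (B t - B 0) w = B t w - B 0 w)// B0 subr0.
Qed.

Lemma bpos_exp t (c : R) : (fun w => expR (c * `|bpos t w|)) \in L2.
Proof.
have me : measurable_fun setT (fun w => expR (c * `|bpos t w|)).
  apply: measurableT_comp => //; apply: measurable_funM => //.
  by apply: measurableT_comp => //; exact: measurable_bpos.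
have [t0|t0] := leP t 0.
  apply: (Lfun2_ae_eq (g := fun=> 1)) => //; first exact: Lfun_cst.
  apply: filterS B00 => w /= B0.
  by rewrite /bpos /tpos max_l// B0 normr0 mulr0 expR0.
have s0 : Num.sqrt (t - 0) != 0 by rewrite subr0 gt_eqF// sqrtr_gt0.
have := gaussian_exp_Lfun2 s0 (bm_gaussian bm (lexx 0) t0) c.
move/Lfun2_ae_eq; apply => //.
by apply: filterS (increment t0) => w /= ->.
Qed.

Lemma bpos_Lfun2 t : bpos t \in L2 /\ dotp P (bpos t) (bpos t) = tpos t.
Proof.
have mb := measurable_bpos t.
have [t0|t0] := leP t 0.
  have ae0 : {ae P, forall w, bpos t w = 0}.
    by apply: filterS B00 => w /= B0; rewrite /bpos /tpos max_l.
  have bL := Lfun2_ae_eq mb (Lfun2_0 P) ae0.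
  split => //; rewrite (dotp_ae_eq bL (Lfun2_0 P) bL ae0) /tpos max_l// /dotp.
  by under eq_Rintegral do rewrite mul0r; rewrite Rintegral_cst// mul0r.
have s0 : Num.sqrt (t - 0) != 0 by rewrite subr0 gt_eqF// sqrtr_gt0.
have [iL iE] := gaussian_second_moment s0 (bm_gaussian bm (lexx 0) t0).
have bL := Lfun2_ae_eq mb iL (increment t0).
split => //; rewrite (dotp_ae_eq bL iL bL (increment t0)) dotpC.
rewrite (dotp_ae_eq bL iL iL (increment t0)) iE sqr_sqrtr ?subr0 ?ltW//.
by rewrite tpos_id// ltW.
Qed.

End brownian_marginals.

Section scaling_limit.
Context (R : realType) d (T : measurableType d) (P : probability T R).
Context (B : R -> {RV P >-> R}) (bm : brownian_motion B).
Context d' (T' : measurableType d') (P' : probability T' R).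
Context (xi : {RV P' >-> R}) (xin : nat -> nat -> {RV P >-> R}).
Context (xiL : (xi : T' -> R) \in Lfun P' 2%:E).
Context (xi0 : ('E_P'[xi] = 0)%E) (xi1 : ('V_P'[xi] = 1)%E).
Context (indep : forall n, pos_nat n -> mutually_independent P pos_nat (xin n)).
Context (law : forall n i, pos_nat n -> pos_nat i ->
  forall A : set R, measurable A -> distribution P (xin n i) A = distribution P' xi A).
Context (walk_cvg : forall t : R, 0 <= t ->
  cvg_in_probability P (fun n => random_walk xin n t) (B t)).

Local Notation L2 := (Lfun P 2%:E).
Local Notation nrm := (L2norm P).
Local Notation dot := (dotp P).
Local Notation bpos := (bpos B).

Definition step_of (n i : nat) (w : T) : R := xin n i.+1 w / Num.sqrt n%:R.
Definition walk (n : nat) (t : R) (w : T) : R := \sum_(i < grid n t) step_of n i w.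

Lemma walkE n t : walk n t = random_walk xin n (tpos t).
Proof.
apply/funext => w; rewrite /walk /random_walk big_add1/= big_mkord mulr_sumr.
by apply: eq_bigr => i _; rewrite /step_of mulrC.
Qed.

Let rootP k : 0 < Num.sqrt k.+1%:R :> R. Proof. by rewrite sqrtr_gt0. Qed.
Let root2 k : Num.sqrt k.+1%:R ^+ 2 = k.+1%:R :> R. Proof. by rewrite sqr_sqrtr. Qed.

Lemma xin_Lfun2 n i : (0 < n)%N -> [/\ (xin n i.+1 : T -> R) \in L2,
  nrm (xin n i.+1) = 1 & \int[P]_w xin n i.+1 w = 0].
Proof.
move=> n0; have mid : measurable_fun setT (fun x : R => x) by [].
have [] := same_law_Lfun2 (fun A mA => law n0 (ltn0Sn i) mA) mid xiL.
by rewrite (xi_norm xiL xi0 xi1) (xi_mean xi0).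
Qed.

Lemma step_of_Lfun2 k i : step_of k.+1 i \in L2.
Proof.
have [yL _ _] := xin_Lfun2 i (ltn0Sn k).
by have := Lfun2Z (Num.sqrt k.+1%:R)^-1 yL; under eq_fun do rewrite mulrC.
Qed.

Lemma step_of_norm k i : nrm (step_of k.+1 i) = (Num.sqrt k.+1%:R)^-1.
Proof.
have [yL yn _] := xin_Lfun2 i (ltn0Sn k).
rewrite (_ : step_of k.+1 i = fun w => (Num.sqrt k.+1%:R)^-1 * xin k.+1 i.+1 w).
  by rewrite L2normZ// yn mulr1 ger0_norm// invr_ge0 ltW.
by apply/funext => w; rewrite /step_of mulrC.
Qed.

Lemma walk_Lfun2 k t : walk k.+1 t \in L2.
Proof. by apply: Lfun2_sum => i; exact: step_of_Lfun2. Qed.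

Lemma step_of_dot k i j : dot (step_of k.+1 i) (step_of k.+1 j) = (i == j)%:R / k.+1%:R.
Proof.
have [<-|ij] := eqVneq i j.
  by rewrite -L2norm_sqr step_of_norm exprVn root2 mul1r.
have n0 := ltn0Sn k.
have [iL _ ei] := xin_Lfun2 i n0; have [jL _ ej] := xin_Lfun2 j n0.
have ms : measurable_fun setT (fun x : R => x / Num.sqrt k.+1%:R).
  by apply: measurable_funM.
have H := independent_integralM (pairwise_independent indep n0 ij) ms ms.
have := H (step_of_Lfun2 k i) (step_of_Lfun2 k j); rewrite mul0r => ->.
rewrite RintegralZr ?ei ?mul0r//.
by apply/Lfun1_integrable; apply: Lfun_subset12 iL; exact: fin_num_measure.
Qed.

Lemma walk_dot k t : dot (walk k.+1 t) (walk k.+1 t) = (grid k.+1 t)%:R / k.+1%:R.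
Proof.
rewrite dotp_sumr ?walk_Lfun2//; last by move=> i; exact: step_of_Lfun2.
rewrite (eq_bigr (fun=> k.+1%:R^-1)).
  by rewrite sumr_const card_ord mulr_natl.
move=> i _; rewrite dotpC dotp_sumr ?step_of_Lfun2//; last by move=> j; exact: step_of_Lfun2.
rewrite (bigD1 i)//= step_of_dot eqxx mul1r big1 ?addr0// => j ji.
by rewrite step_of_dot (_ : (i == j :> nat) = false) ?mul0r//; apply/negbTE; rewrite eq_sym.
Qed.

(** Convergence in probability is assumed; the squared norms floor(nt)/n
    converge to t as well. *)
Lemma walk_cvg_L2 t : nrm (fun w => walk k.+1 t w - bpos t w) @[k --> \oo] --> 0.
Proof.
have [bL bE] := bpos_Lfun2 bm t.
apply: (L2_cvg_in_probability (X_ := fun k => walk k.+1 t)) => //.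
- by move=> k; exact: walk_Lfun2.
- move=> e e0; have := walk_cvg (tpos_ge0 t) e0.
  rewrite -cvg_shiftS; apply: cvg_trans; apply: near_eq_cvg; apply: nearW => k /=.
  by rewrite walkE.
- rewrite bE (_ : (fun k => _) = (fun k : nat => (grid k.+1 t)%:R / k.+1%:R)).
    by apply: truncn_div_cvg; exact: tpos_ge0.
  by apply/funext => k; exact: walk_dot.
Qed.

Definition lin (g : seq (R * R)) (w : T) : R := \sum_(p <- g) p.1 * bpos p.2 w.
Definition linw (n : nat) (g : seq (R * R)) (w : T) : R :=
  \sum_(p <- g) p.1 * walk n p.2 w.

Lemma linE g w : lin g w = \sum_(p <- g) p.1 * bpos p.2 w. Proof. by []. Qed.

Lemma lin_Lfun2 g : lin g \in L2.
Proof. by apply: Lfun2_sum => p; apply: Lfun2Z; case: (bpos_Lfun2 bm p.2). Qed.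

Lemma linw_Lfun2 k g : linw k.+1 g \in L2.
Proof. by apply: Lfun2_sum => p; apply: Lfun2Z; exact: walk_Lfun2. Qed.

Lemma linw_cvg g : nrm (fun w => linw k.+1 g w - lin g w) @[k --> \oo] --> 0.
Proof.
have dL k t : (fun w => walk k.+1 t w - bpos t w) \in L2.
  by apply: Lfun2B; [exact: walk_Lfun2|case: (bpos_Lfun2 bm t)].
apply: (@norm_le_cvg0 _ _ (fun k => \sum_(p <- g) `|p.1| *
    nrm (fun w => walk k.+1 p.2 w - bpos p.2 w))).
  move=> k; rewrite ger0_norm ?L2norm_ge0//.
  have -> : (fun w => linw k.+1 g w - lin g w) =
      (fun w => \sum_(p <- g) p.1 * (walk k.+1 p.2 w - bpos p.2 w)).
    apply/funext => w; rewrite /linw /lin -sumrB; apply: eq_bigr => p _.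
    by rewrite mulrBr.
  apply: le_trans (L2norm_sum _ _) _; first by move=> p; apply: Lfun2Z.
  by apply: ler_sum => p _; rewrite L2normZ.
elim: g => [|p g IH].
  by rewrite (_ : (fun k => _) = (fun=> 0)); [exact: cvg_cst|apply/funext => k; rewrite big_nil].
rewrite (_ : (fun k => _) = (fun k => `|p.1| * nrm (fun w => walk k.+1 p.2 w - bpos p.2 w) +
    \sum_(q <- g) `|q.1| * nrm (fun w => walk k.+1 q.2 w - bpos q.2 w))); last first.
  by apply/funext => k; rewrite big_cons.
rewrite -[X in _ --> X]addr0; apply: cvgD => //.
rewrite -[X in _ --> X](mulr0 `|p.1|); apply: cvgM; first exact: cvg_cst.
exact: walk_cvg_L2.
Qed.

Definition cos_sum (n : nat) (g : seq (R * R)) (t : R) (w : T) : R :=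
  \sum_(i < grid n t) step_of n i w * cos (coef n g i * step_of n i w).
Definition sin_sum (n : nat) (g : seq (R * R)) (t : R) (w : T) : R :=
  \sum_(i < grid n t) step_of n i w * sin (coef n g i * step_of n i w).

Let grid_ratio k t : (grid k.+1 t)%:R / k.+1%:R <= tpos t :> R.
Proof. by rewrite ler_pdivrMr// mulrC /grid truncn_le mulr_ge0// tpos_ge0. Qed.

(** The difference between cos_sum and the walk is a row sum of cos_terms. *)
Lemma cos_sum_cvg g t :
  (forall k, cos_sum k.+1 g t \in L2) /\
  nrm (fun w => cos_sum k.+1 g t w - bpos t w) @[k --> \oo] --> 0.
Proof.
pose e k := eta xi (mass g) (Num.sqrt k.+1%:R).
have e0 k : 0 <= e k by exact: eta_ge0.
have ec : e k @[k --> \oo] --> 0 by exact: eta_cvg.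
pose D k w := \sum_(i < grid k.+1 t)
  cos_term (Num.sqrt k.+1%:R) (coef k.+1 g) i (xin k.+1 i.+1 w).
have b k : D k \in L2 /\ nrm (D k) <=
    Num.sqrt ((grid k.+1 t)%:R * (e k / Num.sqrt k.+1%:R) ^+ 2 +
      (grid k.+1 t)%:R ^+ 2 * (mass g / Num.sqrt k.+1%:R ^+ 2 * e k) ^+ 2).
  have h i := cos_term_xi xiL xi0 xi1 (rootP k) (coef_le k.+1 g) i.
  apply: (row_sum_bound indep law (grid k.+1 t) (ltn0Sn k)
    (f := cos_term (Num.sqrt k.+1%:R) (coef k.+1 g))) => i; [exact: measurable_cos_term|by case: (h i)..].
have DL k : D k \in L2 by case: (b k).
have cE k : cos_sum k.+1 g t = fun w => D k w + walk k.+1 t w.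
  apply/funext => w; rewrite /D /walk -big_split/=; apply: eq_bigr => i _.
  by rewrite /cos_term /step_of mulrBr mulr1 subrK.
have cL k : cos_sum k.+1 g t \in L2 by rewrite cE; exact: Lfun2D (DL k) (walk_Lfun2 k t).
split=> //.
have [bL _] := bpos_Lfun2 bm t.
have Dc : nrm (D k) @[k --> \oo] --> 0.
  (* grid k.+1 t <= (k+1) t absorbs the powers of k+1 in the row bound *)
  apply: (@norm_le_cvg0 _ _ (fun k =>
    Num.sqrt ((tpos t + (tpos t * mass g) ^+ 2) * (e k * e k)))).
    move=> k; rewrite ger0_norm ?L2norm_ge0//; apply: le_trans (b k).2 _.
    rewrite ler_sqrt; last by rewrite mulr_ge0 ?mulr_ge0// addr_ge0 ?tpos_ge0// sqr_ge0.
    rewrite mulrDl lerD// -/(e k).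
      rewrite exprMn exprVn root2 expr2 mulrCA mulrC.
      by rewrite ler_wpM2r ?mulr_ge0.
    rewrite -exprMn root2 -expr2 -exprMn lerXn2r ?nnegrE ?mulr_ge0 ?tpos_ge0 ?mass_ge0//.
    rewrite mulrA ler_wpM2r// mulrCA mulrC ler_wpM2r ?mass_ge0//.
  rewrite -[X in _ --> X](@sqrtr0 R); apply: continuous_cvg; first exact: sqrt_continuous.
  rewrite -[X in _ --> X](mulr0 (tpos t + (tpos t * mass g) ^+ 2)).
  apply: cvgM; first exact: cvg_cst.
  by rewrite -[X in _ --> X](mulr0 (0 : R)); exact: cvgM.
apply: (@norm_le_cvg0 _ _ (fun k => nrm (D k) + nrm (fun w => walk k.+1 t w - bpos t w))).
  move=> k; rewrite ger0_norm ?L2norm_ge0// cE.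
  under [X in nrm X <= _]eq_fun do rewrite -addrA.
  by apply: L2normD => //; apply: Lfun2B => //; exact: walk_Lfun2.
by rewrite -[X in _ --> X]addr0; apply: cvgD => //; exact: walk_cvg_L2.
Qed.

(** The difference between sin_sum and the mean of the coefficients is a row
    sum of sin_terms, and that mean tends to the covariance. *)
Lemma sin_sum_cvg g t :
  (forall k, sin_sum k.+1 g t \in L2) /\
  nrm (fun w => sin_sum k.+1 g t w - overlap g t) @[k --> \oo] --> 0.
Proof.
pose e k := eta xi (mass g) (Num.sqrt k.+1%:R).
pose e' k := e k + mass g / Num.sqrt k.+1%:R.
have e0 k : 0 <= e k by exact: eta_ge0.
have ec : e k @[k --> \oo] --> 0 by exact: eta_cvg.
have e'0 k : 0 <= e' k by rewrite addr_ge0// divr_ge0 ?mass_ge0// ltW.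
have e'c : e' k @[k --> \oo] --> 0.
  rewrite -[X in _ --> X]addr0; apply: cvgD => //.
  rewrite -[X in _ --> X](mulr0 (mass g)); apply: cvgM; first exact: cvg_cst.
  exact: invsqrt_cvg.
pose D k w := \sum_(i < grid k.+1 t)
  sin_term (Num.sqrt k.+1%:R) (coef k.+1 g) i (xin k.+1 i.+1 w).
have b k : D k \in L2 /\ nrm (D k) <=
    Num.sqrt ((grid k.+1 t)%:R * (e k / Num.sqrt k.+1%:R + mass g / Num.sqrt k.+1%:R ^+ 2) ^+ 2 +
      (grid k.+1 t)%:R ^+ 2 * (mass g / Num.sqrt k.+1%:R ^+ 2 * e k) ^+ 2).
  have h i := sin_term_xi xiL xi0 xi1 (rootP k) (coef_le k.+1 g) i.
  apply: (row_sum_bound indep law (grid k.+1 t) (ltn0Sn k)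
    (f := sin_term (Num.sqrt k.+1%:R) (coef k.+1 g))) => i; [exact: measurable_sin_term|by case: (h i)..].
pose m k := (\sum_(i < grid k.+1 t) coef k.+1 g i) / k.+1%:R.
have cstL c : (fun=> c : R) \in L2 by exact: Lfun_cst.
have DL k : D k \in L2 by case: (b k).
have sE k : sin_sum k.+1 g t = fun w => D k w + m k.
  apply/funext => w; rewrite /D /m mulr_suml -big_split/=; apply: eq_bigr => i _.
  by rewrite /sin_term /step_of root2 subrK.
have sL k : sin_sum k.+1 g t \in L2 by rewrite sE; exact: Lfun2D.
split=> //.
have Dc : nrm (D k) @[k --> \oo] --> 0.
  apply: (@norm_le_cvg0 _ _ (fun k => Num.sqrt (tpos t * (e' k * e' k) +
      (tpos t * mass g) ^+ 2 * (e k * e k)))).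
    move=> k; rewrite ger0_norm ?L2norm_ge0//; apply: le_trans (b k).2 _.
    rewrite ler_sqrt; last first.
      by rewrite addr_ge0 ?mulr_ge0 ?tpos_ge0 ?mass_ge0 ?sqr_ge0.
    rewrite lerD// -/(e k).
      have -> : e k / Num.sqrt k.+1%:R + mass g / Num.sqrt k.+1%:R ^+ 2 =
          e' k / Num.sqrt k.+1%:R.
        by rewrite /e' mulrDl expr2 invfM mulrA.
      rewrite exprMn exprVn root2 expr2 mulrCA mulrC.
      by rewrite ler_wpM2r ?mulr_ge0.
    rewrite -exprMn root2 -expr2 -exprMn lerXn2r ?nnegrE ?mulr_ge0 ?tpos_ge0 ?mass_ge0//.
    rewrite mulrA ler_wpM2r// mulrCA mulrC ler_wpM2r ?mass_ge0//.
  rewrite -[X in _ --> X](@sqrtr0 R); apply: continuous_cvg; first exact: sqrt_continuous.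
  rewrite -[X in _ --> X]addr0; apply: cvgD.
    rewrite -[X in _ --> X](mulr0 (tpos t)); apply: cvgM; first exact: cvg_cst.
    by rewrite -[X in _ --> X](mulr0 (0 : R)); exact: cvgM.
  rewrite -[X in _ --> X](mulr0 ((tpos t * mass g) ^+ 2)).
  apply: cvgM; first exact: cvg_cst.
  by rewrite -[X in _ --> X](mulr0 (0 : R)); exact: cvgM.
apply: (@norm_le_cvg0 _ _ (fun k => nrm (D k) + `|m k - overlap g t|)).
  move=> k; rewrite ger0_norm ?L2norm_ge0// sE.
  under [X in nrm X <= _]eq_fun do rewrite -addrA.
  apply: le_trans (L2normD (DL k) (cstL _)) _; rewrite lerD2l.
  by rewrite /L2norm /dotp Rintegral_cst//= probability_setT mulr1 -expr2 sqrtr_sqr.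
rewrite -[X in _ --> X]addr0; apply: cvgD => //; apply/norm_cvg0P.
rewrite -[X in _ --> X](subrr (overlap g t)); apply: cvgB; last exact: cvg_cst.
exact: coef_mean_cvg.
Qed.

End scaling_limit.

(** * Test functions and discrete duality *)

Section step_process_pairing.
Context d (T : measurableType d) (R : realType) (P : probability T R).
Context (D : nat -> T -> R) (n : nat) (n0 : (0 < n)%N) (D0 : D 0 = cst 0).
Context (DL : forall i, D i \in Lfun P 2%:E).
Context (C : R) (DC : (L2n_sqnorm P n D <= C%:E)%E).

Local Notation dot := (dotp P).
Local Notation nrm := (L2norm P).
Local Notation dotZ := (dotp (P_time P) (step_process D n)).

Let n0' : 0 < n%:R :> R. Proof. by rewrite ltr0n. Qed.

Let ZL : step_process D n \in Lfun (P_time P) 2%:E.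
Proof. by apply: Lfun2_step_process => //; apply: le_lt_trans DC (ltry _). Qed.

Lemma tensor_cat (V : T -> R) (a b c : R) p : a <= b -> b <= c ->
  tensor V a c p = tensor V a b p + tensor V b c p.
Proof.
move=> ab bc; rewrite /tensor -mulrDr; congr (_ * _).
rewrite !indicE !mem_setE !in_itv /=.
case: (ltP a p.2) => ha /=; case: (leP p.2 b) => hb /=; rewrite ?add0r ?addr0//.
- by rewrite (le_trans hb bc).
- by have := lt_le_trans hb (le_trans ha ab); rewrite ltxx.
Qed.

Lemma dotp_step_process_tensor (V : T -> R) N : V \in Lfun P 2%:E ->
  dotZ (tensor V 0 (N%:R / n%:R)) = \sum_(i < N) n%:R^-1 * dot (D i.+1) V.
Proof.
move=> VL.
have le i : i%:R / n%:R <= i.+1%:R / n%:R :> R.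
  by rewrite ler_pM2r ?invr_gt0// ler_nat.
have ge0 i : 0 <= i%:R / n%:R :> R by rewrite divr_ge0.
have tL i : tensor V (i%:R / n%:R) (i.+1%:R / n%:R) \in Lfun (P_time P) 2%:E.
  exact: Lfun2_tensor.
have -> : tensor V 0 (N%:R / n%:R) =
    fun p => \sum_(i < N) tensor V (i%:R / n%:R) (i.+1%:R / n%:R) p.
  apply/funext => p; elim: N => [|N IH].
    by rewrite big_ord0 mul0r /tensor indicE set_itvxx ?in_set0 ?mulr0// set_itv_ge ?in_set0 ?mulr0// bnd_simp ltxx.
  by rewrite big_ord_recr/= -IH -tensor_cat.
rewrite dotp_sumr//; apply: eq_bigr => i _.
rewrite (_ : n%:R^-1 * dot _ _ = (i.+1%:R / n%:R - i%:R / n%:R) * dot (D i.+1) V); last first.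
  by rewrite -mulrBl -natr1 addrAC subrr add0r mul1r.
rewrite -dotp_tensor//.
apply: eq_Rintegral => p _; rewrite -(_ : step_cell D n i.+1 p = tensor (D i.+1) (i%:R / n%:R) (i.+1%:R / n%:R) p)//.
rewrite step_cellE//; case: ifPn => [/eqP e|ne]; first by rewrite /step_process e.
rewrite mul0r /tensor indicE memNset ?mulr0//= => h.
by move: ne; rewrite -cell_itv// h.
Qed.

Lemma sum_step_norm_le N : \sum_(i < N) n%:R^-1 * nrm (D i.+1) ^+ 2 <= C.
Proof.
rewrite -lee_fin; apply: le_trans DC.
rewrite /L2n_sqnorm -mulr_sumr EFinM lee_wpmul2l ?lee_fin ?invr_ge0//.
rewrite -sumEFin.
under eq_bigr => i _ do rewrite L2norm_int//.
apply: le_trans (nneseries_lim_ge N.+1 _) => [|i _ _]; last first.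
  by rewrite unlock; apply: integral_ge0 => w _; rewrite lee_fin sqr_ge0.
rewrite big_add1/= big_mkord; apply: lee_sum => i _.
by rewrite unlock.
Qed.

Lemma step_process_norm_le : L2norm (P_time P) (step_process D n) <= Num.sqrt C.
Proof.
have H : L2norm (P_time P) (step_process D n) ^+ 2 <= C.
  by rewrite -lee_fin L2norm_int// integral_step_process_sqr.
rewrite -(@ler_pXn2r _ 2)// ?nnegrE ?sqrtr_ge0 ?L2norm_ge0// [leRHS]sqr_sqrtr//.
exact: le_trans (sqr_ge0 _) H.
Qed.

(** Moving from V 1_(0,t] to Y i on the i-th cell costs delta times the sum of
    the norms of the D i over n, bounded through x <= 1 + x^2. The second
    error comes from the incomplete last cell, of length at most 1/n. *)
Lemma step_process_pairing_le (V : T -> R) (Y : nat -> T -> R) (t delta : R) :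
  V \in Lfun P 2%:E -> (forall i, Y i \in Lfun P 2%:E) -> nrm V <= 1 ->
  (forall i, nrm (fun w => V w - Y i w) <= delta) ->
  `|dotZ (tensor V 0 (tpos t)) -
    \sum_(i < grid n t) n%:R^-1 * dot (D i.+1) (Y i)| <=
  delta * (tpos t + C) + Num.sqrt C * Num.sqrt n%:R^-1.
Proof.
move=> VL YL V1 VY; set N := grid n t.
have t0 := tpos_ge0 t.
have /andP[] := truncn_itv (mulr_ge0 (ltW n0') t0); rewrite -/(grid n t) -/N => N1 N2.
have N1' : N%:R / n%:R <= tpos t by rewrite ler_pdivrMr// mulrC.
have N2' : tpos t - N%:R / n%:R <= n%:R^-1.
  rewrite lerBlDr -[X in X + _]mul1r -mulrDl nat1r ler_pdivlMr// mulrC; exact: ltW.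
have Nn0 : 0 <= N%:R / n%:R :> R by rewrite divr_ge0.
have delta0 : 0 <= delta by apply: le_trans (VY 0%N); exact: L2norm_ge0.
have tL : tensor V (N%:R / n%:R) (tpos t) \in Lfun (P_time P) 2%:E by exact: Lfun2_tensor.
have -> : tensor V 0 (tpos t) = fun p => tensor V 0 (N%:R / n%:R) p +
    tensor V (N%:R / n%:R) (tpos t) p.
  by apply/funext => p; exact: tensor_cat.
rewrite dotpDr//; last exact: Lfun2_tensor.
rewrite dotp_step_process_tensor// addrAC -sumrB; apply: le_trans (ler_normD _ _) _.
apply: lerD.
  have term (i : 'I_N) : `|n%:R^-1 * dot (D i.+1) V - n%:R^-1 * dot (D i.+1) (Y i)| <=
      delta * (n%:R^-1 + n%:R^-1 * nrm (D i.+1) ^+ 2).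
    rewrite -mulrBr -dotpBr// normrM ger0_norm ?invr_ge0//.
    apply: (@le_trans _ _ (n%:R^-1 * (nrm (D i.+1) * delta))).
      rewrite ler_wpM2l ?invr_ge0//.
      apply: le_trans (L2_CauchySchwarz (DL _) (Lfun2B VL (YL i))) _.
      by rewrite ler_wpM2l ?L2norm_ge0.
    rewrite -[X in X + _]mulr1 -mulrDr [leRHS]mulrCA ler_wpM2l ?invr_ge0//.
    rewrite mulrC ler_wpM2l//.
    have := L2norm_ge0 P (D i.+1); move: (nrm _) => x x0; nra.
  apply: le_trans (ler_norm_sum _ _ _) _.
  apply: le_trans (ler_sum _ (fun i _ => term i)) _.
  rewrite -mulr_sumr ler_wpM2l// big_split/= sumr_const card_ord lerD//.
    by rewrite -[_ *+ N]mulr_natl.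
  exact: sum_step_norm_le.
apply: le_trans (L2_CauchySchwarz ZL tL) _.
rewrite ler_pM ?L2norm_ge0 ?step_process_norm_le//.
rewrite ler_sqrt ?invr_ge0// dotp_tensor// -L2norm_sqr.
apply: le_trans N2'; rewrite ler_piMr ?subr_ge0// expr_le1 ?L2norm_ge0//.
Qed.

End step_process_pairing.

Section lipschitz_products.
Context (R : realType) d (T : measurableType d) (P : probability T R).
Local Notation L2 := (Lfun P 2%:E).
Local Notation nrm := (L2norm P).

Lemma L2norm_bounded1 (D : T -> R) : measurable_fun setT D ->
  (forall w, `|D w| <= 1) -> D \in L2 /\ nrm D <= 1.
Proof.
move=> mD D1; have cL : (fun=> 1 : R) \in L2 by exact: Lfun_cst.
have DL : D \in L2 by apply: (Lfun2_le mD cL) => w; rewrite normr1.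
split => //; apply: le_trans (L2norm_le mD cL _) _ => [w|]; first by rewrite normr1.
by rewrite /L2norm /dotp Rintegral_cst//= probability_setT !mulr1 sqrtr1.
Qed.

Lemma lipschitz_mul_cvg (f : R -> R) (X_ : nat -> T -> R) (X : T -> R)
    (F_ : nat -> T -> R) (F : T -> R) :
  measurable_fun setT f -> (forall x, `|f x| <= 1) ->
  (forall x y, `|f x - f y| <= `|x - y|) ->
  (forall n, X_ n \in L2) -> X \in L2 ->
  nrm (fun w => X_ n w - X w) @[n --> \oo] --> 0 ->
  (forall n, F_ n \in L2) -> F \in L2 ->
  nrm (fun w => F_ n w - F w) @[n --> \oo] --> 0 ->
  nrm (fun w => f (X_ n w) * F_ n w - f (X w) * F w) @[n --> \oo] --> 0.
Proof.
move=> mf f1 fl XnL XL cX FnL FL cF.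
have mfX Y : Y \in L2 -> measurable_fun setT (fun w => f (Y w)).
  by move=> YL; apply: measurableT_comp => //; exact: Lfun2_measurable YL.
have dFL n := Lfun2B (FnL n) FL.
have dXL n := Lfun2B (XnL n) XL.
have mdf n : measurable_fun setT (fun w => f (X_ n w) - f (X w)).
  by apply: measurable_funB; exact: mfX.
have dfL n : (fun w => f (X_ n w) - f (X w)) \in L2.
  exact: Lfun2_le (mdf n) (dXL n) _.
have df2 n w : `|f (X_ n w) - f (X w)| <= 2.
  by apply: le_trans (ler_normB _ _) _; have := f1 (X_ n w); have := f1 (X w); lra.
have df0 : nrm (fun w => f (X_ n w) - f (X w)) @[n --> \oo] --> 0.
  apply: (norm_le_cvg0 _ cX) => n; rewrite ger0_norm ?L2norm_ge0//.
  exact: L2norm_le (mdf n) (dXL n) _.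
apply: (@norm_le_cvg0 _ _ (fun n => nrm (fun w => F_ n w - F w) +
    nrm (fun w => (f (X_ n w) - f (X w)) * F w))).
  move=> n; rewrite ger0_norm ?L2norm_ge0//.
  have -> : (fun w => f (X_ n w) * F_ n w - f (X w) * F w) =
      (fun w => f (X_ n w) * (F_ n w - F w) + (f (X_ n w) - f (X w)) * F w).
    by apply/funext => w; ring.
  apply: le_trans (L2normD _ _) _.
  - by apply: Lfun2_mul_bounded (mfX _ (XnL n)) _ => //.
  - exact: Lfun2_mul_bounded (mdf n) (df2 n).
  - rewrite lerD2r -[leRHS]mul1r; apply: L2norm_mul_bounded (mfX _ (XnL n)) _ _ => //.
rewrite -[X in _ --> X]addr0; apply: cvgD => //.
exact: bounded_mul_cvg0 df2 df0.
Qed.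

Lemma measurable_wrtP (H : set (set T)) (Y : T -> R) :
  measurable_fun [set: g_sigma_algebraType H] (Y : g_sigma_algebraType H -> R) ->
  measurable_wrt <<s H >> Y.
Proof. by move=> mY _ [A mA <-]; exact: mY. Qed.

End lipschitz_products.

Section test_functions.
Context (R : realType) d (T : measurableType d) (P : probability T R).
Context (B : R -> {RV P >-> R}) (bm : brownian_motion B).
Context d' (T' : measurableType d') (P' : probability T' R).
Context (xi : {RV P' >-> R}) (xin : nat -> nat -> {RV P >-> R}).
Context (xiL : (xi : T' -> R) \in Lfun P' 2%:E).
Context (xi0 : ('E_P'[xi] = 0)%E) (xi1 : ('V_P'[xi] = 1)%E).
Context (indep : forall n, pos_nat n -> mutually_independent P pos_nat (xin n)).
Context (law : forall n i, pos_nat n -> pos_nat i ->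
  forall A : set R, measurable A -> distribution P (xin n i) A = distribution P' xi A).
Context (walk_cvg : forall t : R, 0 <= t ->
  cvg_in_probability P (fun n => random_walk xin n t) (B t)).

Local Notation L2 := (Lfun P 2%:E).
Local Notation nrm := (L2norm P).
Local Notation dot := (dotp P).
Local Notation bpos := (bpos B).
Local Notation lin := (lin B).
Local Notation linw := (linw xin).
Local Notation step_of := (step_of xin).

(** For F = cos (. + a), L = lin g and kappa the covariance of L and B_t, this is
    F(L) B_t - kappa F'(L), the Skorokhod integral of F(L) 1_(0,t]. *)
Definition test_fun (g : seq (R * R)) (a t : R) (w : T) : R :=
  cos (lin g w + a) * bpos t w + sin (lin g w + a) * overlap g t.
Lemma test_funE g a t w : test_fun g a t w =
  cos (lin g w + a) * bpos t w + sin (lin g w + a) * overlap g t.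
Proof. by []. Qed.

Definition test_funw (n : nat) (g : seq (R * R)) (a t : R) (w : T) : R :=
  cos (linw n g w + a) * cos_sum xin n g t w +
  sin (linw n g w + a) * sin_sum xin n g t w.

Lemma sin_lipschitz (x y : R) : `|sin x - sin y| <= `|x - y|.
Proof.
have e (z : R) : sin z = cos (z - pi / 2) by rewrite -sinDpihalf subrK.
rewrite !e; apply: le_trans (cos_lipschitz _ _) _.
by rewrite opprB addrA subrK.
Qed.

Let mcos a : measurable_fun setT (fun x : R => cos (x + a)).
Proof.
apply: measurableT_comp; first exact: continuous_measurable_fun (@continuous_cos R).
exact: measurable_funD.
Qed.

Let msin a : measurable_fun setT (fun x : R => sin (x + a)).
Proof.
apply: measurableT_comp; first exact: continuous_measurable_fun (@continuous_sin R).
exact: measurable_funD.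
Qed.

Let linwL := linw_Lfun2 xiL xi0 xi1 law.

Let cosL a F G : F \in L2 -> G \in L2 -> (fun w => cos (F w + a) * G w) \in L2.
Proof.
move=> FL GL; apply: (@Lfun2_mul_bounded _ _ _ _ _ _ 1) => //.
  by apply: measurableT_comp (mcos a) _; exact: Lfun2_measurable FL.
by move=> w; exact: cos_max.
Qed.

Let sinL a F G : F \in L2 -> G \in L2 -> (fun w => sin (F w + a) * G w) \in L2.
Proof.
move=> FL GL; apply: (@Lfun2_mul_bounded _ _ _ _ _ _ 1) => //.
  by apply: measurableT_comp (msin a) _; exact: Lfun2_measurable FL.
by move=> w; exact: sin_max.
Qed.

Lemma test_fun_Lfun2 g a t : test_fun g a t \in L2.
Proof.
have [bL _] := bpos_Lfun2 bm t; have lL := lin_Lfun2 bm g.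
have kL : (fun=> overlap g t) \in L2 by exact: Lfun_cst.
by apply: Lfun2D; [exact: cosL|exact: sinL].
Qed.

Lemma test_funw_cvg g a t : [/\ forall k, test_funw k.+1 g a t \in L2,
  test_fun g a t \in L2 &
  nrm (fun w => test_funw k.+1 g a t w - test_fun g a t w) @[k --> \oo] --> 0].
Proof.
have [cL cc] := cos_sum_cvg bm xiL xi0 xi1 indep law walk_cvg g t.
have [sL sc] := sin_sum_cvg xiL xi0 xi1 indep law g t.
have [bL _] := bpos_Lfun2 bm t.
have lL := lin_Lfun2 bm g.
have lc := linw_cvg bm xiL xi0 xi1 indep law walk_cvg g.
have kL : (fun=> overlap g t) \in L2 by exact: Lfun_cst.
have lip (x y : R) : (x + a) - (y + a) = x - y by ring.
have wL k : test_funw k.+1 g a t \in L2.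
  by apply: Lfun2D; [exact: cosL|exact: sinL].
have tL := test_fun_Lfun2 g a t.
split => //.
pose F k w := cos (linw k.+1 g w + a) * cos_sum xin k.+1 g t w - cos (lin g w + a) * bpos t w.
pose G k w := sin (linw k.+1 g w + a) * sin_sum xin k.+1 g t w -
  sin (lin g w + a) * overlap g t.
have c1 : nrm (F k) @[k --> \oo] --> 0.
  apply: (lipschitz_mul_cvg (f := fun x => cos (x + a))) => // [x|x y].
    exact: cos_max.
  by rewrite -[x - y](lip x y); exact: cos_lipschitz.
have c2 : nrm (G k) @[k --> \oo] --> 0.
  apply: (lipschitz_mul_cvg (f := fun x => sin (x + a)) (F := fun=> overlap g t)) => // [x|x y].
    exact: sin_max.
  by rewrite -[x - y](lip x y); exact: sin_lipschitz.
apply: (@norm_le_cvg0 _ _ (fun k => nrm (F k) + nrm (G k))); last first.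
  by rewrite -[X in _ --> X]addr0; exact: cvgD.
move=> k; rewrite ger0_norm ?L2norm_ge0//.
have -> : (fun w => test_funw k.+1 g a t w - test_fun g a t w) = (fun w => F k w + G k w).
  by apply/funext => w; rewrite /test_funw /test_fun /F /G; ring.
by apply: L2normD; apply: Lfun2B; [exact: cosL|exact: cosL|exact: sinL|exact: sinL].
Qed.

(** Deleting the (i+1)-st step from the argument makes the cosine measurable
    for the field generated by the other steps, so that it can be pulled into
    the conditional expectation defining the discretized derivative. *)
Definition leave_one_out (n : nat) (g : seq (R * R)) (a : R) (i : nat) (w : T) : R :=
  cos (linw n g w + a - coef n g i * step_of n i w).

Lemma leave_one_out_measurable n g a i :
  measurable_wrt (Fn_minus xin n i.+1) (leave_one_out n g a i).
Proof.
have E w : linw n g w - coef n g i * step_of n i w =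
    \sum_(p <- g) p.1 * \sum_(j < grid n p.2 | j != i :> nat) step_of n j w.
  rewrite /linw /coef mulr_suml -sumrB; apply: eq_bigr => p _.
  rewrite -mulrA -mulrBr; congr (_ * _); rewrite /walk.
  have [ip|ip] := ltnP i (grid n p.2).
    by rewrite (bigD1 (Ordinal ip))//= mul1r addrAC subrr add0r.
  rewrite mul0r subr0 [RHS]big_mkcond/=; apply: eq_bigr => j _.
  by rewrite ltn_eqF// (leq_trans (ltn_ord j)).
apply: measurable_wrtP; rewrite /leave_one_out.
rewrite (_ : (fun w => _) = (fun w => cos ((\sum_(p <- g)
    p.1 * \sum_(j < grid n p.2 | j != i :> nat) step_of n j w) + a))); last first.
  by apply/funext => w; rewrite addrAC E.
apply: (measurableT_comp (mcos a)); apply: measurable_sum => p.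
apply: measurable_funM => //.
rewrite (_ : (fun w => _) = (fun w => \sum_(j < grid n p.2)
    if j != i :> nat then step_of n j w else 0)); last first.
  by apply/funext => w; rewrite big_mkcond.
apply: measurable_sum => j; case: (boolP (nat_of_ord j != i)) => ji //.
apply: measurable_funM => //= _ A mA; rewrite setTI; apply: sub_sigma_algebra.
exists j.+1; first by split => //= -[]; move/eqP: ji.
by exists A => //; rewrite setTI.
Qed.

Lemma leave_one_outE n g a i w : leave_one_out n g a i w =
  cos (linw n g w + a) * cos (coef n g i * step_of n i w) +
  sin (linw n g w + a) * sin (coef n g i * step_of n i w).
Proof. by rewrite /leave_one_out cosB. Qed.

Let sub_Fn_minus n j : Fn_minus xin n j `<=` measurable.
Proof.
apply: smallest_sub; first exact: sigma_algebra_measurable.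
by move=> _ [i _ [A mA <-]]; apply: measurable_funP.
Qed.

Lemma leave_one_out_Lfun2 n g a i :
  leave_one_out n g a i \in L2 /\ nrm (leave_one_out n g a i) <= 1.
Proof.
apply: L2norm_bounded1 => [|w]; last exact: cos_max.
by move=> _ A mA; apply: (@sub_Fn_minus n i.+1); apply: leave_one_out_measurable; exists A.
Qed.

(** After pulling each leave_one_out into the conditional expectation, the
    addition formula for the cosine separates the deleted step from the rest. *)
Lemma disc_malliavin_duality k (X : T -> R) g a t : X \in L2 ->
  \sum_(i < grid k.+1 t) k.+1%:R^-1 *
    dot (disc_malliavin P xin k.+1 X i.+1) (leave_one_out k.+1 g a i) =
  dot X (test_funw k.+1 g a t).
Proof.
move=> XL.
have stepL i := step_of_Lfun2 xiL xi0 xi1 law k i.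
have term i : k.+1%:R^-1 *
    dot (disc_malliavin P xin k.+1 X i.+1) (leave_one_out k.+1 g a i) =
    dot X (fun w => step_of k.+1 i w * leave_one_out k.+1 g a i w).
  have [yL _ _] := xin_Lfun2 xiL xi0 xi1 law i (ltn0Sn k).
  have iX := Lfun2_integrableM yL XL.
  have Y1 w : `|leave_one_out k.+1 g a i w| <= 1 by exact: cos_max.
  have mY := @leave_one_out_measurable k.+1 g a i.
  have [mC iC _] := cond_expP (@sub_Fn_minus k.+1 i.+1) iX.
  have mY' := Lfun2_measurable (leave_one_out_Lfun2 k.+1 g a i).1.
  have root2 : Num.sqrt k.+1%:R ^+ 2 = k.+1%:R :> R by rewrite sqr_sqrtr.
  rewrite /dotp /disc_malliavin /=.
  under eq_Rintegral do rewrite -mulrA.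
  rewrite RintegralZl//; last exact: integrable_mul_bounded iC mY' Y1.
  rewrite (cond_exp_mul_bounded (@sub_Fn_minus k.+1 i.+1) iX mY Y1).
  have e : k.+1%:R^-1 * Num.sqrt k.+1%:R = (Num.sqrt k.+1%:R)^-1 :> R.
    by rewrite -[in X in X * _]root2 expr2 invfM mulfVK ?gt_eqF ?sqrtr_gt0.
  rewrite mulrA e.
  rewrite -RintegralZl//; last exact: integrable_mul_bounded iX mY' Y1.
  by apply: eq_Rintegral => w _; rewrite /step_of; ring.
under eq_bigr do rewrite term.
rewrite -dotp_sumr//; last first.
  move=> i; have [lL _] := leave_one_out_Lfun2 k.+1 g a i.
  under eq_fun do rewrite mulrC.
  apply: (@Lfun2_mul_bounded _ _ _ _ _ _ 1) => // [|w]; last exact: cos_max.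
  exact: Lfun2_measurable lL.
congr dotp; apply/funext => w.
rewrite /test_funw /cos_sum /sin_sum !mulr_sumr -big_split/=; apply: eq_bigr => i _.
by rewrite leave_one_outE; ring.
Qed.

Lemma leave_one_out_dist k g a i :
  nrm (fun w => cos (lin g w + a) - leave_one_out k.+1 g a i w) <=
  mass g * (Num.sqrt k.+1%:R)^-1 + nrm (fun w => linw k.+1 g w - lin g w).
Proof.
have stepL := step_of_Lfun2 xiL xi0 xi1 law k i.
have dL := Lfun2B (linwL k g) (lin_Lfun2 bm g).
have [lL _] := leave_one_out_Lfun2 k.+1 g a i.
have H : nrm (fun w => cos (lin g w + a) - leave_one_out k.+1 g a i w) <=
    nrm (fun w => mass g * `|step_of k.+1 i w| + `|linw k.+1 g w - lin g w|).
  apply: L2norm_le => [||w].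
  - apply: measurable_funB; last exact: Lfun2_measurable lL.
    apply: measurableT_comp (mcos a) _; exact: Lfun2_measurable (lin_Lfun2 bm g).
  - by apply: Lfun2D; [apply: Lfun2Z|]; exact: Lfun2_abs.
  - rewrite [leRHS]ger0_norm ?addr_ge0 ?mulr_ge0 ?mass_ge0//.
    apply: le_trans (cos_lipschitz _ _) _.
    rewrite (_ : _ - _ = coef k.+1 g i * step_of k.+1 i w - (linw k.+1 g w - lin g w)); last by ring.
    apply: le_trans (ler_normB _ _) _; rewrite lerD2r normrM.
    by rewrite ler_wpM2r// coef_le.
apply: le_trans H _; apply: le_trans (L2normD _ _) _.
- by apply: Lfun2Z; exact: Lfun2_abs.
- exact: Lfun2_abs.
- rewrite L2norm_abs lerD2r L2normZ; last exact: Lfun2_abs.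
  rewrite L2norm_abs ger0_norm ?mass_ge0// (step_of_norm xiL xi0 xi1 law)//.
Qed.

End test_functions.

(** * Algebras of bounded functions *)

Section exp_partial_sums.
Context (R : realType).
Implicit Type x : R.

Definition exp_sum (N : nat) x : R := \sum_(j < N) x ^+ j / j`!%:R.

Lemma exp_sum_cvg x : exp_sum N x @[N --> \oo] --> expR x.
Proof.
have -> : (fun N => exp_sum N x) = series (exp_coeff x).
  by apply/funext => N; rewrite /exp_sum /series/= big_mkord.
exact: is_cvg_series_exp_coeff.
Qed.

Lemma exp_sum_le N x c : `|x| <= c -> `|exp_sum N x| <= expR c.
Proof.
move=> xc; have c0 : 0 <= c by apply: le_trans xc.
apply: (@le_trans _ _ (exp_sum N c)).
  apply: le_trans (ler_norm_sum _ _ _) _; apply: ler_sum => j _.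
  rewrite normrM normfV normr_nat normrX ler_wpM2r//.
  by rewrite lerXn2r// nnegrE.
have -> : exp_sum N c = series (exp_coeff c) N.
  by rewrite /exp_sum /series/= big_mkord.
apply: nondecreasing_cvgn_le; last exact: is_cvg_series_exp_coeff.
apply/nondecreasing_seqP => n; rewrite /series/= big_nat_recr//= lerDl.
by rewrite /exp_coeff/= divr_ge0// exprn_ge0.
Qed.

End exp_partial_sums.

Section exp_closure.
Context (R : realType) (S : Type).
Implicit Types f g s : S -> R.

Definition norm_bounded f := exists c : R, forall x, `|f x| <= c.

Lemma norm_bounded_cst (c : R) : norm_bounded (fun=> c).
Proof. by exists `|c|. Qed.

Lemma norm_boundedD f g : norm_bounded f -> norm_bounded g ->
  norm_bounded (fun x => f x + g x).
Proof.
move=> [c fc] [k gk]; exists (c + k) => x.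
by apply: le_trans (ler_normD _ _) _; rewrite lerD.
Qed.

Lemma norm_boundedM f g : norm_bounded f -> norm_bounded g ->
  norm_bounded (fun x => f x * g x).
Proof.
by move=> [c fc] [k gk]; exists (c * k) => x; rewrite normrM ler_pM.
Qed.

Context (K : (S -> R) -> (S -> R) -> Prop).
Context (Klin : forall a f f' g g', K f f' -> K g g' ->
  K (fun x => a * f x + g x) (fun x => a * f' x + g' x)).
Context (Klim : forall (f_ f'_ : nat -> S -> R) f f' (c c' : R),
  (forall n, K (f_ n) (f'_ n)) -> (forall n x, `|f_ n x| <= c) ->
  (forall n x, `|f'_ n x| <= c') -> (forall x, f_ n x @[n --> \oo] --> f x) ->
  (forall x, f'_ n x @[n --> \oo] --> f' x) -> K f f').

(** Read K f f' as: f' is the derivative of f in a fixed direction. The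
    hypothesis on s is then the product rule; it gives the powers of s, the
    partial sums of the exponential series, and, in the limit, e^s. *)
Lemma exp_closure s s' : norm_bounded s -> norm_bounded s' ->
  (forall f f', K f f' -> K (fun x => s x * f x) (fun x => s x * f' x + s' x * f x)) ->
  forall f f', norm_bounded f -> norm_bounded f' -> K f f' ->
  K (fun x => expR (s x) * f x)
    (fun x => expR (s x) * f' x + s' x * expR (s x) * f x).
Proof.
move=> [c sc] [c' sc'] Ks f f' [b fb] [b' fb'] Kf.
have Kpow j : K (fun x => s x ^+ j * f x)
    (fun x => s x ^+ j * f' x + j%:R * s' x * s x ^+ j.-1 * f x).
  elim: j => [|j IH].
    rewrite (_ : (fun x => _) = f); last by apply/funext => x; rewrite expr0 mul1r.
    rewrite (_ : (fun x => _) = f')//.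
    by apply/funext => x; rewrite expr0 mul1r !mul0r addr0.
  have := Ks _ _ IH.
  rewrite (_ : (fun x => _) = (fun x => s x ^+ j.+1 * f x)); last first.
    by apply/funext => x; rewrite exprS mulrA.
  rewrite [X in K _ X](_ : _ = (fun x => s x ^+ j.+1 * f' x +
    j.+1%:R * s' x * s x ^+ j * f x))//.
  apply/funext => x; rewrite exprS -natr1; case: j {IH} => [|j] /=.
    by rewrite expr0; ring.
  by rewrite exprS; ring.
have Ksum N : K (fun x => exp_sum N.+1 (s x) * f x)
    (fun x => exp_sum N.+1 (s x) * f' x + s' x * exp_sum N (s x) * f x).
  elim: N => [|N IH].
    have := Kpow 0%N; rewrite (_ : (fun x => _) = (fun x => exp_sum 1 (s x) * f x)); last first.
      by apply/funext => x; rewrite /exp_sum big_ord1 expr0 divr1.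
    rewrite [X in K _ X](_ : _ = (fun x => exp_sum 1 (s x) * f' x +
       s' x * exp_sum 0 (s x) * f x))//.
    by apply/funext => x; rewrite /exp_sum big_ord1 big_ord0 expr0 divr1; ring.
  have eN (m : nat) x : exp_sum m.+1 x = exp_sum m x + x ^+ m / m`!%:R :> R.
    by rewrite /exp_sum big_ord_recr.
  have := Klin (N.+1`!%:R)^-1 (Kpow N.+1) IH.
  rewrite (_ : (fun x => _) = (fun x => exp_sum N.+2 (s x) * f x)); last first.
    by apply/funext => x; rewrite (eN N.+1); ring.
  rewrite [X in K _ X](_ : _ = (fun x => exp_sum N.+2 (s x) * f' x +
       s' x * exp_sum N.+1 (s x) * f x))//.
  apply/funext => x; rewrite (eN N.+1) [in RHS](eN N) factS natrM invfM.
  have N0 : N.+1%:R != 0 :> R by rewrite pnatr_eq0.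
  have F0 : N`!%:R != 0 :> R by rewrite pnatr_eq0 -lt0n fact_gt0.
  rewrite succnK (eN N).
  by field; rewrite F0 addrC natr1 N0.
apply: (Klim (c := expR c * b) (c' := expR c * b' + c' * expR c * b) Ksum) => [N x|N x|x|x].
- by rewrite normrM ler_pM//; exact: exp_sum_le.
- apply: le_trans (ler_normD _ _) _; rewrite !normrM lerD//.
    by rewrite ler_pM//; exact: exp_sum_le.
  by rewrite !ler_pM ?mulr_ge0//; exact: exp_sum_le.
- apply: cvgM; last exact: cvg_cst.
  have := @exp_sum_cvg R (s x); rewrite -(cvg_shiftS (fun N => exp_sum N (s x))).
  exact.
- apply: cvgD; apply: cvgM; try exact: cvg_cst.
    have := @exp_sum_cvg R (s x); rewrite -(cvg_shiftS (fun N => exp_sum N (s x))).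
    exact.
  by apply: cvgM; [exact: cvg_cst|exact: exp_sum_cvg].
Qed.

End exp_closure.

Section bounded_algebra.
Context (R : realType) (S : Type) (M : (S -> R) -> Prop).
Context (Mbounded : forall f, M f -> norm_bounded f).
Context (M1 : M (fun=> 1)).
Context (Mlin : forall a f g, M f -> M g -> M (fun x => a * f x + g x)).
Context (Mmul : forall f g, M f -> M g -> M (fun x => f x * g x)).
Context (Mlim : forall (f_ : nat -> S -> R) f (c : R), (forall n, M (f_ n)) ->
  (forall n x, `|f_ n x| <= c) -> (forall x, f_ n x @[n --> \oo] --> f x) -> M f).

Lemma algebra_cst (c : R) : M (fun=> c).
Proof.
have := Mlin (c - 1) M1 M1; rewrite (_ : (fun=> _) = (fun=> c))//.
by apply/funext => x; rewrite mulr1 subrK.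
Qed.

Lemma algebra_scale (c : R) f : M f -> M (fun x => c * f x).
Proof.
move=> Mf; have := Mlin c Mf (algebra_cst 0).
by rewrite (_ : (fun x => _) = (fun x => c * f x))//; apply/funext => x; rewrite addr0.
Qed.

Lemma algebra_exp f : M f -> M (fun x => expR (f x)).
Proof.
move=> Mf; have zb := @norm_bounded_cst R S 0.
have := @exp_closure R S (fun g _ => M g) (fun a g _ h _ => @Mlin a g h)
  (fun g_ _ g _ c _ Mg gc _ gg _ => Mlim Mg gc gg) f (fun=> 0) (Mbounded Mf) zb
  (fun g _ Mg => Mmul Mf Mg) (fun=> 1) (fun=> 0) (norm_bounded_cst _ 1) zb M1.
by rewrite (_ : (fun x => _) = (fun x => expR (f x)))//; apply/funext => x; rewrite mulr1.
Qed.

Lemma algebra_pow f j : M f -> M (fun x => f x ^+ j).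
Proof.
move=> Mf; elim: j => [|j IH].
  by rewrite (_ : (fun x => _) = (fun=> 1)).
have := Mmul Mf IH; rewrite (_ : (fun x => _) = (fun x => f x ^+ j.+1))//.
by apply/funext => x; rewrite exprS.
Qed.

Lemma expRN_le (y : R) : 0 < y -> expR (- y) <= y^-1.
Proof.
move=> y0; rewrite expRN lef_pV2 ?posrE ?expR_gt0//.
by apply: le_trans (expR_ge1Dx y); rewrite lerDr.
Qed.

Lemma scaled_inv_cvg0 (y : R) : (k.+1%:R * y)^-1 @[k --> \oo] --> 0.
Proof.
rewrite (_ : (fun k => _) = (fun k : nat => k.+1%:R^-1 * y^-1)); last first.
  by apply/funext => k; rewrite invfM.
rewrite -[X in _ --> X](mul0r y^-1); apply: cvgM; last exact: cvg_cst.
exact: cvg_harmonic.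
Qed.

(** exp (- exp (- k f)) tends to 1, 1/e or 0 according to the sign of f, and
    high powers of this limit send 1/e to 0. *)
Lemma algebra_pos f : M f -> M (\1_[set x | 0 < f x]).
Proof.
move=> Mf.
pose u k x := expR (- expR (- (k.+1%:R * f x))).
have Mu k : M (u k).
  have := algebra_exp (algebra_scale (-1) (algebra_exp (algebra_scale (- k.+1%:R) Mf))).
  rewrite (_ : (fun x => _) = u k)//.
  by apply/funext => x; rewrite /u mulN1r mulNr.
have u1 k x : `|u k x| <= 1.
  by rewrite ger0_norm ?expR_ge0// -expR0 ler_expR oppr_le0 expR_ge0.
pose h x : R := if 0 < f x then 1 else if f x == 0 then expR (-1) else 0.
have Mh : M h.
  apply: (Mlim Mu u1) => x; rewrite /h; case: ltgtP => fx.
  - apply: (norm_sub_le_cvg _ (scaled_inv_cvg0 (f x))) => k.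
    have kf : 0 < k.+1%:R * f x by rewrite mulr_gt0.
    apply: le_trans (expRN_le kf).
    rewrite /u ler0_norm; last by rewrite subr_le0 -expR0 ler_expR oppr_le0 expR_ge0.
    have := expR_ge1Dx (- expR (- (k.+1%:R * f x))).
    lra.
  - have fN : 0 < - f x by rewrite oppr_gt0.
    apply: (norm_le_cvg0 _ (scaled_inv_cvg0 (- f x))) => k.
    have kf : 0 < k.+1%:R * - f x by rewrite mulr_gt0.
    rewrite ger0_norm ?expR_ge0// /u; apply: le_trans (expRN_le (expR_gt0 _)) _.
    rewrite lef_pV2 ?posrE ?expR_gt0// -mulrN.
    by apply: le_trans (expR_ge1Dx _); rewrite lerDr.
  - rewrite (_ : (fun k => _) = (fun=> expR (-1))); first exact: cvg_cst.
    by apply/funext => k; rewrite /u -fx mulr0 oppr0 expR0.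
have e1 : expR (-1) < 1 :> R by rewrite -[ltRHS]expR0 ltr_expR; lra.
have e0 := expR_ge0 (-1 : R).
apply: (Mlim (f_ := fun j x => h x ^+ j.+1) (c := 1)) => [j|j x|x].
- exact: algebra_pow.
- rewrite normrX exprn_ile1//; rewrite /h; case: ifP => _; first by rewrite normr1.
  by case: ifP => _; rewrite ?normr0// ger0_norm// ltW.
- rewrite indicE /h; case: ifP => fx.
    rewrite mem_set//; under eq_fun do rewrite expr1n; exact: cvg_cst.
  rewrite memNset/=; last by rewrite fx.
  case: ifP => _; last by under eq_fun do rewrite expr0n; exact: cvg_cst.
  rewrite (cvg_shiftS (fun j => expR (-1) ^+ j)); apply: cvg_expr.
  by rewrite ger0_norm.
Qed.

Lemma algebra_indicC A : M (\1_A) -> M (\1_(~` A)).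
Proof.
move=> MA; have := Mlin (-1) MA M1.
rewrite (_ : (fun x => _) = \1_(~` A))//; apply/funext => x.
by rewrite !indicE in_setC; case: (_ \in _); rewrite /=; ring.
Qed.

(** Countable intersections are limits of finite products. *)
Lemma algebra_sigma_algebra : sigma_algebra setT [set A | M (\1_A)].
Proof.
split=> /=.
- rewrite (_ : \1_set0 = fun=> 0); first exact: algebra_cst.
  by apply/funext => x; rewrite indicE in_set0.
- by move=> A MA; rewrite setTD; exact: algebra_indicC.
- move=> A MA; rewrite -[X in \1_X]setCK setC_bigcup; apply: algebra_indicC.
  apply: (Mlim (f_ := fun n x => \prod_(k < n) \1_(~` A k) x) (c := 1)) => [n|n x|x].
  + elim: n => [|n IH].
      by rewrite (_ : (fun x => _) = (fun=> 1))//; apply/funext => x; rewrite big_ord0.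
    rewrite (_ : (fun x => _) = (fun x => (\prod_(k < n) \1_(~` A k) x) * \1_(~` A n) x)).
      by apply: Mmul => //; exact: algebra_indicC.
    by apply/funext => x; rewrite big_ord_recr.
  + rewrite normr_prod prodr_ile1// => k _; rewrite normr_ge0/= indicE.
    by case: (_ \in _); rewrite ?normr1 ?normr0.
  + rewrite indicE; have [xA|/existsNP[k /not_implyP[_ xA]]] :=
      pselect (forall k, True -> (~` A k) x).
      rewrite mem_set// (_ : (fun n => _) = (fun=> 1)); first exact: cvg_cst.
      by apply/funext => n; apply: big1 => k _; rewrite indicE mem_set//; exact: xA.
    rewrite memNset/=; last by move=> /(_ k Logic.I).
    apply: cvg_near_cst; exists k.+1 => // n /= kn.
    by rewrite (bigD1 (Ordinal kn))//= indicE memNset// mul0r.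
Qed.

Lemma sin_scale_cvg (x : R) : k.+1%:R * sin (x / k.+1%:R) @[k --> \oo] --> x.
Proof.
have c0 : x ^+ 2 * k.+1%:R^-1 @[k --> \oo] --> 0.
  rewrite -[X in _ --> X](mulr0 (x ^+ 2)); apply: cvgM; first exact: cvg_cst.
  exact: cvg_harmonic.
apply: (norm_sub_le_cvg _ c0) => k.
have k0 : k.+1%:R != 0 :> R by rewrite pnatr_eq0.
rewrite [X in _ - X](_ : x = k.+1%:R * (x / k.+1%:R)); last by rewrite mulrCA divff// mulr1.
rewrite -mulrBr normrM ger0_norm//.
have := sinBid_trunc2 (x / k.+1%:R); rewrite /trunc2 => H.
apply: (@le_trans _ _ (k.+1%:R * (`|x / k.+1%:R| * `|x / k.+1%:R|))).
  by rewrite ler_wpM2l//; apply: le_trans H _; rewrite ler_wpM2l// ge_min lexx orbT.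
rewrite -normrM ger0_norm -?expr2 ?sqr_ge0// expr_div_n.
by rewrite le_eqVlt; apply/orP; left; apply/eqP; field.
Qed.

(** As b may be unbounded, it is reached through the bounded k sin (b / k); the
    function exp (- exp (a - b)) is a bounded increasing function of b and
    exceeds 1/e exactly when b exceeds a. *)
Lemma algebra_level (b : S -> R) (a : R) :
  (forall k, M (fun x => sin (b x / k.+1%:R))) -> M (\1_[set x | a < b x]).
Proof.
move=> Mb.
pose u_ k x := expR (- expR (a - k.+1%:R * sin (b x / k.+1%:R))).
pose u x := expR (- expR (a - b x)).
have Mu_ k : M (u_ k).
  have := algebra_exp (algebra_scale (-1) (algebra_exp
    (Mlin (- k.+1%:R) (Mb k) (algebra_cst a)))).
  rewrite (_ : (fun x => _) = u_ k)//.
  by apply/funext => x; rewrite /u_ mulN1r mulNr addrC.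
have Mu : M u.
  apply: (Mlim (c := 1) Mu_) => [k x|x].
    by rewrite ger0_norm ?expR_ge0// -expR0 ler_expR oppr_le0 expR_ge0.
  apply: continuous_cvg; first exact: continuous_expR.
  apply: cvgN; apply: continuous_cvg; first exact: continuous_expR.
  by apply: cvgB; [exact: cvg_cst|exact: sin_scale_cvg].
have := algebra_pos (Mlin 1 Mu (algebra_cst (- expR (-1)))).
rewrite (_ : [set x | _] = [set x | a < b x])//; apply/seteqP; split=> x /=.
  by rewrite mul1r subr_gt0 ltr_expR ltrN2 -[X in _ < X]expR0 ltr_expR subr_lt0.
by move=> ab; rewrite mul1r subr_gt0 ltr_expR ltrN2 -[X in _ < X]expR0 ltr_expR subr_lt0.
Qed.

End bounded_algebra.

(** * Totality of the trigonometric processes *)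

Section trigonometric_total.
Context (R : realType) d (T : measurableType d) (P : probability T R).
Context (B : R -> {RV P >-> R}) (bm : brownian_motion B).
Context (cbf : completed_brownian_field B).

Local Notation TR := (T * measurableTypeR R)%type.
Local Notation L2 := (Lfun (P_time P) 2%:E).
Local Notation nrm := (L2norm (P_time P)).
Local Notation lin := (lin B).
Local Notation bpos := (bpos B).

Definition trig (g : seq (R * R)) (a t : R) : T * R -> R :=
  tensor (fun w => cos (lin g w + a)) 0 (tpos t).

Lemma measurable_lin g : measurable_fun setT (lin g).
Proof. by apply: measurable_sum => p; apply: measurable_funM. Qed.

Lemma trig_base_Lfun2 g a : (fun w => cos (lin g w + a)) \in Lfun P 2%:E /\
  L2norm P (fun w => cos (lin g w + a)) <= 1.
Proof.
apply: L2norm_bounded1 => [|w]; last exact: cos_max.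
apply: measurableT_comp; first exact: continuous_measurable_fun (@continuous_cos R).
by apply: measurable_funD => //; exact: measurable_lin.
Qed.

Lemma trig_Lfun2 g a t : trig g a t \in L2.
Proof. by have [h _] := trig_base_Lfun2 g a; apply: Lfun2_tensor => //; exact: tpos_ge0. Qed.

Lemma P_time_setX (A : set T) (C : set (measurableTypeR R)) :
  measurable A -> measurable C ->
  P_time P (A `*` C) = (P A * lebesgue_measure (C `&` `[0%R, +oo[))%E.
Proof.
move=> mA mC.
rewrite (_ : P_time P _ = (P \x lebesgue_measure)%E ((A `*` C) `&` (setT `*` `[0%R, +oo[)))//.
rewrite -setXI setIT product_measure1E//.
by apply: measurableI => //; exact: measurable_itv.
Qed.

Lemma P_time_pos_ae : {ae P_time P, forall p : TR, 0 < p.2}.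
Proof.
exists ([set: T] `*` `]-oo, 0%R]%classic); split.
- by apply: measurableX => //; exact: measurable_itv.
- rewrite P_time_setX//.
  rewrite (_ : _ `&` `[0, +oo[ = [set 0 : R]); last first.
    apply/seteqP; split=> s /=; rewrite !in_itv/= ?andbT.
      by move=> [s0 s1]; apply/eqP; rewrite eq_le s0 s1.
    by move=> ->; rewrite lexx.
  by rewrite lebesgue_measure_set1 mule0.
- by move=> [w s] /= /negP; rewrite -leNgt in_itv/= => s0; split.
Qed.

Context (V : (T * R -> R) -> Prop).
Context (Vlin : forall a f g, f \in L2 -> g \in L2 -> V f -> V g ->
  V (fun p => a * f p + g p)).
Context (Vcl : forall f_ f, (forall n, f_ n \in L2) -> f \in L2 ->
  (forall n, V (f_ n)) -> nrm (fun p => f_ n p - f p) @[n --> \oo] --> 0 -> V f).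
Context (Vtrig : forall g a t, V (trig g a t)).

Let Vae f g : f \in L2 -> g \in L2 -> {ae P_time P, forall p, f p = g p} ->
  V f -> V g.
Proof.
move=> fL gL fg Vf; apply: (@Vcl (fun=> f) g) => //.
rewrite (_ : (fun n => _) = (fun=> 0)); first exact: cvg_cst.
apply/funext => n; rewrite (L2norm_ae_eq (Lfun2B fL gL) (Lfun2_0 _)).
  by rewrite /L2norm /dotp; under eq_Rintegral do rewrite mul0r;
    rewrite Rintegral_cst// mul0r sqrtr0.
by apply: filterS fg => p ->; rewrite subrr.
Qed.

Let bm_fun (f : T * R -> R) := measurable_fun [set: TR] f /\ norm_bounded f.

(** Phi is good if it multiplies every trigonometric process into V; mult
    singles out the multipliers of good functions, which form an algebra. *)
Let good Phi := bm_fun Phi /\ forall g a t, V (fun p => Phi p * trig g a t p).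
Let mult s := bm_fun s /\ forall Phi, good Phi -> good (fun p => s p * Phi p).

Let bm_mulL Phi f : bm_fun Phi -> f \in L2 -> (fun p => Phi p * f p) \in L2.
Proof. by move=> [mP [c Pc]] fL; exact: Lfun2_mul_bounded fL mP Pc. Qed.

Let bm_funM f g : bm_fun f -> bm_fun g -> bm_fun (fun p => f p * g p).
Proof.
move=> [mf bf] [mg bg]; split; first exact: measurable_funM.
exact: norm_boundedM.
Qed.

Let bm_funL a f g : bm_fun f -> bm_fun g -> bm_fun (fun p => a * f p + g p).
Proof.
move=> [mf bf] [mg bg]; split.
  by apply: measurable_funD => //; exact: measurable_funM.
by apply: norm_boundedD => //; apply: norm_boundedM => //; exact: norm_bounded_cst.
Qed.

Let good_lim (f_ : nat -> T * R -> R) f c : (forall n, good (f_ n)) ->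
  (forall n x, `|f_ n x| <= c) -> (forall x, f_ n x @[n --> \oo] --> f x) -> good f.
Proof.
move=> gf fc ff.
have mf : measurable_fun [set: TR] f.
  by apply: (measurable_fun_limR _ ff) => n; case: (gf n) => -[].
have bf : bm_fun f.
  split => //; exists c => x; apply: (cvg_le _ (cvg_norm (ff x))) => n; exact: fc.
split => // g a t; have tL := trig_Lfun2 g a t.
have fb n p : `|f_ n p * trig g a t p| <= `|c| * `|trig g a t p|.
  by rewrite normrM ler_wpM2r// (le_trans (fc n p))// ler_norm.
have [gL gc] := @L2_dominated_cvg _ _ _ (P_time P) (fun n p => f_ n p * trig g a t p)
  (fun p => f p * trig g a t p) (fun p => `|c| * `|trig g a t p|)
  (fun n => Lfun2_measurable (bm_mulL (gf n).1 tL)) (Lfun2Z `|c| (Lfun2_abs tL))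
  fb (fun p => cvgM (ff p) (cvg_cst _)).
apply: (@Vcl (fun n p => f_ n p * trig g a t p)) => //.
- by move=> n; exact: bm_mulL (gf n).1 tL.
- by move=> n; case: (gf n).
Qed.

Let mult1 : mult (fun=> 1).
Proof.
split; first by split; [exact: measurable_cst|exact: norm_bounded_cst].
by move=> Phi gP; rewrite (_ : (fun p => _) = Phi)//; apply/funext => p; rewrite mul1r.
Qed.

Let good_lin a f g : good f -> good g -> good (fun p => a * f p + g p).
Proof.
move=> [bf Vf] [bg Vg]; split; first exact: bm_funL.
move=> l b t; have tL := trig_Lfun2 l b t.
have := Vlin a (bm_mulL bf tL) (bm_mulL bg tL) (Vf l b t) (Vg l b t).
rewrite (_ : (fun p => _) = (fun p => (a * f p + g p) * trig l b t p))//.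
by apply/funext => p; rewrite mulrDl mulrA.
Qed.

Let mult_lin a f g : mult f -> mult g -> mult (fun p => a * f p + g p).
Proof.
move=> [bf mf] [bg mg]; split; first exact: bm_funL.
move=> Phi gP; have := good_lin a (mf _ gP) (mg _ gP).
rewrite (_ : (fun p => _) = (fun p => (a * f p + g p) * Phi p))//.
by apply/funext => p; rewrite mulrDl mulrA.
Qed.

Let mult_mul f g : mult f -> mult g -> mult (fun p => f p * g p).
Proof.
move=> [bf mf] [bg mg]; split; first exact: bm_funM.
move=> Phi gP; have := mf _ (mg _ gP).
rewrite (_ : (fun p => _) = (fun p => f p * g p * Phi p))//.
by apply/funext => p; rewrite mulrA.
Qed.

Let mult_lim (f_ : nat -> T * R -> R) f c : (forall n, mult (f_ n)) ->
  (forall n x, `|f_ n x| <= c) -> (forall x, f_ n x @[n --> \oo] --> f x) -> mult f.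
Proof.
move=> mf fc ff; split.
  split; first by apply: (measurable_fun_limR _ ff) => n; case: (mf n) => -[].
  by exists c => x; apply: (cvg_le _ (cvg_norm (ff x))) => n; exact: fc.
move=> Phi gP; have [[_ [k Pk]] _] := gP.
apply: (@good_lim (fun n p => f_ n p * Phi p) _ (c * k)) => [n|n p|p].
- by have [_] := mf n; exact.
- by rewrite normrM ler_pM.
- by apply: cvgM => //; exact: cvg_cst.
Qed.

Let mult_bounded f : mult f -> norm_bounded f. Proof. by case=> -[]. Qed.

(** The product-to-sum formula writes the product of sin (B_t / (k+1)) with a
    trigonometric process as a combination of two such processes. *)
Let mult_sin t k : mult (fun p => sin (bpos t p.1 / k.+1%:R)).
Proof.
set r := k.+1%:R^-1.
have bs : bm_fun (fun p => sin (bpos t p.1 * r)).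
  split; last by exists 1 => p; exact: sin_max.
  apply: measurableT_comp; first exact: continuous_measurable_fun (@continuous_sin R).
  by apply: measurable_funM => //; exact: measurableT_comp.
split => // Phi gP; have [bP VP] := gP; split; first exact: bm_funM.
move=> g a u.
have tL l b := bm_mulL bP (trig_Lfun2 l b u).
have := Vlin 2^-1 (tL ((r, t) :: g) (a - pi / 2)) (Lfun2Z (- 2^-1) (tL ((- r, t) :: g) (a - pi / 2)))
  (VP _ _ _) _.
set W := (fun p => _ + _).
rewrite (_ : (fun p => sin (bpos t p.1 * r) * Phi p * trig g a u p) = W).
  apply; have := Vlin (- 2^-1 - 1) (tL ((- r, t) :: g) (a - pi / 2))
    (tL ((- r, t) :: g) (a - pi / 2)) (VP _ _ _) (VP _ _ _).
  rewrite (_ : (fun p => _) = (fun p => - 2^-1 * (Phi p * trig ((- r, t) :: g) (a - pi / 2) u p)))//.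
  by apply/funext => p; ring.
apply/funext => p; rewrite /W /trig /tensor.
have e (x : R) : cos (x - pi / 2) = sin x by rewrite -sinDpihalf subrK.
rewrite !linE !big_cons /= -!linE !addrA !e.
set b := bpos t p.1; set L := lin g p.1.
rewrite (_ : r * b + L + a = L + a + b * r); last by ring.
rewrite (_ : - r * b + L + a = L + a - b * r); last by ring.
by rewrite sinB [sin (L + a + _)]sinD; field.
Qed.

(** Cutting at time u only shortens the interval of a trigonometric process. *)
Let mult_time (u : R) : mult (\1_[set p | p.2 <= u]).
Proof.
have bs : bm_fun (\1_[set p | p.2 <= u] : T * R -> R).
  split; last by exists 1 => p; rewrite indicE; case: (_ \in _); rewrite ?normr1 ?normr0.
  apply: measurable_indic; rewrite -[X in measurable X]setTI.
  rewrite (_ : [set p | _] = snd @^-1` `]-oo, u]%classic); last first.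
    by apply/seteqP; split=> p /=; rewrite in_itv.
  exact: measurable_snd.
split => // Phi gP; have [bP VP] := gP; split; first exact: bm_funM.
move=> g a t; have := VP g a (Num.min u t).
rewrite (_ : (fun p => _) = (fun p => \1_[set p | p.2 <= u] p * Phi p * trig g a t p))//.
apply/funext => p; rewrite mulrAC [RHS]mulrC; congr (_ * _).
rewrite /trig /tensor [RHS]mulrC -mulrA; congr (_ * _).
have -> : \1_[set p : T * R | p.2 <= u] p = (p.2 <= u)%R%:R :> R.
  rewrite indicE; case: (leP p.2 u) => pu; first by rewrite mem_set.
  by rewrite memNset//= leNgt pu.
rewrite !indicE !mem_setE /= !in_itv/= /tpos !le_max !le_min.
have [p0|p0] := ltP 0 p.2; last by rewrite mul0r.
by case: (p.2 <= u); case: (p.2 <= t); rewrite /= ?mulr0 ?mulr1.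
Qed.

Let msets : set (set (T * R)) := [set A | mult (\1_A)].

Let msets_sigma : sigma_algebra setT msets.
Proof. exact: algebra_sigma_algebra mult1 mult_lin mult_mul mult_lim. Qed.

Let msets_preimage (U : Type) (f : T * R -> U) :
  sigma_algebra setT [set A | msets (f @^-1` A)].
Proof.
have [m0 mD mU] := msets_sigma; split=> /=.
- by rewrite preimage_set0.
- by move=> A mA; rewrite setTD preimage_setC -setTD; exact: mD.
- by move=> A mA; rewrite preimage_bigcup; exact: mU.
Qed.

Let msets_time (A : set (measurableTypeR R)) : measurable A -> msets (snd @^-1` A).
Proof.
move=> mA; have {}mA : (@RGenOInfty.G R).-sigma.-measurable A.
  by rewrite -RGenOInfty.measurableE.
have {mA} : <<s @RGenOInfty.G R >> A := mA.
move: A; apply: smallest_sub; first exact: (msets_preimage snd).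
move=> _ [x ->] /=.
have := algebra_indicC mult1 mult_lin (mult_time x).
rewrite (_ : ~` _ = snd @^-1` `]x, +oo[%classic)//.
apply/seteqP; split=> p /=; rewrite in_itv/= andbT.
  by move=> /negP; rewrite -ltNge.
by move=> xp; apply/negP; rewrite -ltNge.
Qed.

Let msets_level t (A : set R) : measurable A -> msets (fst @^-1` (bpos t @^-1` A)).
Proof.
move=> mA; have {}mA : (@RGenOInfty.G R).-sigma.-measurable A.
  by rewrite -RGenOInfty.measurableE.
have {mA} : <<s @RGenOInfty.G R >> A := mA.
move: A; apply: smallest_sub; first exact: (msets_preimage (bpos t \o fst)).
move=> _ [x ->] /=.
have := algebra_level mult_bounded mult1 mult_lin mult_mul mult_lim x (mult_sin t).
rewrite (_ : [set p | _] = fst @^-1` (bpos t @^-1` `]x, +oo[%classic))//.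
by apply/seteqP; split=> p /=; rewrite in_itv/= andbT.
Qed.

Let msets_null (A A1 : set T) : measurable A -> msets (fst @^-1` A1) ->
  {ae P, forall w, \1_A w = \1_A1 w :> R} -> msets (fst @^-1` A).
Proof.
move=> mA [b1 m1] AA1.
have bA : bm_fun (\1_(fst @^-1` A) : T * R -> R).
  split; last by exists 1 => p; rewrite indicE; case: (_ \in _); rewrite ?normr1 ?normr0.
  by apply: measurable_indic; rewrite -[X in measurable X]setTI; exact: measurable_fst.
split => // Phi gP; have [bP _] := gP; have [b1P V1P] := m1 _ gP.
split; first exact: bm_funM.
move=> g a t; have tL := trig_Lfun2 g a t.
apply: Vae (V1P g a t); try exact: bm_mulL (bm_funM _ _) tL.
have [N [mN PN sN]] := AA1.
exists (N `*` setT); split.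
- exact: measurableX.
- by rewrite P_time_setX// PN mul0e.
- move=> [w s] /= h; split => //; apply: sN => /= e; apply: h.
  by congr (_ * _ * _); exact: esym e.
Qed.

(** Every event differs by a null set from one of the field generated by B. *)
Let msets_space (A : set T) : measurable A -> msets (fst @^-1` A).
Proof.
move=> /[dup] mA; have [_ _] := msets_sigma.
have FBm A1 : sigma_of [set t : R | 0 <= t] (fun t => B t) A1 -> msets (fst @^-1` A1).
  move: A1; apply: smallest_sub; first exact: (msets_preimage fst).
  move=> _ [t t0 [C mC <-]]; rewrite setTI /=.
  have := msets_level t mC; rewrite (_ : bpos t = B t)//.
  by apply/funext => w; rewrite bposE tpos_id.
have FBmeas A1 : sigma_of [set t : R | 0 <= t] (fun t => B t) A1 -> measurable A1.
  move: A1; apply: smallest_sub; first exact: sigma_algebra_measurable.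
  by move=> _ [t t0 [C mC <-]]; exact: measurable_funP.
move=> _ /(cbf A).1 [A1 [A2 [F1 F2 A1A AA2 P0]]].
apply: (msets_null mA (FBm _ F1)).
exists (A2 `\` A1); split => //.
  by apply: measurableD; exact: FBmeas.
move=> w /= h; split.
  apply: AA2; apply: contrapT => nA; apply: h.
  by rewrite !indicE !memNset// => /A1A.
by move=> w1; apply: h; rewrite !indicE !mem_set//; exact: A1A.
Qed.

Let msets_measurable (A : set TR) : measurable A -> msets A.
Proof.
move: A; apply: smallest_sub; first exact: msets_sigma.
move=> A [[C mC <-]|[C mC <-]]; rewrite setTI; first exact: msets_space.
exact: msets_time.
Qed.

Let good1 : good (fun=> 1).
Proof.
split; first by split; [exact: measurable_cst|exact: norm_bounded_cst].
move=> g a t; rewrite (_ : (fun p => _) = trig g a t)//.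
by apply/funext => p; rewrite mul1r.
Qed.

Let mult_all f : bm_fun f -> mult f.
Proof.
move=> [mf [c fc]].
apply: (@bounded_measurable_class _ _ (@measurable _ TR) mult msets_measurable _ _ _ f c) => //.
- exact: algebra_cst mult1 mult_lin 0.
- move=> f_ h mf_ fh; have [[_ [k fk]] _] := mf_ 0%N.
  have hk x : `|h x| <= k + 1.
    have := fh 0%N x; rewrite invr1 => H0; rewrite -[h x](subKr (f_ 0%N x)).
    by apply: le_trans (ler_normB _ _) _; rewrite lerD.
  apply: (mult_lim (c := k + 2) mf_) => [n x|x].
    rewrite -[f_ n x](subrK (h x)).
    apply: le_trans (ler_normD _ _) _.
    rewrite (_ : k + 2 = 1 + (k + 1)); last by ring.
    by apply: lerD => //; apply: le_trans (fh n x) _; rewrite invf_le1// ler1n.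
  by apply: (norm_sub_le_cvg _ (@cvg_harmonic R)) => n; exact: fh.
- move=> a b; rewrite -[X in measurable X]setTI; apply: mf => //; exact: measurable_itv.
Qed.

(** By the preceding steps all bounded measurable functions are multipliers, and
    1 is good since V contains the trigonometric processes. So V contains all
    bounded functions cut off in time, and truncating f in space and time gives
    f, except at times s <= 0, which are negligible. *)
Lemma trigonometric_total f : f \in L2 -> V f.
Proof.
move=> fL; have mf := Lfun2_measurable fL.
pose chi k p : R := \1_[set p | `|f p| <= k%:R] p.
have mchi k : measurable_fun [set: TR] (chi k).
  apply: measurable_indic; rewrite -[X in measurable X]setTI.
  rewrite (_ : [set p | _] = (fun p => `|f p|) @^-1` `]-oo, k%:R]%classic); last first.
    by apply/seteqP; split=> p /=; rewrite in_itv.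
  by have mn : measurable_fun [set: TR] (fun p => `|f p|); [exact: measurableT_comp|exact: mn].
have chi_le k p : `|chi k p| <= 1.
  by rewrite /chi indicE; case: (_ \in _); rewrite ?normr1 ?normr0.
pose Phi k p := f p * chi k p.
have bPhi k : bm_fun (Phi k).
  split; first exact: measurable_funM.
  exists k%:R => p; rewrite /Phi /chi indicE; have [fk|fk] := leP `|f p| k%:R.
    by rewrite mem_set// mulr1.
  by rewrite memNset ?mulr0 ?normr0//= leNgt fk.
pose i k p : R := trig [::] 0 k%:R p.
have iE k p : i k p = \1_(`]0, k%:R]) p.2.
  by rewrite /i /trig /tensor linE big_nil addr0 cos0 mul1r tpos_id.
pose f_ k p := Phi k p * i k p.
have Vf_ k : V (f_ k).
  have [_ m] := mult_all (bPhi k); have [_ h] := m _ good1.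
  have := h [::] 0 k%:R; rewrite (_ : (fun p => _) = f_ k)//.
  by apply/funext => p; rewrite mulr1.
have f_L k : f_ k \in L2 by exact: bm_mulL (bPhi k) (trig_Lfun2 _ _ _).
pose f' p := f p * \1_[set p : T * R | 0 < p.2] p.
have f_le k p : `|f_ k p| <= `|f p|.
  rewrite /f_ /Phi iE -mulrA normrM ler_piMr// normrM mulr_ile1//.
  by rewrite indicE; case: (_ \in _); rewrite ?normr1 ?normr0.
have f_c p : f_ k p @[k --> \oo] --> f' p.
  rewrite /f_ /f' /Phi /chi indicE.
  apply: cvg_near_cst.
  exists (Num.truncn (Num.max `|f p| p.2)).+1 => // k /= kb.
  have /andP[kf kp] : (`|f p| <= k%:R) && (p.2 <= k%:R).
    rewrite -ge_max; apply: ltW; apply: lt_le_trans (truncnS_gt _) _.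
    by rewrite ler_nat.
  rewrite !indicE mem_set// mulr1 iE; congr (_ * _).
  by rewrite indicE !mem_setE /= in_itv/= kp andbT.
have [f'L fc] := L2_dominated_cvg (fun k => Lfun2_measurable (f_L k)) (Lfun2_abs fL) f_le f_c.
apply: (@Vae f' f) => //.
  by apply: filterS P_time_pos_ae => p p0; rewrite /f' indicE mem_set// mulr1.
exact: Vcl fc.
Qed.

End trigonometric_total.

(** * From trigonometric functions to exponentials *)

Section dominated_pairing.
Context (R : realType) d (T : measurableType d) (m : {measure set T -> \bar R}).
Local Notation L2 := (Lfun m 2%:E).

Lemma dotp_dominated_cvg (Z g v : T -> R) (v_ : nat -> T -> R) : Z \in L2 -> g \in L2 ->
  (forall n, measurable_fun setT (v_ n)) -> (forall n x, `|v_ n x| <= g x) ->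
  (forall x, v_ n x @[n --> \oo] --> v x) ->
  v \in L2 /\ dotp m Z (v_ n) @[n --> \oo] --> dotp m Z v.
Proof.
move=> ZL gL mv vg vc; have [vL cv] := L2_dominated_cvg mv gL vg vc.
have vnL n : v_ n \in L2.
  apply: (Lfun2_le (mv n) gL) => x; rewrite [leRHS]ger0_norm//.
  exact: le_trans (normr_ge0 _) (vg n x).
split => //.
exact: (dotp_cvg_weak_strong (fun=> ZL) vnL vL (fun=> lexx _) (cvg_cst _) cv).
Qed.

End dominated_pairing.

Section exponential_duality.
Context (R : realType) d (T : measurableType d) (P : probability T R).
Context (B : R -> {RV P >-> R}) (bm : brownian_motion B).

Local Notation L2 := (Lfun P 2%:E).
Local Notation L2t := (Lfun (P_time P) 2%:E).
Local Notation lin := (lin B).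
Local Notation bpos := (bpos B).
Local Notation test_fun := (test_fun B).
Local Notation trig := (trig B).

Definition abs_lin (g : seq (R * R)) (w : T) : R :=
  \sum_(p <- g) `|p.1| * `|bpos p.2 w|.

Lemma lin_le_abs g w : `|lin g w| <= abs_lin g w.
Proof.
apply: le_trans (ler_norm_sum _ _ _) _; apply: ler_sum => p _.
by rewrite normrM.
Qed.

Lemma measurable_abs_lin g : measurable_fun setT (abs_lin g).
Proof.
apply: measurable_sum => p; apply: measurable_funM => //.
by apply: measurableT_comp => //; exact: measurable_bpos.
Qed.

(** By e^(x+y) <= e^(2x) + e^(2y) the Gaussian bound is used for one value of B
    at a time. *)
Lemma exp_abs_lin_Lfun2 g c : 0 <= c -> (fun w => expR (c * abs_lin g w)) \in L2.
Proof.
elim: g c => [|p g IH] c c0.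
  rewrite (_ : (fun w => _) = (fun=> 1)); first exact: Lfun_cst.
  by apply/funext => w; rewrite /abs_lin big_nil mulr0 expR0.
have c20 : 0 <= c * 2 by rewrite mulr_ge0.
have := Lfun2D (bpos_exp bm p.2 (c * 2 * `|p.1|)) (IH _ c20).
move/Lfun2_le; apply => [|w].
  apply: measurableT_comp => //; apply: measurable_funM => //.
  exact: measurable_abs_lin.
rewrite /abs_lin big_cons -/(abs_lin g w) -(mulrA (c * 2)).
have x0 : 0 <= `|p.1| * `|bpos p.2 w| by rewrite mulr_ge0.
have y0 : 0 <= abs_lin g w by apply: sumr_ge0 => q _; rewrite mulr_ge0.
move: (`|p.1| * `|bpos p.2 w|) (abs_lin g w) x0 y0 => x y x0 y0.
rewrite !ger0_norm ?addr_ge0 ?expR_ge0//.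
have [xy|/ltW xy] := leP x y.
  apply: (@le_trans _ _ (expR (c * 2 * y))); last by rewrite lerDr expR_ge0.
  by rewrite ler_expR -mulrA ler_wpM2l//; lra.
apply: (@le_trans _ _ (expR (c * 2 * x))); last by rewrite lerDl expR_ge0.
by rewrite ler_expR -mulrA ler_wpM2l//; lra.
Qed.

Lemma lin_cat g l w : lin (g ++ l) w = lin g w + lin l w.
Proof. by rewrite !linE big_cat. Qed.

Lemma lin_scale c g w : lin [seq (c * p.1, p.2) | p <- g] w = c * lin g w.
Proof. by rewrite !linE big_map mulr_sumr; apply: eq_bigr => p _; rewrite mulrA. Qed.

Lemma overlap_cat (g l : seq (R * R)) (t : R) : overlap (g ++ l) t = overlap g t + overlap l t.
Proof. by rewrite /overlap big_cat. Qed.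

Lemma overlap_scale (c : R) (g : seq (R * R)) (t : R) :
  overlap [seq (c * p.1, p.2) | p <- g] t = c * overlap g t.
Proof. by rewrite /overlap big_map mulr_sumr; apply: eq_bigr => p _; rewrite mulrA. Qed.

Context (Z : T * R -> R) (X : T -> R) (ZL : Z \in L2t) (XL : X \in L2).
Context (dual : forall g a t,
  dotp (P_time P) Z (trig g a t) = dotp P X (test_fun g a t)).

Section fixed_time.
Variable t : R.

Local Notation dotZ u := (dotp (P_time P) Z (tensor u 0 (tpos t))).

Let bm_fun (f : T -> R) := measurable_fun setT f /\ norm_bounded f.

Let ctrig l a w := cos (lin l w + a).

Let lhs (f : T -> R) l a := dotZ (fun w => f w * ctrig l a w).
Let rhs_fun (f f' : T -> R) l a w := f w * test_fun l a t w - f' w * ctrig l a w.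

(** Think of f = F(L) and f' = kappa F'(L), with kappa the covariance of L and
    B_t. The duality is required for the product of f with every cosine, not
    for f alone, so that it is stable under multiplication of f by sines. *)
Let dual_pair (f f' : T -> R) := [/\ bm_fun f, bm_fun f' &
  forall l a, lhs f l a = dotp P X (rhs_fun f f' l a)].

Let bm_mulL (f F : T -> R) : bm_fun f -> F \in L2 -> (fun w => f w * F w) \in L2.
Proof. by move=> [mf [c fc]] FL; exact: Lfun2_mul_bounded FL mf fc. Qed.

Let ctrigL l a : ctrig l a \in L2 := (trig_base_Lfun2 B l a).1.
Let testL l a : test_fun l a t \in L2. Proof. exact: test_fun_Lfun2. Qed.

Let rhsL f f' l a : bm_fun f -> bm_fun f' -> rhs_fun f f' l a \in L2.
Proof. by move=> bf bf'; apply: Lfun2B; exact: bm_mulL. Qed.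

Let tenL u : u \in L2 -> tensor u 0 (tpos t) \in L2t.
Proof. by move=> uL; apply: Lfun2_tensor => //; exact: tpos_ge0. Qed.

Let dotZ_lin a u v : u \in L2 -> v \in L2 ->
  dotZ (fun w => a * u w + v w) = a * dotZ u + dotZ v.
Proof.
move=> uL vL; rewrite -dotpZr ?tenL// -dotpDr ?tenL ?Lfun2Z ?tenL//.
by congr dotp; apply/funext => p; rewrite /tensor; ring.
Qed.

Let dotZ_cvg (u_ : nat -> T -> R) (u g : T -> R) : g \in L2 ->
  (forall n, u_ n \in L2) -> (forall n w, `|u_ n w| <= g w) ->
  (forall w, u_ n w @[n --> \oo] --> u w) ->
  dotZ (u_ n) @[n --> \oo] --> dotZ u.
Proof.
move=> gL uL ug uc.
refine (proj2 (@dotp_dominated_cvg R _ _ (P_time P) Z (tensor g 0 (tpos t))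
  (tensor u 0 (tpos t)) (fun n => tensor (u_ n) 0 (tpos t)) ZL (tenL gL) _ _ _)).
- by move=> n; exact: Lfun2_measurable (tenL (uL n)).
- move=> n p; rewrite /tensor normrM (ger0_norm (_ : 0 <= \1_(_) _))//.
  by rewrite ler_wpM2r.
- by move=> p; apply: cvgM; [exact: uc|exact: cvg_cst].
Qed.

Let dual_pair1 : dual_pair (fun=> 1) (fun=> 0).
Proof.
split; try by split; [exact: measurable_cst|exact: norm_bounded_cst].
move=> l a; rewrite /lhs /rhs_fun.
under [in RHS]eq_fun do rewrite mul1r mul0r subr0.
rewrite -(dual l a t); congr dotp; congr tensor.
by apply/funext => w; rewrite mul1r.
Qed.

Let dual_pair_lin a f f' g g' : dual_pair f f' -> dual_pair g g' ->
  dual_pair (fun x => a * f x + g x) (fun x => a * f' x + g' x).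
Proof.
have bmL h k : bm_fun h -> bm_fun k -> bm_fun (fun x => a * h x + k x).
  move=> [mh bh] [mk bk]; split.
    by apply: measurable_funD => //; exact: measurable_funM.
  by apply: norm_boundedD => //; apply: norm_boundedM => //; exact: norm_bounded_cst.
move=> [bf bf' ef] [bg bg' eg]; split; [exact: bmL|exact: bmL|move=> l b].
have := ef l b; have := eg l b; rewrite /lhs => Eg Ef.
transitivity (a * dotp P X (rhs_fun f f' l b) + dotp P X (rhs_fun g g' l b)).
  rewrite -Ef -Eg -dotZ_lin; try exact: bm_mulL (ctrigL l b).
  by congr dotp; congr tensor; apply/funext => w; ring.
rewrite -dotpZr ?rhsL// -dotpDr ?Lfun2Z ?rhsL//; congr dotp; apply/funext => w.
by rewrite /rhs_fun; ring.
Qed.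

Let dual_pair_lim (f_ f'_ : nat -> T -> R) f f' (c c' : R) :
  (forall n, dual_pair (f_ n) (f'_ n)) -> (forall n x, `|f_ n x| <= c) ->
  (forall n x, `|f'_ n x| <= c') -> (forall x, f_ n x @[n --> \oo] --> f x) ->
  (forall x, f'_ n x @[n --> \oo] --> f' x) -> dual_pair f f'.
Proof.
have bm_lim (h_ : nat -> T -> R) h k : (forall n, measurable_fun setT (h_ n)) ->
    (forall n x, `|h_ n x| <= k) -> (forall x, h_ n x @[n --> \oo] --> h x) -> bm_fun h.
  move=> mh hk hh; split; first exact: measurable_fun_limR mh hh.
  by exists k => x; apply: (cvg_le _ (cvg_norm (hh x))) => n; exact: hk.
move=> Kf fc fc' ff ff'.
have bf_ n : bm_fun (f_ n) by case: (Kf n).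
have bf'_ n : bm_fun (f'_ n) by case: (Kf n).
have bf : bm_fun f by apply: bm_lim fc ff => n; case: (bf_ n).
have bf' : bm_fun f' by apply: bm_lim fc' ff' => n; case: (bf'_ n).
split => // l a.
have cst_c : (fun=> c) \in L2 by exact: Lfun_cst.
have cl : lhs (f_ n) l a @[n --> \oo] --> lhs f l a.
  apply: (dotZ_cvg (u_ := fun n w => f_ n w * ctrig l a w) cst_c) => [n|n w|w].
  - exact: bm_mulL (bf_ n) (ctrigL l a).
  - rewrite normrM -[leRHS]mulr1 ler_pM//; exact: cos_max.
  - by apply: cvgM => //; exact: cvg_cst.
have [_ cr] : rhs_fun f f' l a \in L2 /\ dotp P X (rhs_fun (f_ n) (f'_ n) l a) @[n --> \oo] -->
    dotp P X (rhs_fun f f' l a).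
  apply: (dotp_dominated_cvg (g := fun w => c * `|test_fun l a t w| + c' * `|ctrig l a w|)) => //.
  - by apply: Lfun2D; apply: Lfun2Z; apply: Lfun2_abs.
  - by move=> n; exact: Lfun2_measurable (rhsL l a (bf_ n) (bf'_ n)).
  - move=> n w; apply: le_trans (ler_normB _ _) _.
    by rewrite !normrM lerD// ler_wpM2r.
  - by move=> w; apply: cvgB; apply: cvgM => //; exact: cvg_cst.
have E n : lhs (f_ n) l a = dotp P X (rhs_fun (f_ n) (f'_ n) l a) by case: (Kf n).
apply: (@cvg_unique _ _ (lhs (f_ n) l a @[n --> \oo])) => //.
rewrite (_ : (fun n => lhs _ _ _) = (fun n => dotp P X (rhs_fun (f_ n) (f'_ n) l a)))//.
by apply/funext => n; exact: E.
Qed.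

Section scaled_sine.
Variables (g : seq (R * R)) (k : nat).
Local Notation r := (k.+1%:R^-1 : R).

Let s w := k.+1%:R * sin (lin g w / k.+1%:R).
Let s' w := cos (lin g w / k.+1%:R) * overlap g t.

Let bs : bm_fun s.
Proof.
split.
  apply: measurable_funM => //.
  apply: measurableT_comp; first exact: continuous_measurable_fun (@continuous_sin R).
  by apply: measurable_funM => //; exact: measurable_lin.
by apply: norm_boundedM; [exact: norm_bounded_cst|exists 1 => w; exact: sin_max].
Qed.

Let bs' : bm_fun s'.
Proof.
split.
  apply: measurable_funM => //.
  apply: measurableT_comp; first exact: continuous_measurable_fun (@continuous_cos R).
  by apply: measurable_funM => //; exact: measurable_lin.
by apply: norm_boundedM; [exists 1 => w; exact: cos_max|exact: norm_bounded_cst].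
Qed.

(** The product of two trigonometric functions is a combination of
    trigonometric functions of l + g/(k+1) and l - g/(k+1). *)
Let dual_pair_sine f f' : dual_pair f f' ->
  dual_pair (fun x => s x * f x) (fun x => s x * f' x + s' x * f x).
Proof.
have bmM h j : bm_fun h -> bm_fun j -> bm_fun (fun x => h x * j x).
  by move=> [mh bh] [mj bj]; split; [exact: measurable_funM|exact: norm_boundedM].
have bmD h j : bm_fun h -> bm_fun j -> bm_fun (fun x => h x + j x).
  by move=> [mh bh] [mj bj]; split; [exact: measurable_funD|exact: norm_boundedD].
move=> [bf bf' ef]; split; [exact: bmM|by apply: bmD; exact: bmM|move=> l a].
pose lp := l ++ [seq (r * p.1, p.2) | p <- g].
pose lm := l ++ [seq (- r * p.1, p.2) | p <- g].
have e (x : R) : cos (x - pi / 2) = sin x by rewrite -sinDpihalf subrK.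
have e' (x : R) : sin (x - pi / 2) = - cos x by rewrite -{2}(subrK (pi / 2) x) cosDpihalf opprK.
pose c : R := k.+1%:R / 2; pose a' := a - pi / 2.
have cL j : (fun w => f w * ctrig j a' w) \in L2 by exact: bm_mulL (ctrigL j a').
have rL j : rhs_fun f f' j a' \in L2 by exact: rhsL.
have K0 : k.+1%:R != 0 :> R by rewrite pnatr_eq0.
have ap w : lin lp w + a' = (lin l w + a + lin g w / k.+1%:R) - pi / 2.
  by rewrite lin_cat lin_scale /a'; ring.
have am w : lin lm w + a' = (lin l w + a - lin g w / k.+1%:R) - pi / 2.
  by rewrite lin_cat lin_scale /a'; ring.
transitivity (c * (lhs f lp a' - lhs f lm a')).
  rewrite /lhs -dotpBr ?tenL// -dotpZr ?Lfun2B ?tenL//; congr dotp; apply/funext => p.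
  rewrite /tensor -mulrBl mulrA; congr (_ * _).
  by rewrite /ctrig ap am !e sinB [sin (_ + _ / _)]sinD /s /c; field.
rewrite (ef lp) (ef lm) -(dotpBr (rL lp) (rL lm) XL) -(dotpZr c (Lfun2B (rL lp) (rL lm)) XL).
congr dotp; apply/funext => w.
rewrite /rhs_fun /ctrig !test_funE ap am !e !e' /lp /lm !overlap_cat !overlap_scale.
rewrite sinB cosB [sin (_ + _ / _)]sinD [cos (_ + _ / _)]cosD /s /s' /c.
by field.
Qed.

Lemma scaled_sine_duality :
  dotZ (fun w => expR (s w)) =
  dotp P X (fun w => expR (s w) * bpos t w - s' w * expR (s w)).
Proof.
have [] := exp_closure dual_pair_lin dual_pair_lim bs.2 bs'.2 dual_pair_sine
  (norm_bounded_cst _ 1) (norm_bounded_cst _ 0) dual_pair1.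
move=> _ _ /(_ [::] 0); rewrite /lhs => E.
rewrite [LHS](_ : _ = dotZ (fun w => expR (s w) * 1 * ctrig [::] 0 w)).
  rewrite E; congr dotp; apply/funext => w; rewrite /rhs_fun /ctrig test_funE.
  by rewrite !linE /overlap !big_nil addr0 cos0 sin0; ring.
congr dotp; congr tensor; apply/funext => w.
by rewrite /ctrig linE big_nil addr0 cos0 !mulr1.
Qed.

End scaled_sine.

(** k sin (L / k) tends to L and its derivative kappa cos (L / k) to kappa, both
    under an integrable bound exponential in the values of B. *)
Theorem exponential_duality g :
  [/\ (fun w => expR (lin g w)) \in L2,
      (fun w => expR (lin g w) * (bpos t w - overlap g t)) \in L2 &
      dotZ (fun w => expR (lin g w)) =
      dotp P X (fun w => expR (lin g w) * (bpos t w - overlap g t))].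
Proof.
pose s k w := k.+1%:R * sin (lin g w / k.+1%:R).
pose s' k w := cos (lin g w / k.+1%:R) * overlap g t.
have s_le k w : `|s k w| <= abs_lin g w.
  rewrite /s normrM ger0_norm//; apply: le_trans (lin_le_abs g w).
  have [z _ ->] := sin_MVT (lin g w / k.+1%:R).
  rewrite -[X in _ <= `|X|](divfK (_ : k.+1%:R != 0)) ?pnatr_eq0// [leRHS]normrM.
  by rewrite normr_nat [leRHS]mulrC ler_wpM2l// normrM ler_piMl//; exact: cos_max.
have s_cvg w : s k w @[k --> \oo] --> lin g w by exact: sin_scale_cvg.
have s'_cvg w : s' k w @[k --> \oo] --> overlap g t.
  rewrite -[X in _ --> X]mul1r; apply: cvgM; last exact: cvg_cst.
  rewrite -[X in _ --> X](@cos0 R); apply: continuous_cvg; first exact: continuous_cos.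
  rewrite -[X in _ --> X](mulr0 (lin g w)); apply: cvgM; first exact: cvg_cst.
  exact: cvg_harmonic.
have es_cvg w : expR (s k w) @[k --> \oo] --> expR (lin g w).
  by apply: continuous_cvg => //; exact: continuous_expR.
have ms k : measurable_fun setT (fun w => expR (s k w)).
  apply: measurableT_comp => //; apply: measurable_funM => //.
  apply: measurableT_comp; first exact: continuous_measurable_fun (@continuous_sin R).
  by apply: measurable_funM => //; exact: measurable_lin.
have ms' k : measurable_fun setT (s' k).
  apply: measurable_funM => //.
  apply: measurableT_comp; first exact: continuous_measurable_fun (@continuous_cos R).
  by apply: measurable_funM => //; exact: measurable_lin.
have es_le k w : expR (s k w) <= expR (abs_lin g w).
  by rewrite ler_expR; apply: le_trans (ler_norm _) (s_le k w).
have aL l : (fun w => expR (abs_lin l w)) \in L2.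
  by have := exp_abs_lin_Lfun2 l ler01; under eq_fun do rewrite mul1r.
have esL k : (fun w => expR (s k w)) \in L2.
  by apply: (Lfun2_le (ms k) (aL g)) => w; rewrite !ger0_norm ?expR_ge0.
have esb k w : `|expR (s k w)| <= expR (abs_lin g w) by rewrite ger0_norm ?expR_ge0.
have [eL _] := L2_dominated_cvg ms (aL g) esb es_cvg.
have cl : dotZ (fun w => expR (s k w)) @[k --> \oo] --> dotZ (fun w => expR (lin g w)).
  exact: (dotZ_cvg (u_ := fun k w => expR (s k w)) (aL g) esL esb es_cvg).
pose v k w := expR (s k w) * bpos t w - s' k w * expR (s k w).
pose v' w := expR (lin g w) * (bpos t w - overlap g t).
have [vL cr] : v' \in L2 /\ dotp P X (v k) @[k --> \oo] --> dotp P X v'.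
  apply: (dotp_dominated_cvg (v_ := v) XL
    (Lfun2D (aL ((1, t) :: g)) (Lfun2Z `|overlap g t| (aL g)))) => [k|k w|w].
  - by apply: measurable_funB; apply: measurable_funM => //; exact: measurable_bpos.
  - apply: le_trans (ler_normB _ _) _; rewrite lerD//.
      rewrite /abs_lin big_cons normr1 mul1r addrC expRD normrM.
      rewrite ler_pM//.
      by apply: le_trans (expR_ge1Dx _); rewrite lerDr.
    rewrite normrM ler_pM// /s' normrM ler_piMl//; exact: cos_max.
  - rewrite /v' mulrBr [_ * overlap g t]mulrC; apply: cvgB.
      by apply: cvgM => //; exact: cvg_cst.
    exact: cvgM.
split => //.
apply: (@cvg_unique _ _ (dotZ (fun w => expR (s k w)) @[k --> \oo])) => //.
rewrite (_ : (fun k => dotZ _) = (fun k => dotp P X (v k)))//.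
by apply/funext => k; exact: scaled_sine_duality.
Qed.

End fixed_time.
End exponential_duality.

(** * The Malliavin derivative of the limit *)

Section nonintegrable.
Context (R : realType) d (T : measurableType d) (m : {measure set T -> \bar R}).

(** One of the two parts has infinite integral, and fine is 0 there. *)
Lemma Rintegral_nonintegrable (f : T -> R) : measurable_fun setT f ->
  ~ m.-integrable setT (EFin \o f) -> \int[m]_x f x = 0.
Proof.
move=> mf nf; rewrite /Rintegral; have [fi|] := boolP ((\int[m]_x (f x)%:E)%E \is a fin_num); last first.
  by move: (integral _ _ _) => [r| |]//; rewrite fin_numE.
exfalso; apply: nf; apply/integrableP; split; first exact/measurable_EFinP.
move: fi; rewrite integralE fin_numB => /andP[fp fn].
have mE : measurable_fun setT (EFin \o f) by exact/measurable_EFinP.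
under eq_integral do rewrite -/((abse \o (EFin \o f)) _).
rewrite fune_abse ge0_integralD//.
- by apply: lte_add_pinfty; rewrite ltey_eq; apply/orP; left; [exact: fp|exact: fn].
- exact: measurable_funepos.
- exact: measurable_funeneg.
Qed.

(** The sections Z (., s) are integrable only for almost every s; this form of
    linearity holds for every s. *)
Lemma RintegralZr_measurable (f : T -> R) (c : R) : measurable_fun setT f ->
  \int[m]_x (f x * c) = (\int[m]_x f x) * c.
Proof.
move=> mf; have [fi|nf] := pselect (m.-integrable setT (EFin \o f)).
  by rewrite RintegralZr.
have [->|c0] := eqVneq c 0.
  by under eq_Rintegral do rewrite mulr0; rewrite Rintegral_cst// mul0r mulr0.
rewrite (Rintegral_nonintegrable mf nf) mul0r Rintegral_nonintegrable//.
  exact: measurable_funM.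
move=> fci; apply: nf; have := integrableZ_EFin c^-1 fci.
rewrite (_ : (fun x => _) = f)//.
by apply/funext => x; rewrite mulrC mulfK.
Qed.

End nonintegrable.

Section step_functions.
Context (R : realType).
Local Notation mu := (@lebesgue_measure R).

Definition half_line : set (measurableTypeR R) := `[0%R, +oo[%classic.

Lemma measurable_half_line : measurable half_line.
Proof. exact: measurable_itv. Qed.

Definition time_measure : {measure set (measurableTypeR R) -> \bar R} :=
  mrestr mu measurable_half_line.

Local Notation L2 := (Lfun time_measure 2%:E).

Definition initial (t : R) : measurableTypeR R -> R := \1_(`]0%R, tpos t]%classic).
Definition initial_sum (l : seq (R * R)) (s : R) : R := \sum_(p <- l) p.1 * initial p.2 s.

(** On the half-line 1_(b, c] is 1_(0, max b c] - 1_(0, b], also when it is 0. *)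
Definition increments (g : step R) : seq (R * R) :=
  flatten [seq [:: (p.1.1, Num.max p.1.2 p.2); (- p.1.1, p.1.2)] | p <- g].

Lemma big_increments (F : R * R -> R) (g : step R) :
  \sum_(q <- increments g) F q =
  \sum_(p <- g) (F (p.1.1, Num.max p.1.2 p.2) + F (- p.1.1, p.1.2)).
Proof.
rewrite /increments; elim: g => [|p g IH]; first by rewrite !big_nil.
by rewrite /= !big_cons IH addrA.
Qed.

Lemma step_funE (g : step R) (s : R) : 0 < s -> step_fun g s = initial_sum (increments g) s.
Proof.
move=> s0; rewrite /initial_sum big_increments; apply: eq_bigr => -[[a b] c] _ /=.
rewrite mulNr -mulrBr; congr (_ * _); rewrite /initial !indicE !mem_setE !in_itv/= s0 /=.
rewrite /tpos !le_max (leNgt s 0) s0 /=.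
case: (leP s b) => sb /=; first by rewrite subrr.
by rewrite subr0.
Qed.

Lemma measurable_initial t : measurable_fun setT (initial t).
Proof. by apply: measurable_indic; exact: measurable_itv. Qed.

Lemma initialM (x y : R) s :
  initial x s * initial y s = \1_(`]0%R, Num.min (tpos x) (tpos y)]%classic) s :> R.
Proof.
rewrite /initial !indicE !mem_setE !in_itv/= le_min.
by case: (0 < s); case: (s <= tpos x); case: (s <= tpos y); rewrite /= ?mulr0 ?mulr1.
Qed.

Lemma initial_Lfun2 x : initial x \in L2.
Proof.
apply/Lfun2P; split; first exact: measurable_initial.
apply/integrableP; split.
  by apply/measurable_EFinP; apply: measurable_funX; exact: measurable_initial.
rewrite integral_mrestr//; last first.
  apply: measurableT_comp => //; apply/measurable_EFinP; apply: measurable_funX.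
  exact: measurable_initial.
under eq_integral do rewrite /= expr2 initialM ger0_norm//.
by rewrite integral_time_indic ?ltry// le_min !tpos_ge0.
Qed.

Lemma dotp_initial x y : dotp time_measure (initial x) (initial y) =
  Num.min (tpos x) (tpos y).
Proof.
rewrite /dotp Rintegral_mrestr; last by apply: Lfun2_integrableM; exact: initial_Lfun2.
under eq_Rintegral do rewrite initialM.
by rewrite /Rintegral integral_time_indic/= ?subr0// le_min !tpos_ge0.
Qed.

Lemma initial_sum_Lfun2 l : initial_sum l \in L2.
Proof. by apply: Lfun2_sum => p; apply: Lfun2Z; exact: initial_Lfun2. Qed.

Lemma time_measure_pos_ae : {ae time_measure, forall s : measurableTypeR R, 0 < s}.
Proof.
exists `]-oo, 0%R]%classic; split; first exact: measurable_itv.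
  rewrite (_ : time_measure _ = mu (`]-oo, 0%R]%classic `&` half_line))//.
  rewrite (_ : _ `&` half_line = [set 0 : R]) ?lebesgue_measure_set1//.
  apply/seteqP; split=> s; rewrite /half_line /= !in_itv/= ?andbT.
    by move=> [s0 s1]; apply/eqP; rewrite eq_le s0 s1.
  by move=> ->; rewrite lexx.
by move=> s /= /negP; rewrite -leNgt in_itv.
Qed.

Lemma step_pairing (g h : step R) :
  \int[mu]_(s in `[0%R, +oo[) (step_fun g s * step_fun h s) =
  \sum_(q <- increments h) q.1 * overlap (increments g) q.2.
Proof.
have sE k : {ae time_measure, forall s : measurableTypeR R, step_fun k s = initial_sum (increments k) s}.
  by apply: filterS time_measure_pos_ae => s; exact: step_funE.
have sL k : (step_fun k : measurableTypeR R -> R) \in L2.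
  apply: Lfun2_ae_eq (initial_sum_Lfun2 (increments k)) (sE k).
  apply: measurable_sum => p; apply: measurable_funM; first exact: measurable_cst.
  have mI : measurable (`]p.1.2, p.2]%classic : set (measurableTypeR R)) by exact: measurable_itv.
  exact: (measurable_indic mI).
have iL k := initial_sum_Lfun2 (increments k).
transitivity (dotp time_measure (step_fun g) (step_fun h)).
  by rewrite /dotp Rintegral_mrestr//; exact: Lfun2_integrableM.
rewrite (dotp_ae_eq (sL g) (iL g) (sL h) (sE g)) dotpC.
rewrite (dotp_ae_eq (sL h) (iL h) (iL g) (sE h)) dotpC.
have ZL (p : R * R) : (fun s => p.1 * initial p.2 s) \in L2.
  by apply: Lfun2Z; exact: initial_Lfun2.
pose F (p : R * R) (s : measurableTypeR R) := p.1 * initial p.2 s.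
rewrite (dotp_sumr (increments h) (F := F) ZL (iL g)); apply: eq_bigr => q _.
rewrite dotpZr ?initial_Lfun2//; congr (_ * _).
rewrite dotpC (dotp_sumr (increments g) (F := F) ZL (initial_Lfun2 q.2)).
by apply: eq_bigr => p _; rewrite dotpZr ?initial_Lfun2// dotp_initial.
Qed.

End step_functions.

Section malliavin_identity.
Context (R : realType) d (T : measurableType d) (P : probability T R).
Context (B : R -> {RV P >-> R}) (bm : brownian_motion B).
Context (Z : T * R -> R) (X : T -> R).
Context (ZL : Z \in Lfun (P_time P) 2%:E) (XL : X \in Lfun P 2%:E).
Context (Z0 : forall w s, s <= 0 -> Z (w, s) = 0).
Context (dual : forall g a t,
  dotp (P_time P) Z (trig B g a t) = dotp P X (test_fun B g a t)).

Local Notation mu := (@lebesgue_measure R).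
Local Notation lin := (lin B).
Local Notation bpos := (bpos B).

Lemma wiener_intE (g : step R) w : wiener_int B g w = lin (increments g) w.
Proof.
rewrite linE big_increments; apply: eq_bigr => p _ /=.
by rewrite mulNr -mulrBr.
Qed.

(** The pairing of Z with a Wick exponential times 1_(0,t] is known by
    exponential_duality; both sides of the defining identity are linear in h,
    and h is for s > 0 a combination of such indicators. At s = 0 it may differ
    from that combination, but Z vanishes there. *)
Lemma malliavin_derivative_of_dual : malliavin_derivative_of B X Z.
Proof.
split => // g h; set G := increments g; set H := increments h.
set K := expR (- (2^-1 * \int[mu]_(s in `[0%R, +oo[) (step_fun g s ^+ 2))).
have wE w : wick_exp B g w = K * expR (lin G w).
  by rewrite /wick_exp wiener_intE expRD mulrC.
have eL : (fun w => expR (lin G w)) \in Lfun P 2%:E.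
  by have [] := exponential_duality bm ZL XL dual 0 G.
have ebL t : (fun w => expR (lin G w) * (bpos t w - overlap G t)) \in Lfun P 2%:E.
  by have [] := exponential_duality bm ZL XL dual t G.
have edual t : dotp (P_time P) Z (tensor (fun w => expR (lin G w)) 0 (tpos t)) =
    dotp P X (fun w => expR (lin G w) * (bpos t w - overlap G t)).
  by have [] := exponential_duality bm ZL XL dual t G.
pose v (p : T * measurableTypeR R) :=
  \sum_(q <- H) (q.1 * K) * tensor (fun w => expR (lin G w)) 0 (tpos q.2) p.
have tL q : (fun p => (q.1 * K) * tensor (fun w => expR (lin G w)) 0 (tpos q.2) p)
    \in Lfun (P_time P) 2%:E.
  by apply: Lfun2Z; apply: Lfun2_tensor => //; exact: tpos_ge0.
have vL : v \in Lfun (P_time P) 2%:E by exact: Lfun2_sum.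
have vE w s : v (w, s) = wick_exp B g w * initial_sum H s.
  rewrite /v wE /initial_sum mulr_sumr; apply: eq_bigr => q _.
  by rewrite /tensor /initial /=; ring.
transitivity (dotp (P_time P) Z v).
  rewrite /dotp; have [_ ->] := P_time_Fubini (Lfun2_integrableM ZL vL).
  apply: eq_Rintegral => s; rewrite inE/= in_itv/= andbT => s0.
  have mZ : measurable_fun setT (fun w => Z (w, s) * wick_exp B g w).
    apply: measurable_funM.
      apply: (measurableT_comp (Lfun2_measurable ZL)).
      exact: measurable_fun_pair.
    rewrite (_ : wick_exp B g = fun w => K * expR (lin G w)); last exact/funext.
    by apply: measurable_funM => //; exact: Lfun2_measurable eL.
  have -> : \int[P]_w (Z (w, s) * v (w, s)) =
      (\int[P]_w (Z (w, s) * wick_exp B g w)) * initial_sum H s.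
    rewrite -RintegralZr_measurable//; apply: eq_Rintegral => w _.
    by rewrite vE mulrA.
  rewrite /S_transform; move: s0; rewrite le_eqVlt => /predU1P[<-|s0].
    rewrite (_ : \int[P]_w (Z (w, 0) * _) = 0) ?mul0r//.
    under eq_Rintegral do rewrite Z0// mul0r.
    by rewrite Rintegral_cst// mul0r.
  by rewrite step_funE.
rewrite dotp_sumr//.
transitivity (dotp P X (fun w => \sum_(q <- H) (q.1 * K) *
    (expR (lin G w) * (bpos q.2 w - overlap G q.2)))).
  rewrite dotp_sumr//; last by move=> q; exact: Lfun2Z.
  apply: eq_bigr => q _; rewrite !dotpZr//; first by rewrite edual.
  by apply: Lfun2_tensor => //; exact: tpos_ge0.
apply: eq_Rintegral => w _; rewrite step_pairing wiener_intE wE -!mulrA; congr (_ * _).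
rewrite linE -sumrB !mulr_sumr; apply: eq_bigr => q _.
by rewrite -mulrBr; ring.
Qed.

End malliavin_identity.

(** * The equivalence *)

Section weak_limits.
Context (R : realType) d (T : measurableType d) (m : {measure set T -> \bar R}).
Local Notation L2 := (Lfun m 2%:E).
Local Notation dot := (dotp m).
Local Notation nrm := (L2norm m).

Lemma weakly_converges_dotp (f_ : nat -> T -> R) f : weakly_converges_L2 m f_ f ->
  forall g, g \in L2 -> dot (f_ k.+1) g @[k --> \oo] --> dot f g.
Proof.
move=> [_ _ fc] g gL; have := fc g gL.
by rewrite -(cvg_shiftS (fun n => dot (f_ n) g)).
Qed.

Lemma weakly_converges_shift (f_ : nat -> T -> R) f :
  (forall k, f_ k.+1 \in L2) -> f \in L2 ->
  (forall g, g \in L2 -> dot (f_ k.+1) g @[k --> \oo] --> dot f g) ->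
  weakly_converges_L2 m f_ f.
Proof.
move=> fnL fL fc; split => [[//|k] _| |g gL]; [exact: fnL|exact: fL|].
by have := fc g gL; rewrite (cvg_shiftS (fun n => dot (f_ n) g)).
Qed.

Lemma weakly_converges_bounded (f_ : nat -> T -> R) f : weakly_converges_L2 m f_ f ->
  exists M : R, forall k, nrm (f_ k.+1) <= M.
Proof.
move=> /[dup] fw [fL _ _]; apply: L2_uniform_boundedness => [k|g gL].
  exact: fL.
have cg := weakly_converges_dotp fw gL.
have /cvg_has_ub[M /ubP Mb] : cvgn (fun k => dot (f_ k.+1) g).
  by apply/cvg_ex; exists (dot f g).
by exists M => n; apply: Mb; exists n.
Qed.

Context (Z_ : nat -> T -> R) (C : R).
Context (ZL : forall k, Z_ k \in L2) (ZC : forall k, nrm (Z_ k) <= C).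

Definition pairing_cvg (v : T -> R) := cvgn (fun k => dot (Z_ k) v).

Lemma pairing_cvg_lin a f g : f \in L2 -> g \in L2 ->
  pairing_cvg f -> pairing_cvg g -> pairing_cvg (fun x => a * f x + g x).
Proof.
move=> fL gL /cvg_ex[lf fc] /cvg_ex[lg gc]; apply/cvg_ex; exists (a * lf + lg).
rewrite (_ : (fun k => _) = (fun k => a * dot (Z_ k) f + dot (Z_ k) g)); last first.
  by apply/funext => k; rewrite dotpDr ?Lfun2Z// dotpZr.
by apply: cvgD => //; apply: cvgM => //; exact: cvg_cst.
Qed.

(** The pairings with f are a Cauchy sequence, being uniformly close to the
    pairings with some f_ N. *)
Lemma pairing_cvg_closed (f_ : nat -> T -> R) f : (forall n, f_ n \in L2) -> f \in L2 ->
  (forall n, pairing_cvg (f_ n)) -> nrm (fun x => f_ n x - f x) @[n --> \oo] --> 0 ->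
  pairing_cvg f.
Proof.
move=> fnL fL fc ff; apply: cauchy_cvg; apply: cauchy_exP => e e0.
have e2 : 0 < e / 2 by lra.
have : C * nrm (fun x => f_ n x - f x) @[n --> \oo] --> 0.
  by rewrite -[X in _ --> X](mulr0 C); apply: cvgM => //; exact: cvg_cst.
move=> /cvgrPdist_lt /(_ _ e2)[N _ /(_ N)]; rewrite /= sub0r normrN => /(_ (leqnn _)) HN.
have /cvg_ex[l /cvgrPdist_lt /(_ _ e2) lc] := fc N.
exists l; near=> k; rewrite /ball/=.
have H1 : `|l - dot (Z_ k) (f_ N)| < e / 2 by near: k.
have H2 : `|dot (Z_ k) (f_ N) - dot (Z_ k) f| <= C * nrm (fun x => f_ N x - f x).
  rewrite -dotpBr//; apply: le_trans (L2_CauchySchwarz (ZL k) (Lfun2B (fnL N) fL)) _.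
  by rewrite ler_wpM2r ?L2norm_ge0.
rewrite -(subrKA (dot (Z_ k) (f_ N))) (splitr e).
apply: le_lt_trans (ler_normD _ _) _; apply: ltrD => //.
by apply: le_lt_trans H2 _; apply: le_lt_trans (ler_norm _) HN.
Unshelve. all: by end_near.
Qed.

(** The limit of the pairings is a bounded linear form. *)
Lemma bounded_weak_limit : (forall v, v \in L2 -> pairing_cvg v) ->
  exists2 Z, Z \in L2 & forall v, v \in L2 -> dot (Z_ k) v @[k --> \oo] --> dot Z v.
Proof.
move=> Vc; pose l v := limn (fun k => dot (Z_ k) v).
have lc v : v \in L2 -> dot (Z_ k) v @[k --> \oo] --> l v by move=> /Vc.
have [a f g fL gL|f fL|Z ZL2 lZ] := @L2_Riesz _ _ _ m l C.
- apply: cvg_lim => //.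
  rewrite (_ : (fun k => _) = (fun k => a * dot (Z_ k) f + dot (Z_ k) g)); last first.
    by apply/funext => k; rewrite dotpDr ?Lfun2Z// dotpZr.
  by apply: cvgD; [apply: cvgM; [exact: cvg_cst|exact: lc]|exact: lc].
- apply: (cvg_le _ (cvg_norm (lc _ fL))) => k.
  apply: le_trans (L2_CauchySchwarz (ZL k) fL) _.
  by rewrite ler_wpM2r ?L2norm_ge0.
by exists Z => // v vL; rewrite -lZ//; exact: lc.
Qed.

End weak_limits.

Section equivalence.
Context (R : realType) d (T : measurableType d) (P : probability T R).
Context (B : R -> {RV P >-> R}) (bm : brownian_motion B).
Context d' (T' : measurableType d') (P' : probability T' R).
Context (xi : {RV P' >-> R}) (xin : nat -> nat -> {RV P >-> R}).
Context (Xn : nat -> T -> R) (X : T -> R).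
Context (cbf : completed_brownian_field B).
Context (xiL : (xi : T' -> R) \in Lfun P' 2%:E).
Context (xi0 : ('E_P'[xi] = 0)%E) (xi1 : ('V_P'[xi] = 1)%E).
Context (indep : forall n, pos_nat n -> mutually_independent P pos_nat (xin n)).
Context (law : forall n i, pos_nat n -> pos_nat i ->
  forall A : set R, measurable A -> distribution P (xin n i) A = distribution P' xi A).
Context (walk_cvg : forall t : R, 0 <= t ->
  cvg_in_probability P (fun n => random_walk xin n t) (B t)).
Context (Xw : weakly_converges_L2 P Xn X).
Context (XD : forall n, pos_nat n -> in_D12n P xin n (Xn n)).

Local Notation L2t := (Lfun (P_time P) 2%:E).

Let D n := disc_malliavin P xin n (Xn n).

Let D0 n : D n 0 = cst 0. Proof. by []. Qed.

Let DL k i : D k.+1 i \in Lfun P 2%:E.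
Proof.
have [_ [h _]] := XD (ltn0Sn k : pos_nat k.+1).
by have [->|i0] := posnP i; [rewrite D0; exact: Lfun_cst|case: (h i i0)].
Qed.

Let Dfin k : (L2n_sqnorm P k.+1 (D k.+1) < +oo)%E.
Proof. by have [_ []] := XD (ltn0Sn k : pos_nat k.+1). Qed.

Let process n := disc_malliavin_process P xin n (Xn n).

Let processE n : process n = step_process (D n) n. Proof. by []. Qed.

Let processL k : process k.+1 \in L2t.
Proof. by rewrite processE; exact: Lfun2_step_process. Qed.

Let XnL k : Xn k.+1 \in Lfun P 2%:E. Proof. by case: Xw => h _ _; exact: h. Qed.
Let XL : X \in Lfun P 2%:E. Proof. by case: Xw. Qed.

(** A weakly convergent sequence is bounded. *)
Lemma norm_bound_of_weak_cvg (Z : T * R -> R) :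
  weakly_converges_L2 (P_time P) process Z ->
  (ereal_sup [set L2n_sqnorm P n (D n) | n in pos_nat] < +oo)%E.
Proof.
move=> /weakly_converges_bounded[M ZM].
have M0 : 0 <= M by exact: le_trans (L2norm_ge0 _ _) (ZM 0%N).
apply: (@le_lt_trans _ _ (M ^+ 2)%:E); last exact: ltry.
apply: ge_ereal_sup => _ [[//|k] _ <-].
rewrite -integral_step_process_sqr// -processE -L2norm_int//.
by rewrite lee_fin lerXn2r ?nnegrE ?L2norm_ge0.
Qed.

Section bounded_derivatives.
Context (C : R) (DC : forall k, (L2n_sqnorm P k.+1 (D k.+1) <= C%:E)%E).

Let ZC k : L2norm (P_time P) (process k.+1) <= Num.sqrt C.
Proof. by rewrite processE; exact: step_process_norm_le. Qed.

(** On the discrete side this is the pairing of X^n with the discrete test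
    function, where weak convergence meets strong convergence. *)
Lemma process_trig_cvg g a t :
  dotp (P_time P) (process k.+1) (trig B g a t) @[k --> \oo] -->
  dotp P X (test_fun B g a t).
Proof.
have [M XM] := weakly_converges_bounded Xw.
have [wL tL wc] := test_funw_cvg bm xiL xi0 xi1 indep law walk_cvg g a t.
have rc := dotp_cvg_weak_strong XnL wL tL XM (weakly_converges_dotp Xw tL) wc.
have lc := linw_cvg bm xiL xi0 xi1 indep law walk_cvg g.
pose delta k := mass g * (Num.sqrt k.+1%:R)^-1 +
  L2norm P (fun w => linw xin k.+1 g w - lin B g w).
have dc : delta k @[k --> \oo] --> 0.
  rewrite -[X in _ --> X]addr0; apply: cvgD => //.
  rewrite -[X in _ --> X](mulr0 (mass g)); apply: cvgM; first exact: cvg_cst.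
  exact: invsqrt_cvg.
have [VL V1] := trig_base_Lfun2 B g a.
have bound k : `|dotp (P_time P) (process k.+1) (trig B g a t) -
    dotp P (Xn k.+1) (test_funw xin k.+1 g a t)| <=
    delta k * (tpos t + C) + Num.sqrt C * Num.sqrt k.+1%:R^-1.
  rewrite -(disc_malliavin_duality xiL xi0 xi1 law k g a t (XnL k)).
  apply: (step_process_pairing_le _ _ _ (DC k)) => // i.
    by have [] := leave_one_out_Lfun2 xin k.+1 g a i.
  exact: (leave_one_out_dist bm xiL xi0 xi1 law).
rewrite (_ : (fun k => _) = (fun k =>
    (dotp (P_time P) (process k.+1) (trig B g a t) -
      dotp P (Xn k.+1) (test_funw xin k.+1 g a t)) +
    dotp P (Xn k.+1) (test_funw xin k.+1 g a t))); last first.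
  by apply/funext => k; rewrite subrK.
rewrite -[X in _ --> X]add0r; apply: cvgD => //.
apply: (norm_le_cvg0 bound).
rewrite -[X in _ --> X]addr0; apply: cvgD.
  rewrite -[X in _ --> X](mul0r (tpos t + C)); apply: cvgM => //; exact: cvg_cst.
rewrite -[X in _ --> X](mulr0 (Num.sqrt C)); apply: cvgM; first exact: cvg_cst.
under eq_fun do rewrite sqrtrV//; exact: invsqrt_cvg.
Qed.

(** Totality extends the convergence of the pairings from trigonometric
    processes to all of L2; the weak limit is then set to 0 at the negligible
    times s <= 0. *)
Lemma malliavin_weak_limit : exists DX : T * R -> R,
  malliavin_derivative_of B X DX /\ weakly_converges_L2 (P_time P) process DX.
Proof.
have ZL k := processL k.
have all_cvg v : v \in L2t -> pairing_cvg (P_time P) (fun k => process k.+1) v.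
  apply: (trigonometric_total cbf) v => [a f g fL gL|f_ f fnL fL Vf fc|g a t].
  - exact: pairing_cvg_lin.
  - refine (@pairing_cvg_closed R _ _ (P_time P) (fun k => process k.+1)
      _ ZL ZC f_ f fnL fL Vf fc).
  - by apply/cvg_ex; exists (dotp P X (test_fun B g a t)); exact: process_trig_cvg.
have [Z ZL2 Zc] := bounded_weak_limit ZL ZC all_cvg.
(* the defining identity of the derivative is checked pointwise in s, and Z (w, 0)
   is arbitrary *)
pose Z' (p : T * measurableTypeR R) := Z p * \1_(`]0%R, +oo[%classic : set R) p.2.
have mI : measurable_fun setT (fun p : T * measurableTypeR R => \1_(`]0%R, +oo[%classic : set R) p.2 : R).
  by apply: measurableT_comp => //; exact: measurable_indic.
have Z'L : Z' \in L2t.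
  apply: (Lfun2_le _ ZL2) => [|p].
    by apply: measurable_funM => //; exact: Lfun2_measurable ZL2.
  by rewrite normrM ler_piMr// indicE; case: (_ \in _); rewrite ?normr1 ?normr0.
have Z'E : {ae P_time P, forall p, Z p = Z' p}.
  apply: filterS (P_time_pos_ae P) => p p0.
  by rewrite /Z' indicE mem_set ?mulr1//= in_itv/= p0.
have Z'c v : v \in L2t -> dotp (P_time P) (process k.+1) v @[k --> \oo] -->
    dotp (P_time P) Z' v.
  by move=> vL; rewrite -(dotp_ae_eq ZL2 Z'L vL Z'E); exact: Zc.
exists Z'; split; last first.
  exact: (weakly_converges_shift ZL Z'L Z'c).
apply: (malliavin_derivative_of_dual bm Z'L XL) => [w s s0|g a t].
  rewrite /Z' indicE memNset ?mulr0//= in_itv/= andbT => s1.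
  by move: s0; rewrite leNgt s1.
have c1 := Z'c _ (trig_Lfun2 B g a t); have c2 := @process_trig_cvg g a t.
by rewrite -(cvg_lim _ c1)// -(cvg_lim _ c2).
Qed.

End bounded_derivatives.

Lemma weak_cvg_of_norm_bound :
  (ereal_sup [set L2n_sqnorm P n (D n) | n in pos_nat] < +oo)%E ->
  exists DX : T * R -> R,
  malliavin_derivative_of B X DX /\ weakly_converges_L2 (P_time P) process DX.
Proof.
move=> sup_fin.
have ub k : (L2n_sqnorm P k.+1 (D k.+1) <=
    ereal_sup [set L2n_sqnorm P n (D n) | n in pos_nat])%E.
  by apply: ereal_sup_ubound; exists k.+1.
move: sup_fin ub; case: (ereal_sup _) => [C _ ub|//|_ ub].
  exact: malliavin_weak_limit ub.
apply: (@malliavin_weak_limit 0) => k; apply: le_trans (ub k) _; exact: leNye.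
Qed.

End equivalence.

Theorem theorem13 (R : realType)
    (d : measure_display) (T : measurableType d) (P : probability T R)
    (B : R -> {RV P >-> R})
    (d' : measure_display) (T' : measurableType d') (P' : probability T' R)
    (xi : {RV P' >-> R})
    (xin : nat -> nat -> {RV P >-> R})
    (Xn : nat -> T -> R) (X : T -> R) :
  brownian_motion B ->
  completed_brownian_field B ->
  (xi : T' -> R) \in Lfun P' 2%:E ->
  ('E_P'[xi] = 0)%E ->
  ('V_P'[xi] = 1)%E ->
  (forall n, pos_nat n -> mutually_independent P pos_nat (xin n)) ->
  (forall n i, pos_nat n -> pos_nat i -> forall A : set R, measurable A ->
     distribution P (xin n i) A = distribution P' xi A) ->
  (forall t : R, 0 <= t ->
     cvg_in_probability P (fun n => random_walk xin n t) (B t)) ->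
  weakly_converges_L2 P Xn X ->
  (forall n, pos_nat n -> in_D12n P xin n (Xn n)) ->
  (ereal_sup [set L2n_sqnorm P n (disc_malliavin P xin n (Xn n))
              | n in pos_nat] < +oo)%E
  <->
  (exists DX : T * R -> R,
     malliavin_derivative_of B X DX /\
     weakly_converges_L2 (P_time P)
       (fun n => disc_malliavin_process P xin n (Xn n)) DX).
Proof.
move=> bm cbf xiL xi0 xi1 indep law walk_cvg Xw XD; split.
  exact: (weak_cvg_of_norm_bound bm cbf xiL xi0 xi1 indep law walk_cvg Xw XD).
by move=> [DX [_ Zw]]; exact: (norm_bound_of_weak_cvg XD Zw).
Qed.
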